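(* Let $n\geq0$, fix $(a,c)\in f\mathcal{D}^\circ(n)\times\mathcal{C}(n)$ and write $\mathrm{Map}_\partial(|a|,|c|)$ for the fibre of $\mathcal{E}^\circ(n)$ over $(a,c)$. Then there is a neighbourhood $U$ of $(a,c)$ in $f\mathcal{D}^\circ(n)\times\mathcal{C}(n)$ over which there is a fibrewise homotopy equivalence (over $U$) \[\mathcal{E}^\circ(n)|U\simeq U\times\mathrm{Map}_\partial(|a|,|c|).\]
   Context: Framed little discs. $D^2$ is the closed unit disc and $S^1$ its boundary, with basepoint $\ast$. $f\mathcal{D}(n)$ is the space of embeddings $a=(a_1,\ldots,a_n)\colon\bigsqcup_{i=1}^nD^2\to D^2$ for which each $a_i$ is given by a combination of translation, rotation and (positive) rescaling. The realization $|a|\subset D^2$ is $D^2$ with the interiors of the little discs $a_i(D^2)$ deleted; boundary maps are $\partial_i=a_i|_{S^1}\colon S^1\to|a|$ and $\partial_{\mathrm{out}}\colon S^1\hookrightarrow|a|$ the inclusion. $f\mathcal{D}^\circ(n)\subset f\mathcal{D}(n)$ consists of the elements whose little discs do not meet the boundary of the big disc $D^2$. Cacti. Write $S^1=\mathbb{R}/\mathbb{Z}=I/\partial I$. For $n\geq1$, $\mathcal{F}(n)$ is the set of partitions $x$ of $S^1$ into $n$ closed $1$-manifolds $I_1(x),\ldots,I_n(x)$ of equal length with pairwise disjoint interiors, such that there is no cyclically ordered sequence $z_1,z_2,z_3,z_4$ in $S^1$ with $z_1,z_3\in\mathrm{int}\,I_j(x)$, $z_2,z_4\in\mathrm{int}\,I_k(x)$,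 $j\neq k$; $\mathcal{F}(0)=\ast$. For $x\in\mathcal{F}(n)$, collapsing each component of $\overline{S^1\setminus I_j(x)}$ to a point and rescaling the quotient to identify it with $S^1$ gives a based map $\pi_j\colon S^1\to S^1$, and $c(x)=(\pi_1,\ldots,\pi_n)\colon S^1\to(S^1)^n$. $\mathrm{Mon}(I,\partial I)$ is the space of nondecreasing maps $I\to I$ preserving $\partial I$, regarded as based maps $S^1\to S^1$. $L_z$ is translation by $z\in S^1$. For $f\in\mathrm{Mon}(I,\partial I)$, $\underline z\in(S^1)^n$ put $c(x,f,\underline z)=(L_{z_1}\times\cdots\times L_{z_n})\circ c(x)\circ f$. $\mathcal{C}(n)\subset\mathrm{Map}(S^1,(S^1)^n)$ (compact-open topology) is the subspace of all $c(x,f,\underline z)$. The realization of $c\in\mathcal{C}(n)$ is $|c|=c(S^1)\subset(S^1)^n$. If $c=c(x,f,\underline z)$, the image of $I_i(x)$ under $(L_{z_1}\times\cdots\times L_{z_n})\circ c(x)$ is $\{x^i_1\}\times\cdots\times S^1\times\cdots\times\{x^i_n\}$ ($S^1$ in position $i$), and $\partial_i\colon S^1\to|c|$ is $y\mapsto(x_1^i,\ldots,y,\ldots,x_n^i)$; also $\partial_{\mathrm{out}}=c\colon S^1\to|c|$. The space $\mathcal{E}^\circ(n)$ is the set of triples $(a,c,f)$ with $a\in f\mathcal{D}^\circ(n)$, $c\in\mathcal{C}(n)$ and $f\colon|a|\to|c|$ a homotopy equivalence satisfying $f\circ\partial_i=\partial_i$ ($1\leq i\leq n$) and $f\circ\partial_{\mathrm{out}}=\partial_{\mathrm{out}}$;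 it maps to $f\mathcal{D}^\circ(n)\times\mathcal{C}(n)$ by $(a,c,f)\mapsto(a,c)$. Let $B=f\mathcal{D}^\circ(n)\times\mathcal{C}(n)$, and let $U',V'\to B$ be the pullbacks to $B$ of $\{(a,z)\in f\mathcal{D}^\circ(n)\times D^2: z\in|a|\}$ and $\{(c,\mathbf z)\in\mathcal{C}(n)\times(S^1)^n:\mathbf z\in|c|\}$. $\mathcal{E}^\circ(n)$ is topologized as a subspace of the fibrewise mapping space $\mathrm{Map}_B(U',V')$ of pairs $(b,f)$, $b\in B$, $f\colon U'_b\to V'_b$ continuous, whose topology is generated by the sets $\{(b,f): b\in W, f(K_b)\subset O_b\}$ with $W\subset B$ open, $K\subset U'|_W$ fibrewise compact over $W$ (i.e. $K\to W$ closed with compact fibres), and $O\subset V'|_W$ open. *)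

(* Defs.v *)
From HB Require Import structures.
From mathcomp Require Import all_boot all_order all_algebra.
From mathcomp Require Import all_classical all_reals all_analysis.

Set Implicit Arguments.
Unset Strict Implicit.
Unset Printing Implicit Defensive.

Import Order.TTheory GRing.Theory Num.Theory.
Import numFieldNormedType.Exports.

Local Open Scope classical_set_scope.
Local Open Scope ring_scope.

(* Subspaces are the types [set_type A] of the library (with the initial
   topology for the inclusion [set_val]); a set is coerced to that type. *)

Section Topology.

Definition homeomorphic (X Y : topologicalType) : Prop :=
  exists (f : X -> Y) (g : Y -> X),
    [/\ continuous f, continuous g, cancel f g & cancel g f].

Definition embedding (X Y : topologicalType) (f : X -> Y) : Prop :=
  [/\ continuous f, injective f &
      forall O : set X, open O -> exists2 O' : set Y, open O' & O = f @^-1` O'].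

(* [A] is a 1-manifold, possibly with boundary: it is locally homeomorphic to
   the half-line. *)
Definition manifold1 (R : realType) (X : topologicalType) (A : set X) : Prop :=
  forall x, A x -> exists (O : set X) (P : set R),
    [/\ open O, O x, open P &
        homeomorphic (A `&` O : set X) (`[0, +oo[%classic `&` P : set R)].

End Topology.

Section Homotopy.
Context {R : realType}.

Definition unit_interval : set R := `[0, 1]%classic.

Lemma unit0_subproof : (0 : R) \in unit_interval.
Proof. by rewrite inE /unit_interval/= in_itv/= lexx ler01. Qed.

Lemma unit1_subproof : (1 : R) \in unit_interval.
Proof. by rewrite inE /unit_interval/= in_itv/= lexx ler01. Qed.

Definition unit0 : unit_interval := exist _ 0 unit0_subproof.
Definition unit1 : unit_interval := exist _ 1 unit1_subproof.

Definition homotopic (X Y : topologicalType) (f g : X -> Y) : Prop :=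
  exists H : X * unit_interval -> Y,
    [/\ continuous H, forall x, H (x, unit0) = f x &
        forall x, H (x, unit1) = g x].

Definition homotopy_equivalence (X Y : topologicalType) (f : X -> Y) : Prop :=
  continuous f /\
  exists g : Y -> X,
    [/\ continuous g, homotopic (g \o f) id & homotopic (f \o g) id].

(* Homotopy between two self-maps of a space [p : X -> T] over [T]. *)
Definition fibrewise_homotopic (T X : topologicalType) (p : X -> T)
    (f g : X -> X) : Prop :=
  exists H : X * unit_interval -> X,
    [/\ continuous H, forall x, H (x, unit0) = f x,
        forall x, H (x, unit1) = g x & forall x t, p (H (x, t)) = p x].

Definition fibrewise_homotopy_equivalent (T X Y : topologicalType)
    (p : X -> T) (q : Y -> T) : Prop :=
  exists (phi : X -> Y) (psi : Y -> X),
    [/\ continuous phi /\ (forall x, q (phi x) = p x),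
        continuous psi /\ (forall y, p (psi y) = q y),
        fibrewise_homotopic p (psi \o phi) id &
        fibrewise_homotopic q (phi \o psi) id].

End Homotopy.

(* A space over [B] given as a subspace of [B * F] is presented by the family
   [A : B -> set F] of its fibres. *)
Section FibrewiseMappingSpace.
Context {B F G : topologicalType}.

Record fibmap (A : B -> set F) (A' : B -> set G) := FibMap {
  fm_base : B;
  fm_map : A fm_base -> A' fm_base;
  fm_continuous : continuous fm_map }.

Arguments fm_map {A A'} f _ : rename.

Definition total_restr (H : topologicalType) (A : B -> set H) (W : set B) :
  set (B * H) := [set x | W x.1 /\ A x.1 x.2].

(* The projection K -> W is a closed map with compact fibres. *)
Definition fibrewise_compact (W : set B) (K : set (B * F)) : Prop :=
  (forall C : set (B * F), closed C ->
     exists2 D : set B, closed D & fst @` (K `&` C) = W `&` D) /\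
  (forall b, W b -> compact [set z | K (b, z)]).

Section Subbase.
Variables (A : B -> set F) (A' : B -> set G).

Definition fibmap_subbase : set (set (fibmap A A')) :=
  [set S | exists (W : set B) (K : set (B * F)) (O : set (B * G)),
    [/\ open W, K `<=` total_restr A W, fibrewise_compact W K,
        exists2 O' : set (B * G), open O' & O = total_restr A' W `&` O' &
        S = [set m | W (fm_base m) /\
               forall z : A (fm_base m), K (fm_base m, set_val z) ->
                 O (fm_base m, set_val (fm_map m z))]]].

HB.instance Definition _ := gen_eqMixin (fibmap A A').
HB.instance Definition _ := gen_choiceMixin (fibmap A A').
HB.instance Definition _ :=
  isSubBaseTopological.Build (fibmap A A') fibmap_subbase id.

End Subbase.
End FibrewiseMappingSpace.

Arguments fm_map {B F G A A'} f _ : rename.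

Section Circle.
Variable R : realType.

Definition disc : set (R * R) := [set x | x.1 ^+ 2 + x.2 ^+ 2 <= 1].
Definition circle : set (R * R) := [set x | x.1 ^+ 2 + x.2 ^+ 2 = 1].

Lemma circle_disc_subproof (s : circle) : set_val s \in disc.
Proof.
by have : circle (set_val s) := set_valP s; rewrite inE /circle /disc/= => ->.
Qed.

Definition circle_disc (s : circle) : disc :=
  exist _ (set_val s) (circle_disc_subproof s).

Definition open_disc : set disc :=
  [set x | (set_val x).1 ^+ 2 + (set_val x).2 ^+ 2 < 1].

Lemma circle_exp_subproof (t : R) :
  (cos (2 * pi * t), sin (2 * pi * t)) \in circle.
Proof. by rewrite inE /circle/= cos2Dsin2. Qed.

(* The identification of R/Z with the boundary of the disc; the basepoint of
   the circle is [circle_exp 0]. *)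
Definition circle_exp (t : R) : circle :=
  exist _ (cos (2 * pi * t), sin (2 * pi * t)) (circle_exp_subproof t).

(* The representative in [0, 1[ of a point of R/Z. *)
Definition angle (s : circle) : R :=
  xget 0 [set t | 0 <= t < 1 /\ circle_exp t = s].

Definition translation (z s : circle) : circle :=
  circle_exp (angle z + angle s).

(* Length of the part of [J] lying on the arc from the basepoint to
   [circle_exp t], for t in [0, 1]. *)
Definition arc_length (J : set circle) (t : R) : R :=
  fine (lebesgue_measure (`[0, t]%classic `&` circle_exp @^-1` J)).

Definition torus (n : nat) : topologicalType :=
  prod_topology (fun _ : 'I_n => (circle : topologicalType)).

End Circle.

Arguments disc : clear implicits.
Arguments circle : clear implicits.
Arguments open_disc : clear implicits.

Section FramedLittleDiscs.
Variables (R : realType) (n : nat).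
Local Notation D := (disc R).
Local Notation S1 := (circle R).

Definition discs_maps : topologicalType :=
  {compact-open, {i : 'I_n & D} -> D}.

Definition little_disc (a : discs_maps) (i : 'I_n) (x : D) : D :=
  a (existT _ i x).

Definition framed_affine (g : D -> D) : Prop :=
  exists (r theta : R) (p : R * R), 0 < r /\ forall x : D,
    set_val (g x) =
      (p.1 + r * (cos theta * (set_val x).1 - sin theta * (set_val x).2),
       p.2 + r * (sin theta * (set_val x).1 + cos theta * (set_val x).2)).

Definition fD : set discs_maps :=
  [set a | embedding a /\ forall i, framed_affine (little_disc a i)].

Definition fDo : set discs_maps :=
  [set a | fD a /\ forall i x, open_disc R (little_disc a i x)].

Definition discs_real (a : fDo) : set D :=
  [set z | forall i, ~ (little_disc (set_val a) i @` open_disc R) z].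

Lemma discs_bnd_subproof (a : fDo) (i : 'I_n) (s : S1) :
  little_disc (set_val a) i (circle_disc s) \in discs_real a.
Proof.
rewrite inE => j [x ox e].
have [[[_ inja _] _] _] : fDo (set_val a) := set_valP a.
have xs : x = circle_disc s.
  exact: (congr1 (fun p : {_ : 'I_n & D} => projT2 p) (inja _ _ e)).
have : circle R (set_val s) := set_valP s.
by move: ox; rewrite xs /open_disc/circle/= => + cs; rewrite cs ltxx.
Qed.

Lemma discs_out_subproof (a : fDo) (s : S1) : circle_disc s \in discs_real a.
Proof.
rewrite inE => j [x _ e].
have [_ ina] : fDo (set_val a) := set_valP a.
have := ina j x; rewrite e /open_disc/=.
have : circle R (set_val s) := set_valP s.
by rewrite /circle/= => ->; rewrite ltxx.
Qed.

Definition discs_bnd (a : fDo) (i : 'I_n) (s : S1) : discs_real a :=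
  exist _ (little_disc (set_val a) i (circle_disc s))
    (discs_bnd_subproof a i s).

Definition discs_out (a : fDo) (s : S1) : discs_real a :=
  exist _ (circle_disc s) (discs_out_subproof a s).

End FramedLittleDiscs.

Arguments fD : clear implicits.
Arguments fDo : clear implicits.

Section Cacti.
Variables (R : realType) (n : nat).
Local Notation S1 := (circle R).
Local Notation T := (torus R n).

Definition cyclically_ordered (z1 z2 z3 z4 : S1) : Prop :=
  exists t1 t2 t3 t4 : R,
    [/\ t1 < t2, t2 < t3, t3 < t4, t4 < t1 + 1 &
    [/\ z1 = circle_exp t1, z2 = circle_exp t2,
        z3 = circle_exp t3 & z4 = circle_exp t4]].

Record cactus_partition (x : 'I_n -> set S1) : Prop := {
  cactus_closed : forall j, closed (x j);
  cactus_manifold : forall j, @manifold1 R _ (x j);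
  cactus_cover : \bigcup_j x j = setT;
  cactus_length : forall j k, arc_length (x j) 1 = arc_length (x k) 1;
  cactus_disjoint : forall j k : 'I_n, j != k ->
    interior (x j) `&` interior (x k) = set0;
  cactus_noncrossing : forall j k : 'I_n, j != k ->
    ~ exists z1 z2 z3 z4 : S1,
        cyclically_ordered z1 z2 z3 z4 /\
        [/\ interior (x j) z1, interior (x k) z2,
            interior (x j) z3 & interior (x k) z4] }.

(* For n = 0 there is no partition and the space of cacti is a point by
   convention; note that there is exactly one [x : 'I_0 -> set S1]. *)
Definition cactus_space : set ('I_n -> set S1) :=
  [set x | n = 0%N \/ cactus_partition x].

(* The projection of the circle that collapses the closed complement of [J],
   where [J] has length 1/n: the quotient, a circle of length 1/n, is
   parametrized by the length of [J] swept from the basepoint, and is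
   rescaled by n. *)
Definition collapse (J : set S1) (s : S1) : S1 :=
  circle_exp (n%:R * arc_length J (angle s)).

(* The composite of c(x), whose components are the collapse maps, with the
   translations by the z_j. *)
Definition cactus_proj (x : 'I_n -> set S1) (z : T) (s : S1) : T :=
  fun j => translation (z j) (collapse (x j) s).

(* Mon(I, dI), with its elements represented by functions on R of which only the
   values on [0, 1] matter. *)
Definition Mon : set (R -> R) :=
  [set f : R -> R | [/\ {within `[0, 1], continuous f},
     {in `[0, 1 : R] &, {homo f : s t / s <= t}}, f 0 = 0 & f 1 = 1]].

Definition mon_circle (f : R -> R) (s : S1) : S1 := circle_exp (f (angle s)).

Definition cactus_map (x : 'I_n -> set S1) (f : R -> R) (z : T) (s : S1) : T :=
  cactus_proj x z (mon_circle f s).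

Definition torus_maps : topologicalType := {compact-open, S1 -> T}.

Definition cacti : set torus_maps :=
  [set c | continuous (c : S1 -> T) /\
     exists x f z, [/\ cactus_space x, Mon f & c = cactus_map x f z]].

Definition cacti_fun (c : cacti) : S1 -> T := set_val c.

Definition cacti_real (c : cacti) : set T := range (cacti_fun c).

(* The i-th lobe of [c] is the circle through [p] in direction i. *)
Definition cacti_lobe (c : cacti) (i : 'I_n) (p : T) : Prop :=
  exists x f z, [/\ cactus_space x, Mon f, cacti_fun c = cactus_map x f z &
    cactus_proj x z @` (x i) = [set w : T | forall k, k != i -> w k = p k]].

(* The i-th lobe determines all coordinates of [p] but the i-th one, which is
   not used. *)
Definition cacti_bnd (c : cacti) (i : 'I_n) (s : S1) : T := fun k =>
  if k == i then s else xget (fun=> circle_exp 0) (cacti_lobe c i) k.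

Definition cacti_out (c : cacti) (s : S1) : T := cacti_fun c s.

End Cacti.

Arguments cactus_space : clear implicits.
Arguments Mon : clear implicits.
Arguments cacti : clear implicits.

Section FibrewiseEquivalences.
Variables (R : realType) (n : nat).

Definition EB : topologicalType := (fDo R n * cacti R n)%type.

(* The fibres of the spaces U' and V' over the base. *)
Definition fibre_discs (b : EB) : set (disc R) := discs_real b.1.
Definition fibre_cacti (b : EB) : set (torus R n) := cacti_real b.2.

Definition Emaps : topologicalType := fibmap fibre_discs fibre_cacti.

Definition Eo : set Emaps :=
  [set m : fibmap fibre_discs fibre_cacti |
   [/\ @homotopy_equivalence R _ _ (fm_map m),
     forall i s, set_val (fm_map m (discs_bnd (fm_base m).1 i s)) =
                 cacti_bnd (fm_base m).2 i s &
     forall s, set_val (fm_map m (discs_out (fm_base m).1 s)) =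
               cacti_out (fm_base m).2 s]].

Definition Eo_proj (e : Eo) : EB := fm_base (set_val e).

Definition Eo_restr (U : set EB) : set Eo := Eo_proj @^-1` U.

Definition Map_bnd (b : EB) : set Eo := Eo_proj @^-1` [set b].

End FibrewiseEquivalences.

Arguments Eo : clear implicits.

(* Main.v *)
From HB Require Import structures.
From mathcomp Require Import finmap.
From mathcomp Require Import all_boot all_order all_algebra.
From mathcomp Require Import all_classical all_reals all_analysis.
From mathcomp Require Import ring lra zify.
Require Import Defs.

(** Fix a base point (a0, c0). Given x1 = (a1, c1) and x2 = (a2, c2) close to it,
    a map |a1| -> |c1| with the prescribed boundary values is transported to a
    map |a2| -> |c2| with the prescribed boundary values by three small moves
    [transport]:
    - it is precomposed with [carry : |a2| -> |a1|], which is close to the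
      identity and crushes a collar of each boundary circle of |a2| onto the
      corresponding boundary circle of |a1|;
    - in these collars its values, which are now boundary values for c1, are
      moved along short arcs of the torus to those for c2 [blend];
    - the result, close to |c2| but not inside, is retracted onto |c2| by [rho].
    All of this depends continuously on x1 and x2, without any choice. The fibrewise
    homotopy equivalence transports each map to the fibre over (a0, c0), and its
    inverse transports a map from that fibre to the fibres nearby. The two
    composites are homotopic to the identity over the base because all moves are
    small [transport_round_trip], and transport preserves homotopy equivalences
    because its moves, taken separately, are homotopy equivalences or homotopies
    [transport_he].

    The retraction is the heart of the matter. The realization of a cactus is a
    tree of circles in the torus: it is described by the matrix [p] whose entry
    [p j i] is the constant [i]-th coordinate of the [j]-th lobe, and consists of
    the points [w] such that [w i = p j i] or [w j = p i j] for all [i != j]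
    [lobe_matrix_treelike], [proj_range], [cacti_realE]. This comes from the
    noncrossing condition: the [k]-th projection is constant on the [j]-th piece.
    Its off-diagonal entries are determined by the realization and depend
    continuously on the cactus [cts_lobes]. The retraction is defined from them
    alone. It lets the [j]-th lobe pull
    the [i]-th coordinate of [w] towards [p j i] with a force measured by the
    distance from [w j] to [p i j], and moves that coordinate to the minimum of
    the resulting energy, whose corners trap it at the values [p j i]. The
    equilibrium equation has a unique solution, Lipschitz in the data [Psi_lip],
    so that [rho] is continuous, fixes the points of the tree [rho_id] and moves
    those close to the tree by little [rho_close]. If, for some pair [i != j],
    neither coordinate of a point close to the tree were trapped, the pulls of
    the other lobes would enter the two equilibria with opposite signs, and
    cancelling them gives a contradiction [rho_in].

    The topology of the fibrewise mapping space is handled by two lemmas: as the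
    family |a| is closed in the product of the base with the compact disc,
    evaluation is continuous [app_cts], and a map into the mapping space is
    continuous when its adjoint is [adjoint_cts]. Together they turn continuity
    of [transport] into continuity of maps to the space of equivalences
    [Eo_lift]. *)

Set Implicit Arguments.
Unset Strict Implicit.
Unset Printing Implicit Defensive.

Import Order.TTheory GRing.Theory Num.Theory.
Import numFieldNormedType.Exports.

Local Open Scope classical_set_scope.
Local Open Scope ring_scope.

(** * Continuity and compactness *)

Lemma set_val_inj {T : Type} (A : set T) : injective (@set_val T A).
Proof. exact: val_inj. Qed.

Section ContinuityRules.
Context {X : topologicalType}.

Lemma cts_cst {Y : topologicalType} (y : Y) : continuous (fun _ : X => y).
Proof. by move=> x; exact: cvg_cst. Qed.

Lemma cts_id : continuous (fun x : X => x).
Proof. by move=> x; exact: cvg_id. Qed.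

Lemma cts_comp {Y Z : topologicalType} (f : X -> Y) (g : Y -> Z) :
  continuous g -> continuous f -> continuous (fun x => g (f x)).
Proof. by move=> cg cf x; apply: continuous_comp; [exact: cf|exact: cg]. Qed.

Lemma cts_pair {Y Z : topologicalType} (f : X -> Y) (g : X -> Z) :
  continuous f -> continuous g -> continuous (fun x => (f x, g x)).
Proof. by move=> cf cg x; apply: cvg_pair; [exact: cf|exact: cg]. Qed.

Lemma cts_fst {Y Z : topologicalType} (f : X -> Y * Z) :
  continuous f -> continuous (fun x => (f x).1).
Proof. by move=> cf; apply: (cts_comp _ cf) => z; exact: cvg_fst. Qed.

Lemma cts_snd {Y Z : topologicalType} (f : X -> Y * Z) :
  continuous f -> continuous (fun x => (f x).2).
Proof. by move=> cf; apply: (cts_comp _ cf) => z; exact: cvg_snd. Qed.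

Lemma cts_val {Y : topologicalType} (A : set Y) (f : X -> A) :
  continuous f -> continuous (fun x => set_val (f x)).
Proof. by move=> cf; apply: (cts_comp _ cf); exact: initial_continuous. Qed.

Lemma cts_sub {Y : topologicalType} (A : set Y) (f : X -> A) :
  continuous (fun x => set_val (f x)) -> continuous f.
Proof.
move=> cf; apply/continuousP => _ [W oW <-].
by move/continuousP: cf => /(_ _ oW).
Qed.

Lemma cts_near {Y : topologicalType} (f : X -> Y) (x : X) (U : set Y) :
  continuous f -> open U -> U (f x) -> \forall y \near x, U (f y).
Proof. by move=> cf oU Ux; apply: (cf x U); exact: open_nbhs_nbhs. Qed.

Lemma cts_mkprod {I : Type} {T : I -> topologicalType}
    (f : X -> prod_topology T) :
  (forall i, continuous (fun x => f x i)) -> continuous f.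
Proof.
move=> cf x; apply/cvg_sup => i U [B [[C oC <-] Bx] BU].
by apply: (filterS BU); apply: (cf i x); exact: open_nbhs_nbhs.
Qed.

Lemma cts_app {I : Type} {T : I -> topologicalType}
    (f : X -> prod_topology T) i :
  continuous f -> continuous (fun x => f x i).
Proof.
move=> cf x; have /cvg_sup /(_ i) H := cf x.
apply: cvg_trans; last exact: (@initial_continuous _ _ (fun h : prod_topology T => h i)).
by move=> U; exact: H.
Qed.

Lemma cts_if {Y : topologicalType} {R : realType} (r : X -> R) (c : R)
    (f g : X -> Y) :
  continuous r -> continuous f -> continuous g ->
  (forall x, r x = c -> f x = g x) ->
  continuous (fun x => if r x <= c then f x else g x).
Proof.
move=> cr cf cg fg x U /= HU.
change (\forall y \near x, U (if r y <= c then f y else g y)).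
case: (ltgtP (r x) c) HU => [rc|rc|rc].
- move=> fU; have fU' : \forall y \near x, U (f y) := cf x U fU.
  have H : \forall y \near x, r y < c by exact: (cvgr_lt _ (cr x)).
  by move: fU' H; apply: filterS2 => y Uy rcy; rewrite (ltW rcy).
- move=> gU; have gU' : \forall y \near x, U (g y) := cg x U gU.
  have H : \forall y \near x, c < r y by exact: (cvgr_gt _ (cr x)).
  by move: gU' H; apply: filterS2 => y Uy rcy; rewrite leNgt rcy.
- move=> fU; have fU' : \forall y \near x, U (f y) := cf x U fU.
  have gU' : \forall y \near x, U (g y).
    by apply: (cg x U); rewrite -fg.
  by move: fU' gU'; apply: filterS2 => y Uy Vy; case: ifP.
Qed.

Section RealRules.
Context {R : realType}.
Implicit Types f g : X -> R.

Lemma cts_near_lt f (x : X) (a : R) :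
  continuous f -> f x < a -> nbhs x [set y | f y < a].
Proof. by move=> cf fa; exact: (cvgr_lt _ (cf x)). Qed.

Lemma ctsD f g : continuous f -> continuous g -> continuous (fun x => f x + g x).
Proof. by move=> cf cg x; apply: cvgD; [exact: cf|exact: cg]. Qed.

Lemma ctsN f : continuous f -> continuous (fun x => - f x).
Proof. by move=> cf x; apply: cvgN; exact: cf. Qed.

Lemma ctsB f g : continuous f -> continuous g -> continuous (fun x => f x - g x).
Proof. by move=> cf cg x; apply: cvgB; [exact: cf|exact: cg]. Qed.

Lemma ctsM f g : continuous f -> continuous g -> continuous (fun x => f x * g x).
Proof. by move=> cf cg x; apply: cvgM; [exact: cf|exact: cg]. Qed.

Lemma ctsX f n : continuous f -> continuous (fun x => f x ^+ n).
Proof. by move=> cf; apply: (@cts_comp _ _ f (fun y : R => y ^+ n) _ cf); exact: exprn_continuous. Qed.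

Lemma ctsV f : (forall x, f x != 0) -> continuous f ->
  continuous (fun x => (f x)^-1).
Proof. by move=> f0 cf x; apply: cvgV => //; exact: cf. Qed.

Lemma ctsmax f g : continuous f -> continuous g ->
  continuous (fun x => Num.max (f x) (g x)).
Proof. by move=> cf cg x; apply: continuous_max; [exact: cf|exact: cg]. Qed.

Lemma ctsmin f g : continuous f -> continuous g ->
  continuous (fun x => Num.min (f x) (g x)).
Proof. by move=> cf cg x; apply: continuous_min; [exact: cf|exact: cg]. Qed.

Lemma ctsnorm f : continuous f -> continuous (fun x => `|f x|).
Proof. by move=> cf x; apply: cvg_norm; exact: cf. Qed.

Lemma ctssqrt f : continuous f -> continuous (fun x => Num.sqrt (f x)).
Proof. by move=> cf; apply: (cts_comp _ cf) => x; exact: sqrt_continuous. Qed.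

Lemma ctscos f : continuous f -> continuous (fun x => cos (f x)).
Proof. by move=> cf; apply: (cts_comp _ cf) => x; exact: continuous_cos. Qed.

Lemma ctssin f : continuous f -> continuous (fun x => sin (f x)).
Proof. by move=> cf; apply: (cts_comp _ cf) => x; exact: continuous_sin. Qed.

Lemma ctssum {I : Type} (r : seq I) (P : pred I) (f : I -> X -> R) :
  (forall i, continuous (f i)) ->
  continuous (fun x => \sum_(i <- r | P i) f i x).
Proof.
move=> cf; elim: r => [|i r IH].
  by under eq_fun do rewrite big_nil; exact: cts_cst.
under eq_fun do rewrite big_cons.
by case: (P i) => //; apply: ctsD.
Qed.

End RealRules.
End ContinuityRules.

Ltac cts_rule :=
  lazymatch goal with
  | |- forall x, @continuous_at _ _ x fst => move=> ?; exact: cvg_fst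
  | |- forall x, @continuous_at _ _ x snd => move=> ?; exact: cvg_snd
  | |- forall x, @continuous_at _ _ x set_val => exact: initial_continuous
  | |- forall x, @continuous_at _ _ x (fun y => y) => apply: cts_id
  | |- forall x, @continuous_at _ _ x (Algebra.add ?a) =>
      apply: (ctsD (f := fun _ => a) (g := fun y => y))
  | |- forall x, @continuous_at _ _ x (GRing.mul ?a) =>
      apply: (ctsM (f := fun _ => a) (g := fun y => y))
  | |- forall x, @continuous_at _ _ x (fun y => (@?f y, @?g y)) =>
      apply: cts_pair
  | |- forall x, @continuous_at _ _ x (fun y => (@?f y).1) => apply: cts_fst
  | |- forall x, @continuous_at _ _ x (fun y => (@?f y).2) => apply: cts_snd
  | |- forall x, @continuous_at _ _ x (fun y => set_val (@?f y)) =>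
      apply: cts_val
  | |- forall x, @continuous_at _ _ x (fun y => Algebra.add (@?f y) (@?g y)) =>
      apply: ctsD
  | |- forall x, @continuous_at _ _ x (fun y => Algebra.opp (@?f y)) =>
      apply: ctsN
  | |- forall x, @continuous_at _ _ x (fun y => GRing.mul (@?f y) (@?g y)) =>
      apply: ctsM
  | |- forall x, @continuous_at _ _ x (fun y => GRing.exp (@?f y) _) =>
      apply: ctsX
  | |- forall x, @continuous_at _ _ x (fun y => Order.max (@?f y) (@?g y)) =>
      apply: ctsmax
  | |- forall x, @continuous_at _ _ x (fun y => Order.min (@?f y) (@?g y)) =>
      apply: ctsmin
  | |- forall x, @continuous_at _ _ x (fun y => Num.norm (@?f y)) =>
      apply: ctsnorm
  | |- forall x, @continuous_at _ _ x (fun y => Num.sqrt (@?f y)) =>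
      apply: ctssqrt
  | |- forall x, @continuous_at _ _ x (fun y => cos (@?f y)) => apply: ctscos
  | |- forall x, @continuous_at _ _ x (fun y => sin (@?f y)) => apply: ctssin
  | |- forall x, @continuous_at _ _ x (fun y => bigop _ _ (@?f y)) =>
      apply: ctssum; intro
  end.
Ltac cts_const :=
  match goal with
  | |- forall x, @continuous_at _ _ x (fun y => ?c) =>
      let d := constr:(c) in exact: cts_cst
  end.
Ltac cts1 := first [assumption | cts_const | cts_rule].
Ltac cts := repeat cts1.

(** The tube lemma: every uniformity in the points of a compact fibre rests on
    it. *)
Lemma tube {X K : topologicalType} (P : X -> K -> Prop) (x0 : X) :
  compact [set: K] ->
  (forall k, nbhs ((x0, k) : X * K) [set p | P p.1 p.2]) ->
  \forall x \near x0, forall k, P x k.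
Proof.
move=> /compact_near_coveringP cK PN.
have H : \forall x \near x0, [set: K] `<=` P x.
  apply: cK => k _; have [[A B] /= [nA nB] AB] := PN k.
  by exists (B, A) => //= -[k' x] [/= Bk Ax]; apply: (AB (x, k')).
by apply: filterS H => x Px k; exact: Px.
Qed.

(** * Homotopies *)

Section Homotopies.
Context {R : realType}.
Local Notation I := (@unit_interval R).

Lemma clamp_subproof (t : R) : Num.max 0 (Num.min t 1) \in I.
Proof.
rewrite inE /unit_interval/= in_itv/= le_max lexx ge_max ler01/=.
by rewrite ge_min lexx orbT.
Qed.

Definition clampI (t : R) : I := exist _ (Num.max 0 (Num.min t 1)) (clamp_subproof t).

Lemma clampI_cts (X : topologicalType) (f : X -> R) :
  continuous f -> continuous (fun x => clampI (f x)).
Proof.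
move=> cf; apply: cts_sub.
by change (continuous (fun x => Num.max 0 (Num.min (f x) 1))); cts.
Qed.

Lemma clampI_val (t : I) : clampI (set_val t) = t.
Proof.
apply: val_inj => /=; have := set_valP t; rewrite /unit_interval/= in_itv/=.
by move=> /andP[t0 t1]; rewrite min_l// max_r.
Qed.

Lemma clampI_le0 (t : R) : t <= 0 -> clampI t = unit0.
Proof.
move=> t0; apply: val_inj => /=; rewrite min_l; first by rewrite max_l.
exact: le_trans t0 ler01.
Qed.

Lemma clampI_ge1 (t : R) : 1 <= t -> clampI t = unit1.
Proof. by move=> t1; apply: val_inj => /=; rewrite min_r// max_r. Qed.

Context {X Y Z : topologicalType}.

Definition paste (H1 H2 : X * I -> Y) (p : X * I) : Y :=
  if set_val p.2 <= 2^-1 then H1 (p.1, clampI (2 * set_val p.2))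
  else H2 (p.1, clampI (2 * set_val p.2 - 1)).

Lemma paste_cts (H1 H2 : X * I -> Y) : continuous H1 -> continuous H2 ->
  (forall x, H1 (x, unit1) = H2 (x, unit0)) -> continuous (paste H1 H2).
Proof.
move=> c1 c2 e; apply: cts_if.
- cts.
- by apply: (cts_comp c1); apply: cts_pair; [cts|apply: clampI_cts; cts].
- by apply: (cts_comp c2); apply: cts_pair; [cts|apply: clampI_cts; cts].
- move=> [x t] /= ->; rewrite divff// clampI_ge1// subrr clampI_le0//.
Qed.

Lemma paste0 (H1 H2 : X * I -> Y) x : paste H1 H2 (x, unit0) = H1 (x, unit0).
Proof. by rewrite /paste/= invr_ge0 ler0n mulr0 clampI_le0. Qed.

Lemma paste1 (H1 H2 : X * I -> Y) x : paste H1 H2 (x, unit1) = H2 (x, unit1).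
Proof.
rewrite /paste/= leNgt invf_lt1 ?ltr1n//= mulr1 clampI_ge1//.
by rewrite -[2]/(1 + 1) addrK.
Qed.

Lemma homotopic_sym (f g : X -> Y) : @homotopic R X Y f g -> @homotopic R X Y g f.
Proof.
move=> [H [cH H0 H1]]; exists (fun p => H (p.1, clampI (1 - set_val p.2))); split.
- by apply: (cts_comp cH); apply: cts_pair; [cts|apply: clampI_cts; cts].
- by move=> x /=; rewrite subr0 clampI_ge1// H1.
- by move=> x /=; rewrite subrr clampI_le0.
Qed.

Lemma homotopic_trans (g f h : X -> Y) :
  @homotopic R X Y f g -> @homotopic R X Y g h -> @homotopic R X Y f h.
Proof.
move=> [H1 [c1 H10 H11]] [H2 [c2 H20 H21]]; exists (paste H1 H2); split.
- by apply: paste_cts => // x; rewrite H11.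
- by move=> x; rewrite paste0.
- by move=> x; rewrite paste1.
Qed.

End Homotopies.

Section HomotopyEquivalences.
Context {R : realType}.

Lemma homotopic_comp (X Y Z W : topologicalType) (k : Z -> W) (f g : Y -> Z) (h : X -> Y) :
  continuous k -> continuous h -> @homotopic R _ _ f g ->
  @homotopic R _ _ (fun x => k (f (h x))) (fun x => k (g (h x))).
Proof.
move=> ck ch [H [cH H0 H1]]; exists (fun p => k (H (h p.1, p.2))); split.
- apply: (cts_comp ck); apply: (cts_comp cH); apply: cts_pair; last by cts.
  by apply: (cts_comp ch); cts.
- by move=> x; rewrite H0.
- by move=> x; rewrite H1.
Qed.

Lemma he_comp (X Y Z : topologicalType) (f : X -> Y) (g : Y -> Z) :
  @homotopy_equivalence R _ _ f -> @homotopy_equivalence R _ _ g ->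
  @homotopy_equivalence R _ _ (fun x => g (f x)).
Proof.
move=> [cf [f' [cf' f'f ff']]] [cg [g' [cg' g'g gg']]].
split; first exact: cts_comp.
exists (fun z => f' (g' z)); split; first exact: cts_comp.
- apply: homotopic_trans f'f.
  exact: (homotopic_comp cf' cf g'g).
- apply: homotopic_trans gg'.
  exact: (homotopic_comp cg cg' ff').
Qed.

Lemma he_homotopic (X Y : topologicalType) (f g : X -> Y) : continuous g ->
  @homotopic R _ _ f g ->
  @homotopy_equivalence R _ _ f -> @homotopy_equivalence R _ _ g.
Proof.
move=> cg fg [cf [f' [cf' f'f ff']]]; split => //.
exists f'; split => //.
- apply: homotopic_trans f'f; apply: homotopic_sym.
  exact: (homotopic_comp cf' cts_id fg).
- apply: homotopic_trans ff'; apply: homotopic_sym.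
  exact: (homotopic_comp cts_id cf' fg).
Qed.

End HomotopyEquivalences.

(** * Fibrewise mapping spaces *)

(** An empty space has the empty subcovers, and other spaces can be pointed. *)
Lemma compact_cover_compact (T : topologicalType) (A : set T) :
  compact A -> cover_compact A.
Proof.
have [[x0 _]|T0] := pselect (exists x : T, True); last first.
  move=> _ I D f _ _; exists finmap.fset0 => // x; exfalso.
  by apply: T0; exists x.
pose pt := isPointed.Build T x0.
pose PT : ptopologicalType := HB.pack T pt.
by rewrite -[compact A]/(@compact PT A) compact_cover.
Qed.

Section FibrewiseTopology.
Context {B F G : topologicalType} (A : B -> set F) (A' : B -> set G).
Local Notation M := (fibmap A A').

Definition app (m : M) (z : F) (h : A (fm_base m) z) : G :=
  set_val (fm_map m (exist _ z (mem_set h))).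

Lemma app_irr (m : M) (z : F) (h h' : A (fm_base m) z) : app h = app h'.
Proof. by rewrite /app (_ : mem_set h = mem_set h'); last exact: bool_irrelevance. Qed.

Lemma subbase_open (S : set M) : fibmap_subbase S -> open S.
Proof.
move=> SS; exists [set S]; last by rewrite bigcup_set1.
by move=> _ ->; exact: finI_from1.
Qed.

Lemma subbase_continuous (Y : topologicalType) (g : Y -> M) :
  (forall S, fibmap_subbase S -> open (g @^-1` S)) -> continuous g.
Proof.
move=> gS y U; rewrite nbhsE => -[_ [[D' sD' <-] [C DC Cy]] CU].
have /sD' [D sD IDC] := DC.
apply: filterS (_ : \forall y' \near y, C (g y')).
  by move=> y' Cy'; apply: CU; exists C.
rewrite -IDC; apply: filter_bigI => S DS.
have /sD := DS; rewrite inE => /gS; rewrite openE; apply.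
by move: Cy; rewrite -IDC => /(_ _ DS).
Qed.

Lemma fm_base_cts : continuous (fun m : M => fm_base m).
Proof.
apply/continuousP => W oW; apply: subbase_open.
exists W, set0, set0; split => //.
- split; last by move=> b _; exact: compact0.
  move=> C _; exists set0; first exact: closed0.
  by rewrite set0I image_set0 setI0.
- exists set0; first exact: open0.
  by rewrite setI0.
- by apply/seteqP; split => [m Wm|m []//]; split.
Qed.

Lemma closed_fst (C : set (B * F)) : compact [set: F] -> closed C ->
  closed (fst @` C).
Proof.
move=> cF cC; rewrite -openC openE => b nCb; rewrite /interior.
have : \forall b' \near b, forall z, ~ C (b', z).
  apply: tube => // z; have oC := closed_openC cC.
  have : (~` C) (b, z) by move=> Cbz; apply: nCb; exists (b, z).
  move=> Cbz; apply: filterS (open_nbhs_nbhs (conj oC Cbz)).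
  by case.
by apply: filterS => b' Hb' [[b1 z] Cz /= e]; apply: (Hb' z); rewrite -e.
Qed.

Definition app_dom : set (M * F) := [set x | A (fm_base x.1) x.2].

Definition app_fun (x : app_dom) : G := app (set_valP x).

Hypothesis cF : compact [set: F].
Hypothesis rF : regular_space F.
Hypothesis clA : closed [set x : B * F | A x.1 x.2].

(** Evaluation is continuous since the fibres [A b] are uniformly locally
    compact: intersecting [A] with a closed neighbourhood in [F] gives a
    fibrewise compact set. *)
Lemma app_cts : continuous app_fun.
Proof.
move=> x0 N; rewrite nbhsE => -[N' [oN' N'x] N'N].
case: x0 N'x => -[m0 z0] h0 N'x.
have h0' : A (fm_base m0) z0 by have := set_mem h0.
have /= : open ((fun z => set_val (fm_map m0 z)) @^-1` N').
  apply: open_comp => // z _; apply: (cts_val (f := fm_map m0)).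
  exact: fm_continuous.
move=> [V oV VN].
have Vz0 : V z0.
  have : ((fun z => set_val (fm_map m0 z)) @^-1` N') (exist _ z0 (mem_set h0')).
    by move: N'x; rewrite /= /app_fun (app_irr _ h0').
  by rewrite -VN.
have [C0 nC0 C0V] := rF (open_nbhs_nbhs (conj oV Vz0)).
pose C := closure C0; have cC : closed C by exact: closed_closure.
pose K := [set x : B * F | A x.1 x.2] `&` [set x | C x.2].
have cK : closed K.
  apply: closedI => //; apply: (closed_comp (f := snd)) => //.
  by move=> x _; exact: cvg_snd.
pose O := total_restr A' setT `&` [set x | N' x.2].
pose S := [set m : M | setT (fm_base m) /\
               forall z : A (fm_base m), K (fm_base m, set_val z) ->
                 O (fm_base m, set_val (fm_map m z))].
have oS : open S.
  apply: subbase_open; exists setT, K, O; split => //.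
  - exact: openT.
  - by move=> x [].
  - split=> [C' cC'|b _].
      exists (fst @` (K `&` C')); last by rewrite setTI.
      by apply: closed_fst => //; exact: closedI.
    apply: (subclosed_compact _ cF) => //.
    apply: (closed_comp (f := fun z => (b, z)) _ cK) => z _.
    by apply: cvg_pair; [exact: cvg_cst|exact: cvg_id].
  - exists [set x | N' x.2] => //; apply: (open_comp (f := snd)) => //.
    by move=> x _; exact: cvg_snd.
have Sm0 : S m0.
  split=> // z [_ Cz]; split; first by split => //; exact: set_valP.
  have : V (set_val z) by exact: C0V.
  by rewrite -[V _]/((set_val @^-1` V) z) VN.
have HN : nbhs ((m0, z0) : M * F) (S `*` C).
  exists (S, C) => //; split; first exact: open_nbhs_nbhs.
  by apply: filterS nC0; exact: subset_closure.
have := @initial_continuous _ _ (@set_val _ app_dom) (exist _ (m0, z0) h0) _ HN.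
move=> HS; apply: (@filterS _ (nbhs (exist _ (m0, z0) h0 : app_dom)) _ _ _ _ HS).
move=> -[[m z] h] /= [[_ Sm] Cz]; apply: N'N.
have h' : A (fm_base m) z by have := set_mem h.
have [] := Sm (exist _ z (mem_set h')) (conj h' Cz).
by move=> _; rewrite /= /app_fun (app_irr _ h').
Qed.

(** Conversely a map into the mapping space is continuous as soon as its adjoint
    is: fibrewise compactness is what makes the tube argument work over a
    varying base. *)
Lemma adjoint_cts (Y : topologicalType) (g : Y -> M) (f : Y -> F -> G) :
  continuous (fun y => fm_base (g y)) ->
  (forall y z (h : A (fm_base (g y)) z), app h = f y z) ->
  continuous (fun p : [set p : Y * F | A (fm_base (g p.1)) p.2] =>
                f (set_val p).1 (set_val p).2) ->
  continuous g.
Proof.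
move=> cg gf cf; apply: subbase_continuous => S [W [K [Ot [oW KW [Kcl Kco]]]]].
move=> [P oP OE] -> {S}.
rewrite openE => y0 [Wy0 Hy0]; rewrite /interior.
set b0 := fm_base (g y0) in Wy0 Hy0.
pose good (y : Y) (z : F) := A (fm_base (g y)) z -> P (fm_base (g y), f y z).
have loc z : K (b0, z) -> exists2 Q : set Y * set F,
    [/\ open Q.1, Q.1 y0, open Q.2 & Q.2 z] &
    forall y z', Q.1 y -> Q.2 z' -> good y z'.
  move=> Kz; have [_ /= Az] := KW _ Kz.
  pose E : set (Y * F) := [set p : Y * F | A (fm_base (g p.1)) p.2].
  have Ez : E (y0, z) by [].
  pose e : E := exist _ (y0, z) (mem_set Ez).
  have c2 : continuous (fun p : E => (fm_base (g (set_val p).1),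
      f (set_val p).1 (set_val p).2)).
    apply: cts_pair => //; apply: (cts_comp cg); cts.
  have : nbhs e ((fun p : E => (fm_base (g (set_val p).1),
      f (set_val p).1 (set_val p).2)) @^-1` P).
    apply: c2; apply: open_nbhs_nbhs; split => //=.
    have Kz' : K (b0, set_val (exist _ z (mem_set Az) : A b0)) by [].
    have := Hy0 _ Kz'.
    by rewrite OE => -[_]; rewrite -[set_val _]/(app Az) gf.
  move=> [_ [[T oT <-] Te] TP].
  have : nbhs ((y0, z) : Y * F) T by apply: open_nbhs_nbhs.
  move=> [[Q1 Q2] /= []]; rewrite !nbhsE => -[U1 [oU1 U1y] U1Q] [U2 [oU2 U2z] U2Q] QT.
  exists (U1, U2) => //= y z' Uy Uz' Ayz.
  have Ee : E (y, z') by [].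
  apply: (TP (exist _ (y, z') (mem_set Ee))).
  by apply: QT; split => /=; [exact: U1Q|exact: U2Q].
pose Kb := [set z | K (b0, z)].
have /choice [q Hq] : forall z : F, exists Q : set Y * set F, Kb z ->
    [/\ open Q.1, Q.1 y0, open Q.2, Q.2 z &
    forall y z', Q.1 y -> Q.2 z' -> good y z'].
  move=> z; have [/loc[Q [? ? ? ?] ?]|nK] := pselect (Kb z); first by exists Q.
  by exists (setT, setT).
have := compact_cover_compact (Kco b0 Wy0).
move=> /(_ _ Kb (fun z => (q z).2)) [].
- by move=> z /Hq[].
- by move=> z Kz; exists z => //; have [] := Hq z Kz.
move=> D DK KD.
pose Z := cover [set` D] (fun z => (q z).2).
have oZ : open Z.
  by apply: bigcup_open => z /= Dz; have := DK _ Dz; rewrite inE => /Hq[].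
have nY : \forall y \near y0, (\bigcap_(z in [set` D]) (q z).1) y.
  apply: filter_bigI => z Dz; have := DK _ Dz; rewrite inE => /Hq[? ? _ _ _].
  exact: open_nbhs_nbhs.
have cZ : closed [set x : B * F | (~` Z) x.2].
  by apply: (closed_comp (f := snd)); [move=> x _; exact: cvg_snd|exact: open_closedC].
have [D' cD' D'E] := Kcl _ cZ.
have nD' : \forall y \near y0, ~ D' (fm_base (g y)).
  apply: (cts_near cg (closed_openC cD')) => D'b; have : (W `&` D') b0 by [].
  rewrite -D'E => -[[b z] /= [Kz nZ] eb]; apply: nZ.
  by apply: KD; rewrite /Kb/= -eb.
have nW : \forall y \near y0, W (fm_base (g y)).
  exact: (cts_near cg).
move: nY nD' nW; apply: filterS3 => y Yy nDy Wy; split=> // z Kz.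
have Zz : Z (set_val z).
  apply: contrapT => nZ.
  have : (W `&` D') (fm_base (g y)).
    by rewrite -D'E; exists (fm_base (g y), set_val z).
  by case.
have [w /= Dw qw] := Zz; have := DK _ Dw; rewrite inE => /Hq[_ _ _ _ Hw].
have Az : A (fm_base (g y)) (set_val z) by exact: set_valP.
rewrite OE; split; first by split => //; exact: set_valP.
have -> : set_val (fm_map (g y) z) = f y (set_val z).
  by rewrite -(gf _ _ Az) /app; congr (set_val (fm_map _ _)); exact: val_inj.
by apply: Hw => //; exact: Yy.
Qed.

End FibrewiseTopology.

(** * The circle as a metric group *)

Section CircleGroup.
Context {R : realType}.
Local Notation C := (circle R).
Local Notation ce := (@circle_exp R).
Implicit Types (x y z : C) (s t : R).

Lemma circleP x : (set_val x).1 ^+ 2 + (set_val x).2 ^+ 2 = 1.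
Proof. exact: (set_valP x). Qed.

Lemma circle_eq x y : (set_val x).1 = (set_val y).1 ->
  (set_val x).2 = (set_val y).2 -> x = y.
Proof. by move=> e1 e2; apply: val_inj; rewrite [LHS]surjective_pairing e1 e2 -surjective_pairing. Qed.

Lemma cmul_subproof x y :
  ((set_val x).1 * (set_val y).1 - (set_val x).2 * (set_val y).2,
   (set_val x).1 * (set_val y).2 + (set_val x).2 * (set_val y).1) \in circle R.
Proof.
rewrite inE /circle/=; have hx := circleP x; have hy := circleP y.
transitivity (((set_val x).1 ^+ 2 + (set_val x).2 ^+ 2) *
  ((set_val y).1 ^+ 2 + (set_val y).2 ^+ 2)); first by ring.
by rewrite hx hy mulr1.
Qed.

Definition cmul x y : C := exist _
  ((set_val x).1 * (set_val y).1 - (set_val x).2 * (set_val y).2,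
   (set_val x).1 * (set_val y).2 + (set_val x).2 * (set_val y).1)
  (cmul_subproof x y).

Lemma cinv_subproof x : ((set_val x).1, - (set_val x).2) \in circle R.
Proof. by rewrite inE /circle/= sqrrN circleP. Qed.

Definition cinv x : C := exist _ ((set_val x).1, - (set_val x).2) (cinv_subproof x).

Definition cone : C := ce 0.

Lemma cmulA x y z : cmul x (cmul y z) = cmul (cmul x y) z.
Proof. by apply: circle_eq => /=; ring. Qed.

Lemma cmulC x y : cmul x y = cmul y x.
Proof. by apply: circle_eq => /=; ring. Qed.

Lemma cmul1 x : cmul x cone = x.
Proof. by apply: circle_eq => /=; rewrite mulr0 cos0 sin0; ring. Qed.

Lemma c1mul x : cmul cone x = x.
Proof. by rewrite cmulC cmul1. Qed.

Lemma cmulV x : cmul x (cinv x) = cone.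
Proof.
apply: circle_eq => /=; rewrite mulr0 ?cos0 ?sin0; last by ring.
by rewrite -[RHS](circleP x); ring.
Qed.

Lemma cVmul x : cmul (cinv x) x = cone.
Proof. by rewrite cmulC cmulV. Qed.

Lemma cmulKV x y : cmul x (cmul (cinv x) y) = y.
Proof. by rewrite cmulA cmulV c1mul. Qed.

Lemma cmulVK x y : cmul (cinv x) (cmul x y) = y.
Proof. by rewrite cmulA cVmul c1mul. Qed.

Lemma ceD s t : ce (s + t) = cmul (ce s) (ce t).
Proof. by apply: circle_eq => /=; rewrite mulrDr ?cosD ?sinD; ring. Qed.

Lemma ceN t : ce (- t) = cinv (ce t).
Proof. by apply: circle_eq => /=; rewrite mulrN ?cosN ?sinN. Qed.

Lemma ce_nat n : ce n%:R = cone.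
Proof.
apply: circle_eq => /=; rewrite mulr0.
  have := periodicn (@cosD2pi R) n 0; rewrite add0r => <-; congr cos.
  by rewrite -[_ *+ n]mulr_natr mulr2n; ring.
have := periodicn (@sinD2pi R) n 0; rewrite add0r => <-; congr sin.
by rewrite -[_ *+ n]mulr_natr mulr2n; ring.
Qed.

Lemma cinvM x y : cinv (cmul x y) = cmul (cinv x) (cinv y).
Proof. by apply: circle_eq => /=; ring. Qed.

Lemma cinvK x : cinv (cinv x) = x.
Proof. by apply: circle_eq => //=; ring. Qed.

Lemma cinv1 : cinv cone = cone.
Proof. by rewrite -{2}(cmulV cone) c1mul. Qed.

Lemma ce_int (k : int) : ce k%:~R = cone.
Proof.
case: k => n; first exact: ce_nat.
by rewrite NegzE mulrNz ceN ce_nat cinv1.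
Qed.

Lemma ceDint s (k : int) : ce (s + k%:~R) = ce s.
Proof. by rewrite ceD ce_int cmul1. Qed.

Lemma ce_exists x : exists t, `|t| <= 2^-1 /\ ce t = x.
Proof.
have pi0 := @pi_gt0 R.
have hx := circleP x; set a := (set_val x).1 in hx; set b := (set_val x).2 in hx.
have ha : -1 <= a <= 1 by apply/andP; split; have := sqr_ge0 b; nra.
pose u := acos a / (2 * pi).
have u0 : 0 <= u by rewrite divr_ge0 ?acos_ge0// mulr_ge0// ltW.
have u1 : u <= 2^-1.
  by rewrite ler_pdivrMr ?mulr_gt0// mulrA mulVf// mul1r acos_lepi.
have e : 2 * pi * u = acos a.
  by rewrite /u mulrC divfK// mulf_neq0// gt_eqF.
have sb : Num.sqrt (1 - a ^+ 2) = `|b|.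
  by rewrite -hx addrC addKr sqrtr_sqr.
have [b0|b0] := leP 0 b.
  exists u; split; first by rewrite ger0_norm.
  apply: circle_eq => /=; rewrite e ?acosK ?in_itv//=.
  by rewrite sin_acos// sb ger0_norm.
exists (- u); split; first by rewrite normrN ger0_norm.
apply: circle_eq => /=; rewrite mulrN ?cosN ?sinN e ?acosK ?in_itv//=.
by rewrite sin_acos// sb ltr0_norm// opprK.
Qed.

Lemma ce1_small t : `|t| <= 2^-1 -> ce t = cone -> t = 0.
Proof.
have pi0 := @pi_gt0 R.
move=> t1 et; apply/eqP; rewrite -normr_eq0; apply/eqP.
have : cos (2 * pi * `|t|) = cos (2 * pi * 0).
  have := congr1 (fun x : C => (set_val x).1) et => /= e.
  by rewrite mulr0 -(mulr0 (2 * pi)) -e; case: (ger0P t) => // _; rewrite mulrN cosN.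
move/cos_inj; rewrite !in_itv/= !mulr0 lexx (ltW pi0) => /(_ _ isT) e.
have : 2 * pi * `|t| = 0.
  apply: e; apply/andP; split; first by rewrite mulr_ge0// mulr_ge0// ltW.
  by have := ler_wpM2l (ltW pi0) t1; lra.
by move/eqP; rewrite mulf_eq0 mulf_eq0 pnatr_eq0/= (gt_eqF pi0)/= => /eqP.
Qed.

Lemma ce_eq1 t : ce t = cone -> exists k : int, t = k%:~R.
Proof.
move=> et; pose k := Num.floor (t + 2^-1); exists k.
have /andP[k1 k2] := floor_itv (t + 2^-1); rewrite -/k in k1 k2.
rewrite intrD in k2.
have : t - k%:~R = 0.
  apply: ce1_small; first by rewrite ler_norml; lra.
  by rewrite ceD -mulrNz ce_int cmul1.
by move/eqP; rewrite subr_eq0 => /eqP.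
Qed.

Lemma ce_eq s t : ce s = ce t -> exists k : int, s = t + k%:~R.
Proof.
move=> e; have [|k hk] := @ce_eq1 (s - t); first by rewrite ceD ceN e cmulV.
by exists k; rewrite -hk; ring.
Qed.

Lemma angleP x : 0 <= angle x < 1 /\ ce (angle x) = x.
Proof.
rewrite /angle; case: xgetP => [t -> //|H].
have [t [t1 et]] := ce_exists x; exfalso.
have [t0|t0] := leP 0 t.
  by apply: (H t); split => //; move: t1; rewrite ger0_norm//; lra.
apply: (H (t + 1)); split; last by rewrite -[1]/((1%:Z)%:~R) ceDint.
by move: t1; rewrite ltr0_norm//; lra.
Qed.

Lemma angleK x : ce (angle x) = x. Proof. by case: (angleP x). Qed.

Lemma angle_exp t : 0 <= t < 1 -> angle (ce t) = t.
Proof.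
move=> t01; have [a01 /ce_eq[k e]] := angleP (ce t).
have : k%:~R < (1 : R) by lra.
have : (-1 : R) < k%:~R by lra.
rewrite -[1]/((1%:Z)%:~R) -mulrNz !ltr_int => k1 k2.
have k0 : k = 0 by lia.
by rewrite e k0 addr0.
Qed.

Lemma translationE z x : translation z x = cmul z x.
Proof. by rewrite /translation ceD !angleK. Qed.

(** Normalized arc length from the basepoint. *)
Definition len x : R := Num.min (angle x) (1 - angle x).

Lemma len_exp_le t : len (ce t) <= `|t|.
Proof.
have [a01 /esym /ce_eq[k e]] := angleP (ce t); rewrite /len.
have [k0|k0] := leP 0 k.
  have : (0 : R) <= k%:~R by rewrite ler0z.
  move=> k0'; rewrite ge_min; apply/orP; left; rewrite ler_normr; apply/orP; left; lra.
have : (k%:~R : R) <= -1.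
  by rewrite -[1]/((1%:Z)%:~R) -mulrNz ler_int; lia.
move=> k0'; rewrite ge_min; apply/orP; right; rewrite ler_normr; apply/orP; right; lra.
Qed.

Lemma len_lift x : exists t, [/\ ce t = x, `|t| = len x & len x <= 2^-1].
Proof.
have [a01 e] := angleP x; rewrite /len; have [a|a] := leP (angle x) (1 - angle x).
  by exists (angle x); rewrite ger0_norm; [split=> //|]; lra.
exists (angle x - 1); split; last by lra.
  by rewrite -[1]/((1%:Z)%:~R) -mulrNz ceDint.
by rewrite ler0_norm; lra.
Qed.

Lemma len_ge0 x : 0 <= len x.
Proof. by have [t [_ <- _]] := len_lift x. Qed.

Lemma len1 : len cone = 0.
Proof. by apply/eqP; rewrite eq_le len_ge0 (le_trans (len_exp_le 0))// normr0. Qed.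

Lemma len_eq0 x : len x = 0 -> x = cone.
Proof. by have [t [<- <- _]] := len_lift x => /eqP; rewrite normr_eq0 => /eqP ->. Qed.

Lemma lenM x y : len (cmul x y) <= len x + len y.
Proof.
have [s [<- <- _]] := len_lift x; have [t [<- <- _]] := len_lift y.
by rewrite -ceD; apply: le_trans (len_exp_le _) (ler_normD _ _).
Qed.

Lemma len_small t : `|t| <= 2^-1 -> len (ce t) = `|t|.
Proof.
move=> t1; apply/eqP; rewrite eq_le len_exp_le/=.
have [s [es <- s2]] := len_lift (ce t).
have [k e] := ce_eq es.
have s2' : `|s| <= 2^-1 by have [u [eu _ _]] := len_lift (ce t); rewrite (le_trans _ s2)//.
case: (ltgtP k 0) => k0.
- have : (k%:~R : R) <= -1 by rewrite -[1]/((1%:Z)%:~R) -mulrNz ler_int; lia.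
  move: t1 s2'; rewrite !ler_norml => ? ? ?.
  by apply/andP; split; have := ler_norm s; have := ler_norm (- s); rewrite normrN; lra.
- have : (1 : R) <= k%:~R by rewrite -[1]/((1%:Z)%:~R) ler_int; lia.
  move: t1 s2'; rewrite !ler_norml => ? ? ?.
  by apply/andP; split; have := ler_norm s; have := ler_norm (- s); rewrite normrN; lra.
- by rewrite e k0 addr0.
Qed.

Lemma lenV x : len (cinv x) = len x.
Proof.
have [t [e1 e2 e3]] := len_lift x.
by rewrite -e1 -ceN !len_small ?normrN ?e2.
Qed.

Definition cdist x y := len (cmul (cinv x) y).

Lemma cdist_ge0 x y : 0 <= cdist x y. Proof. exact: len_ge0. Qed.

Lemma cdistxx x : cdist x x = 0.
Proof. by rewrite /cdist cVmul len1. Qed.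

Lemma cdistC x y : cdist x y = cdist y x.
Proof. by rewrite /cdist -lenV cinvM cinvK cmulC. Qed.

Lemma cdist_tri y x z : cdist x z <= cdist x y + cdist y z.
Proof.
rewrite /cdist; apply: le_trans (lenM _ _).
by rewrite -cmulA cmulKV.
Qed.

Lemma cdist_eq0 x y : cdist x y = 0 -> x = y.
Proof. by move/len_eq0 => e; rewrite -[y](cmulKV x) e cmul1. Qed.

Lemma cdistM x t : cdist x (cmul x (ce t)) <= `|t|.
Proof. by rewrite /cdist cmulVK len_exp_le. Qed.

Lemma cdistMl z x y : cdist (cmul z x) (cmul z y) = cdist x y.
Proof.
rewrite /cdist; congr len; rewrite cinvM (cmulC (cinv z)) -cmulA; congr cmul.
by rewrite cmulVK.
Qed.

Section CircleContinuity.
Context {X : topologicalType}.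
Implicit Types f g : X -> C.

Lemma ctscmul f g : continuous f -> continuous g ->
  continuous (fun p => cmul (f p) (g p)).
Proof.
move=> cf cg; apply: cts_sub; apply: cts_pair.
  by change (continuous (fun p => (set_val (f p)).1 * (set_val (g p)).1 -
                              (set_val (f p)).2 * (set_val (g p)).2)); cts.
by change (continuous (fun p => (set_val (f p)).1 * (set_val (g p)).2 +
                                (set_val (f p)).2 * (set_val (g p)).1)); cts.
Qed.

Lemma ctscinv f : continuous f -> continuous (fun p => cinv (f p)).
Proof.
move=> cf; apply: cts_sub.
by change (continuous (fun p => ((set_val (f p)).1, - (set_val (f p)).2))); cts.
Qed.

Lemma ctsce (f : X -> R) : continuous f -> continuous (fun p => ce (f p)).
Proof.
move=> cf; apply: cts_sub.
by change (continuous (fun p => (cos (2 * pi * f p), sin (2 * pi * f p)))); cts.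
Qed.

End CircleContinuity.

Lemma len_near1 e : 0 < e -> \forall x \near cone, len x < e.
Proof.
move=> e0; have pi0 := @pi_gt0 R.
pose e' := Num.min e 2^-1.
have e'0 : 0 < e' by rewrite lt_min e0 invr_gt0 ltr0n.
have e'2 : e' <= 2^-1 by rewrite ge_min lexx orbT.
have inI (u : R) : 0 <= u <= 2^-1 -> 2 * pi * u \in `[0, pi].
  move=> /andP[u0 u1]; rewrite in_itv/= mulr_ge0 ?mulr_ge0 ?(ltW pi0)//=.
  by have := ler_wpM2l (ltW pi0) u1; lra.
have : \forall x \near cone, cos (2 * pi * e') < (set_val x).1.
  apply: (@cts_near _ _ (fun x : C => (set_val x).1) _ [set u | cos (2 * pi * e') < u]).
  - by cts; exact: cts_id.
  - exact: open_gt.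
  - rewrite /= ltr_cos ?inI// ?lexx ?invr_ge0 ?ler0n ?(ltW e'0)//.
    by rewrite mulr0 mulr_gt0// mulr_gt0.
apply: filterS => x; have [t [<- <- t2]] := len_lift x.
rewrite [X in _ < X -> _](_ : _ = cos (2 * pi * `|t|)); last first.
  by rewrite /=; case: (ger0P t) => // _; rewrite mulrN cosN.
rewrite ltr_cos ?inI ?(ltW e'0) ?normr_ge0 ?e'2//.
by rewrite ltr_pM2l ?mulr_gt0// => h; apply: lt_le_trans h _; rewrite ge_min lexx.
Qed.

Lemma ctslen (X : topologicalType) (f : X -> C) : continuous f ->
  continuous (fun p => len (f p)).
Proof.
move=> cf p; apply/cvgrPdist_lt => /= e e0.
have c : continuous (fun q => cmul (cinv (f p)) (f q)).
  by apply: ctscmul => //; exact: cts_cst.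
have := len_near1 e0; rewrite -(cVmul (f p)) => H.
have := c p _ H; rewrite /= /nbhs /=; apply: filterS => q /= h.
have h1 := lenM (f p) (cmul (cinv (f p)) (f q)).
have h2 := lenM (f q) (cinv (cmul (cinv (f p)) (f q))).
rewrite cmulKV in h1; rewrite lenV cinvM cinvK (cmulC _ (cinv _)) cmulKV in h2.
by rewrite ltr_norml; lra.
Qed.

Lemma ctscdist (X : topologicalType) (f g : X -> C) : continuous f -> continuous g ->
  continuous (fun p => cdist (f p) (g p)).
Proof. by move=> cf cg; apply: ctslen; apply: ctscmul => //; exact: ctscinv. Qed.

(** A continuous function on the circle that inverts [circle_exp] near 0; the
    argument of [asin] is truncated to stay away from the end points. *)
Definition tau x : R :=
  let s := sin (pi / 6) in
  asin (Num.max (- s) (Num.min (set_val x).2 s)) / (2 * pi).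

Let s0_bound : 0 < sin (pi / 6 : R) < 1.
Proof.
have pi0 := @pi_gt0 R; apply/andP; split; first by apply: sin_gt0_pi; lra.
by rewrite -[X in _ < X](@sin_pihalf R) ltr_sin ?in_itv/=; lra.
Qed.

Lemma ctstau (X : topologicalType) (f : X -> C) : continuous f ->
  continuous (fun p => tau (f p)).
Proof.
move=> cf; rewrite /tau; apply: ctsM; last exact: cts_cst.
have /andP[h0 h1] := s0_bound.
have ch : continuous (fun p => Num.max (- sin (pi / 6)) (Num.min (set_val (f p)).2 (sin (pi / 6 : R)))).
  by cts.
move: ch; set h := (fun p => Num.max _ _) => ch p.
have : {for p, continuous (@asin R \o h)}; last by [].
apply: continuous_comp; first exact: ch.
rewrite /h; apply: continuous_asin; apply/andP; split.
  by rewrite lt_max ltrN2 h1.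
by rewrite gt_max gt_min h1 orbT andbT; lra.
Qed.

Lemma tau_exp t : `|t| <= 12^-1 -> tau (ce t) = t.
Proof.
have pi0 := @pi_gt0 R; rewrite ler_norml => /andP[t1 t2].
have b1 : 2 * pi * t <= pi / 6.
  by have := ler_wpM2l (ltW pi0) t2; lra.
have b2 : - (pi / 6) <= 2 * pi * t.
  by have := ler_wpM2l (ltW pi0) t1; lra.
have I1 : 2 * pi * t \in `[(- (pi / 2)), pi / 2] by rewrite in_itv/=; lra.
have I2 : (pi / 6 : R) \in `[(- (pi / 2)), pi / 2] by rewrite in_itv/=; lra.
have I3 : (- (pi / 6) : R) \in `[(- (pi / 2)), pi / 2] by rewrite in_itv/=; lra.
rewrite /tau/= min_l; last first.
  by rewrite leNgt ltr_sin// -leNgt.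
rewrite max_r; last by rewrite -sinN leNgt ltr_sin// -leNgt.
by rewrite sinK// mulrC mulrA mulVf ?mul1r// mulf_neq0// gt_eqF.
Qed.

Lemma tauP x : len x <= 12^-1 -> ce (tau x) = x /\ `|tau x| = len x.
Proof.
by have [t [e1 e2 _]] := len_lift x; rewrite -e2 -e1 => /tau_exp ->; rewrite e1.
Qed.

Lemma tau1 : tau cone = 0.
Proof. by rewrite /cone tau_exp// normr0 invr_ge0. Qed.

End CircleGroup.

Ltac ctsC_rule :=
  lazymatch goal with
  | |- forall x, @continuous_at _ _ x (cmul ?a) =>
      apply: (ctscmul (f := fun _ => a) (g := fun y => y))
  | |- forall x, @continuous_at _ _ x (@cinv _) =>
      apply: (ctscinv (f := fun y => y))
  | |- forall x, @continuous_at _ _ x (@circle_exp _) =>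
      apply: (ctsce (f := fun y => y))
  | |- forall x, @continuous_at _ _ x (cdist ?a) =>
      apply: (ctscdist (f := fun _ => a) (g := fun y => y))
  | |- forall x, @continuous_at _ _ x (fun y => cmul (@?f y) (@?g y)) =>
      apply: ctscmul
  | |- forall x, @continuous_at _ _ x (fun y => cinv (@?f y)) => apply: ctscinv
  | |- forall x, @continuous_at _ _ x (fun y => circle_exp (@?f y)) =>
      apply: ctsce
  | |- forall x, @continuous_at _ _ x (fun y => len (@?f y)) => apply: ctslen
  | |- forall x, @continuous_at _ _ x (fun y => cdist (@?f y) (@?g y)) =>
      apply: ctscdist
  | |- forall x, @continuous_at _ _ x (fun y => tau (@?f y)) => apply: ctstau
  | _ => cts_rule
  end.
Ltac ctsC := repeat (first [assumption | cts_const | ctsC_rule]).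

(** * A retraction onto tree-like unions of coordinate circles *)

Section Sawtooth.
Context {R : realType}.
Implicit Types (u h t : R).

Definition saw u : R := 1 - 2 * (u - (Num.floor u)%:~R).
Definition saw' u : R := - saw (- u).

Lemma saw_le1 u : saw u <= 1.
Proof. by have /andP[] := floor_itv u; rewrite /saw; lra. Qed.

Lemma saw_geN1 u : -1 <= saw u.
Proof. by have /andP[] := floor_itv u; rewrite intrD /saw; lra. Qed.

Lemma saw'_le1 u : saw' u <= 1.
Proof. by have := saw_geN1 (- u); rewrite /saw'; lra. Qed.

Lemma saw'_geN1 u : -1 <= saw' u.
Proof. by have := saw_le1 (- u); rewrite /saw'; lra. Qed.

Lemma sawDint u (k : int) : saw (u + k%:~R) = saw u.
Proof.
by rewrite /saw floorDrz ?intr_int// intrKfloor intrD; ring.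
Qed.

Lemma saw'Dint u (k : int) : saw' (u + k%:~R) = saw' u.
Proof. by rewrite /saw' -(sawDint (- u) (- k)) mulrNz (opprD u). Qed.

Lemma saw0 : saw 0 = 1.
Proof. by rewrite /saw floor0; ring. Qed.

Lemma saw'0 : saw' 0 = -1.
Proof. by rewrite /saw' oppr0 saw0. Qed.

Lemma saw_slope u h : 0 <= h -> saw u - 2 * h <= saw (u + h).
Proof.
move=> h0; have : (Num.floor u <= Num.floor (u + h)).
  by rewrite floor_ge_int (le_trans (floor_le u))// lerDl.
by rewrite -(ler_int R) /saw; lra.
Qed.

Lemma saw'_slope u h : 0 <= h -> saw' u - 2 * h <= saw' (u + h).
Proof.
move=> h0; have := saw_slope (- (u + h)) h0.
by rewrite /saw' (_ : - (u + h) + h = - u); [lra|ring].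
Qed.

(** Jumps are upwards, so the left limit at a later point still dominates. *)
Lemma saw_slope_lt u h : 0 < h -> saw u - 2 * h <= saw' (u + h).
Proof.
move=> h0; rewrite /saw' /saw.
have /andP[f1 f2] := floor_itv u.
have /andP[g1 g2] := floor_itv (- (u + h)); rewrite intrD in g2.
have : Num.floor u + Num.floor (- (u + h)) <= -1.
  rewrite -ltzD1 addNr -(ltr_int R) intrD; lra.
by rewrite -(ler_int R) intrD mulrNz; lra.
Qed.

Lemma saw_right u : \forall h \near 0^'+, saw (u + h) <= saw u.
Proof.
have /andP[f1 f2] := floor_itv u.
have d0 : 0 < (Num.floor u + 1)%:~R - u by rewrite subr_gt0.
near=> h.
have h0 : 0 < h by [].
have hd : h < (Num.floor u + 1)%:~R - u by near: h; exact: nbhs_right_lt.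
have e : Num.floor (u + h) = Num.floor u.
  by apply: floor_def; apply/andP; split; lra.
by rewrite /saw e; lra.
Unshelve. all: by end_near. Qed.

Lemma saw'_left u : \forall h \near 0^'+, saw' u <= saw' (u - h).
Proof.
have := saw_right (- u); apply: filterS => h; rewrite /saw'.
by rewrite (_ : - (u - h) = - u + h); [lra|ring].
Qed.

End Sawtooth.

Section Prox.
Context {R : realType} {I : finType}.
Local Notation C := (circle R).
Implicit Types (m : I -> R) (u : I -> C) (y : R).

Definition upF m u y : R := y + \sum_j m j * saw (y - angle (u j)).
Definition loF m u y : R := y + \sum_j m j * saw' (y - angle (u j)).

(** [Psi m u] minimizes the sum of [y ^ 2 / 2] and of the potentials
    [m j * s * (1 - s)], where [s] in [0, 1] is the class of [y - u j] modulo 1;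
    the derivative of this function jumps from [loF] to [upF]. *)
Definition Psi m u : R := xget 0 [set y | loF m u y <= 0 <= upF m u y].

Definition small_mass m := (forall j, 0 <= m j) /\ \sum_j m j <= 4^-1.

Lemma loF_lift m u (a : I -> R) y : (forall j, circle_exp (a j) = u j) ->
  loF m u y = y + \sum_j m j * saw' (y - a j).
Proof.
move=> au; congr (_ + _); apply: eq_bigr => j _.
have [|k ->] := @ce_eq _ (angle (u j)) (a j); first by rewrite angleK.
by congr (_ * _); rewrite -(saw'Dint (y - (a j + k%:~R)) k); congr saw'; ring.
Qed.

Lemma F_mono m u x y : small_mass m -> x < y ->
  upF m u x + (y - x) / 2 <= loF m u y.
Proof.
move=> [m0 m1] xy; rewrite /upF /loF.
have H : \sum_j m j * saw (x - angle (u j)) - \sum_j m j * (2 * (y - x))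
   <= \sum_j m j * saw' (y - angle (u j)).
  rewrite -sumrB; apply: ler_sum => j _; rewrite -mulrBr; apply: ler_wpM2l => //.
  have yx : 0 < y - x by rewrite subr_gt0.
  have := saw_slope_lt (x - angle (u j)) yx.
  by rewrite (_ : x - _ + (y - x) = y - angle (u j)); last by ring.
rewrite -mulr_suml in H.
have : (\sum_j m j) * (2 * (y - x)) <= 4^-1 * (2 * (y - x)).
  by apply: ler_wpM2r => //; lra.
by move: H; set A := \sum_j _; set B := \sum_j _ ; set D := (\sum_j _) * _; lra.
Qed.

Lemma loF_le_upF m u y : small_mass m -> loF m u y <= upF m u y.
Proof.
move=> [m0 m1]; rewrite lerD2l; apply: ler_sum => j _; apply: ler_wpM2l => //.
rewrite /saw' /saw; set a := y - _.
have /andP[f1 f2] := floor_itv a.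
have /andP[g1 g2] := floor_itv (- a); rewrite intrD in g2.
have : Num.floor a + Num.floor (- a) <= 0.
  by rewrite -(ler_int R) intrD; lra.
have : -1 <= Num.floor a + Num.floor (- a).
  rewrite -ltzD1 -(ltr_int R) !intrD; rewrite intrD in f2; lra.
by rewrite -!(ler_int R) intrD mulrNz; lra.
Qed.

Lemma Psi_exists m u : small_mass m -> exists y, loF m u y <= 0 <= upF m u y.
Proof.
move=> sm; have [m0 m1] := sm.
have sb y : y - 4^-1 <= upF m u y <= y + 4^-1.
  have H1 : \sum_j m j * saw (y - angle (u j)) <= \sum_j m j.
    by apply: ler_sum => j _; rewrite ler_piMr// saw_le1.
  have H2 : - \sum_j m j <= \sum_j m j * saw (y - angle (u j)).
    rewrite -sumrN; apply: ler_sum => j _; rewrite -mulrN1.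
    by apply: ler_wpM2l => //; exact: saw_geN1.
  by rewrite /upF; move: H1 H2 m1; set A := \sum_j _; set B := \sum_j _; lra.
pose E := [set y | upF m u y < 0].
have E0 : E !=set0 by exists (-1); rewrite /E/=; have := sb (-1); lra.
have Eub : ubound E 1.
  by move=> y; rewrite /E/= => y0; have := sb y; lra.
have hE : has_sup E by split => //; exists 1.
exists (sup E); apply/andP; split; rewrite leNgt; apply/negP => H.
- have H' : \forall h \near 0^'+, forall j,
      saw' (sup E - angle (u j)) <= saw' (sup E - angle (u j) - h).
    by apply: filter_forall => j; exact: saw'_left.
  near (0:R)^'+ => h.
  have h0 : 0 < h by [].
  have hl : h < loF m u (sup E) by near: h; exact: nbhs_right_lt.
  have hs : forall j, saw' (sup E - angle (u j)) <= saw' (sup E - angle (u j) - h).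
    by near: h.
  have l1 : loF m u (sup E) - h <= loF m u (sup E - h).
    rewrite /loF addrAC lerD2l; apply: ler_sum => j _.
    by apply: ler_wpM2l => //; rewrite (addrAC _ (- h)).
  have l2 := loF_le_upF u (sup E - h) sm.
  have : sup E <= sup E - h.
    apply: ge_sup => // y Ey; rewrite leNgt; apply/negP => hy.
    have := F_mono u sm hy; have := loF_le_upF u y sm.
    by move: Ey; rewrite /E/=; lra.
  by lra.
- have H' : \forall h \near 0^'+, forall j,
      saw (sup E - angle (u j) + h) <= saw (sup E - angle (u j)).
    by apply: filter_forall => j; exact: saw_right.
  near (0:R)^'+ => h.
  have h0 : 0 < h by [].
  have hl : h < - upF m u (sup E) by near: h; apply: nbhs_right_lt; lra.
  have hs : forall j, saw (sup E - angle (u j) + h) <= saw (sup E - angle (u j)).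
    by near: h.
  have l1 : upF m u (sup E + h) <= upF m u (sup E) + h.
    rewrite /upF [leRHS]addrAC lerD2l; apply: ler_sum => j _.
    by apply: ler_wpM2l => //; rewrite (addrAC _ h).
  have : sup E + h <= sup E by apply: ub_le_sup; [case: hE|rewrite /E/=; lra].
  by lra.
Unshelve. all: by end_near. Qed.

Lemma PsiP m u : small_mass m -> loF m u (Psi m u) <= 0 <= upF m u (Psi m u).
Proof.
move=> sm; rewrite /Psi; case: xgetP => [y _ //|H].
by have [y hy] := Psi_exists u sm; case: (H y).
Qed.

Lemma Psi_uniq m u y : small_mass m -> loF m u y <= 0 <= upF m u y -> Psi m u = y.
Proof.
move=> sm hy; have hx := PsiP u sm.
case: (ltgtP (Psi m u) y) => // h.
- by have := F_mono u sm h; lra.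
- by have := F_mono u sm h; lra.
Qed.

Lemma Psi_half_lip m m' u u' : small_mass m -> small_mass m' ->
  Psi m' u' - Psi m u <=
    \sum_j cdist (u j) (u' j) + 2 * \sum_j `|m j - m' j|.
Proof.
move=> sm sm'; have [m0 m1] := sm'; have [n0 n1] := sm.
have /choice [t Ht] : forall j, exists t, circle_exp t = cmul (cinv (u j)) (u' j) /\
    `|t| = cdist (u j) (u' j).
  by move=> j; have [t [e1 e2 _]] := len_lift (cmul (cinv (u j)) (u' j)); exists t.
set D := \sum_j cdist _ _; set M := \sum_j `|_|.
have D0 : 0 <= D by apply: sumr_ge0 => j _; exact: cdist_ge0.
have M0 : 0 <= M by apply: sumr_ge0.
have [//|lt] := leP (Psi m' u' - Psi m u) (D + 2 * M); exfalso.
set x := Psi m u in lt *; set x' := Psi m' u' in lt *.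
have xy : x < x' - D by lra.
have F1 := F_mono u sm xy.
have /andP[_ Fx] := PsiP u sm; rewrite -/x in Fx.
have /andP[Fx' _] := PsiP u' sm'; rewrite -/x' in Fx'.
rewrite (@loF_lift _ _ (fun j => angle (u j) + t j)) in Fx'; last first.
  by move=> j; rewrite ceD angleK (Ht j).1 cmulKV.
have H : \sum_j m' j * (saw' (x' - D - angle (u j)) - 4 * D) <=
         \sum_j m' j * saw' (x' - (angle (u j) + t j)).
  apply: ler_sum => j _; apply: ler_wpM2l => //.
  have tD : `|t j| <= D.
    rewrite (Ht j).2 /D (bigD1 j)//= lerDl; apply: sumr_ge0 => k _.
    exact: cdist_ge0.
  have tD' : 0 <= D - t j by move: tD; rewrite ler_norml; lra.
  have := saw'_slope (x' - D - angle (u j)) tD'.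
  rewrite (_ : _ - _ - _ + (D - t j) = x' - (angle (u j) + t j)); last by ring.
  by move: tD; rewrite ler_norml; lra.
have H2 : \sum_j m j * saw' (x' - D - angle (u j)) - M <=
   \sum_j m' j * saw' (x' - D - angle (u j)).
  rewrite -sumrB; apply: ler_sum => j _.
  have := saw'_le1 (x' - D - angle (u j)).
  have := saw'_geN1 (x' - D - angle (u j)).
  set s := saw' _ => s1 s2.
  have : `|(m j - m' j) * s| <= `|m j - m' j|.
    by rewrite normrM ler_piMr// ler_norml s1 s2.
  have := ler_norm ((m j - m' j) * s).
  by lra.
have H3 : \sum_j m' j * (saw' (x' - D - angle (u j)) - 4 * D) =
   \sum_j m' j * saw' (x' - D - angle (u j)) - (\sum_j m' j) * (4 * D).
  by rewrite mulr_suml -sumrB; apply: eq_bigr => j _; ring.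
have H4 : (\sum_j m' j) * (4 * D) <= 4^-1 * (4 * D).
  by apply: ler_wpM2r => //; lra.
rewrite /loF in F1.
move: H H2 H3 H4 F1 Fx Fx'.
set A1 := \sum_j _; set A2 := \sum_j _; set A3 := \sum_j _; set A4 := \sum_j _.
set A5 := (\sum_j _) * _.
lra.
Qed.

Lemma Psi_lip m m' u u' : small_mass m -> small_mass m' ->
  `|Psi m u - Psi m' u'| <=
    \sum_j cdist (u j) (u' j) + 2 * \sum_j `|m j - m' j|.
Proof.
move=> sm sm'; have h1 := Psi_half_lip u u' sm sm'.
have h2 := Psi_half_lip u' u sm' sm.
rewrite ler_norml; apply/andP; split; first by lra.
apply: le_trans h2 _; rewrite (eq_bigr (fun j => cdist (u j) (u' j))); last first.
  by move=> j _; exact: cdistC.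
rewrite (_ : \sum_j `|m' j - m j| = \sum_j `|m j - m' j|)//.
by apply: eq_bigr => j _; exact: distrC.
Qed.

Lemma ctsPsi (X : topologicalType) (m : X -> I -> R) (u : X -> I -> C) :
  (forall x, small_mass (m x)) -> (forall j, continuous (fun x => m x j)) ->
  (forall j, continuous (fun x => u x j)) ->
  continuous (fun x => Psi (m x) (u x)).
Proof.
move=> sm cm cu x; apply/cvgrPdist_le => /= e e0.
pose g (y : X) := \sum_j cdist (u x j) (u y j) + 2 * \sum_j `|m x j - m y j|.
have cg : continuous g.
  apply: ctsD; first by ctsC.
  by apply: ctsM; [exact: cts_cst|apply: ctssum => j; cts].
have gx : g x < e.
  rewrite /g !big1 ?mulr0 ?addr0// => j _; last exact: cdistxx.
  by rewrite subrr normr0.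
have H : \forall y \near x, g y < e by exact: (cvgr_lt _ (cg x)).
move: H; apply: filterS => y gy.
by apply: le_trans (Psi_lip _ _ (sm x) (sm y)) (ltW gy).
Qed.

End Prox.

(** A tree of circles inside a torus is recorded by the matrix [p], where the
    [l]-th circle consists of the points whose [k]-th coordinate is [p l k] for
    all [k != l]. *)
Section Retraction.
Context {R : realType} {n : nat}.
Local Notation C := (circle R).
Local Notation T := (torus R n).
Implicit Types (p : 'I_n -> T) (v w : T) (i j k l : 'I_n) (e : R).

(** Seen in the product of the [i]-th and [j]-th circles, every [k]-th circle
    lies on the wedge of those two. *)
Definition treelike p := forall i j k, i != j -> k != i -> k != j ->
  p k i = p j i \/ p k j = p i j.

Definition tree p : set T :=
  [set w | forall i j, i != j -> w i = p j i \/ w j = p i j].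

Definition on_circle p l w := forall k, k != l -> w k = p l k.

Definition tclose e w v := forall k, cdist (w k) (v k) <= e.

Lemma tclose_sym e w v : tclose e w v -> tclose e v w.
Proof. by move=> h k; rewrite cdistC. Qed.

Lemma tclose_tri v e e' w u : tclose e w v -> tclose e' v u ->
  tclose (e + e') w u.
Proof. by move=> h h' k; apply: le_trans (cdist_tri (v k) _ _) (lerD _ _). Qed.

Lemma tclose_le e e' w v : e <= e' -> tclose e w v -> tclose e' w v.
Proof. by move=> ee h k; apply: le_trans ee. Qed.

Lemma on_circle_tree p l w : treelike p -> on_circle p l w -> tree p w.
Proof.
move=> tp lw i j ij; have [li|nli] := eqVneq i l.
  by right; rewrite lw -?li// eq_sym.
have [lj|nlj] := eqVneq j l; first by left; rewrite lw -?lj.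
by rewrite !lw//; apply: tp => //; rewrite eq_sym.
Qed.

(** The relation saying that [w] lies off the [i]-th circle in the direction of
    the [k]-th one is a strict order, so it has a maximal element. *)
Lemma tree_on_circle p w (i0 : 'I_n) : treelike p -> tree p w ->
  exists l, on_circle p l w.
Proof.
move=> tp tw.
pose r i := [set k | (k != i) && `[< w k <> p i k >]]%SET.
have trans i k j : k \in r i -> j \in r k -> j \in r i.
  rewrite !inE => /andP[ki /asboolP hik] /andP[jk /asboolP hkj].
  have ik : i != k by rewrite eq_sym.
  have wi : w i = p k i by case: (tw i k ik) => // /hik.
  have ij : j != i by apply/eqP => e; apply: hkj; rewrite e.
  rewrite ij/=; apply/asboolP => wj.
  have kj : k != j by rewrite eq_sym.
  have wk : w k = p j k by case: (tw k j kj) => // /hkj.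
  have [e|e] : p i k = p j k \/ p i j = p k j.
    by apply: tp; rewrite // eq_sym.
  - by apply: hik; rewrite e.
  - by apply: hkj; rewrite -e.
have irr i : i \notin r i by rewrite inE eqxx.
have [l _ Hl] := arg_minnP (fun i => #|r i|) (erefl (xpredT i0)).
exists l => k kl; apply: contrapT => wk.
have rk : k \in r l by rewrite inE kl; apply/asboolP.
have : (#|r k| < #|r l|)%N.
  apply: proper_card; apply/properP; split.
    by apply/fintype.subsetP => j; exact: trans.
  by exists k.
by rewrite ltnNge Hl.
Qed.

(** Since [saw] and [saw'] have slope -2 between upward jumps, a total force of
    at most 1/4 leaves [upF] and [loF] strictly increasing; [eta] bounds each of
    the forces accordingly, and errors of size [eps] in all coordinates add up
    to less than [eta]. *)
Definition eta : R := (4 * n.+1%:R)^-1.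
Definition eps : R := eta / n.+1%:R.

Lemma eta_gt0 : 0 < eta. Proof. by rewrite invr_gt0 mulr_gt0. Qed.

Lemma eps_gt0 : 0 < eps. Proof. by rewrite divr_gt0// eta_gt0. Qed.

Lemma eps_eta : n.+1%:R * eps = eta.
Proof. by rewrite /eps mulrC divfK// pnatr_eq0. Qed.

Lemma eps_le_eta : eps <= eta.
Proof.
rewrite -eps_eta ler_peMl ?(ltW eps_gt0)//.
by rewrite ler1n.
Qed.

Definition mass p w i j : R :=
  if j == i then 0 else Num.min (cdist (w j) (p i j)) eta.

Definition target p w i j : C := cmul (cinv (w i)) (p j i).

(** The [i]-th coordinate of [w] is attracted by the [j]-th circle with a force
    measured by how far the [j]-th coordinate is from the [i]-th circle. *)
Definition rho p w : T :=
  fun i => cmul (w i) (circle_exp (Psi (mass p w i) (target p w i))).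

Lemma mass_ge0 p w i j : 0 <= mass p w i j.
Proof.
rewrite /mass; case: ifP => // _.
by rewrite le_min cdist_ge0 (ltW eta_gt0).
Qed.

Lemma mass_le p w i j : mass p w i j <= eta.
Proof. by rewrite /mass; case: ifP => _; rewrite ?(ltW eta_gt0)// ge_min lexx orbT. Qed.

Lemma mass_le_dist p w i j : mass p w i j <= cdist (w j) (p i j).
Proof. by rewrite /mass; case: ifP => _; rewrite ?cdist_ge0// ge_min lexx. Qed.

Lemma mass_small p w i : small_mass (mass p w i).
Proof.
split=> [j|]; first exact: mass_ge0.
have : \sum_j mass p w i j <= \sum_(j < n) eta by apply: ler_sum => j _; exact: mass_le.
move/le_trans; apply.
rewrite sumr_const card_ord -[eta *+ n]mulr_natl.
have e : n.+1%:R * eta = 4^-1.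
  by rewrite /eta invfM mulrCA mulfV ?mulr1// pnatr_eq0.
by rewrite -e ler_wpM2r ?(ltW eta_gt0)// ler_nat.
Qed.

(** On the tree, each circle either exerts no force on the [i]-th coordinate or
    passes through it, where the corner of its potential holds it fast. *)
Lemma Psi_tree p w i : treelike p -> tree p w ->
  Psi (mass p w i) (target p w i) = 0.
Proof.
move=> tp tw; have [l lw] := tree_on_circle i tp tw.
have sm := mass_small p w i.
have H j : mass p w i j = 0 \/ target p w i j = cone.
  have [ji|ji] := eqVneq j i; first by left; rewrite /mass ji eqxx.
  have [li|li] := eqVneq l i.
    left; rewrite /mass (negbTE ji) lw; last by rewrite li.
    by rewrite -li cdistxx min_l// (ltW eta_gt0).
  have wi : w i = p l i by apply: lw; rewrite eq_sym.
  have [jl|jl] := eqVneq j l.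
    by right; rewrite /target wi jl cVmul.
  have [e|e] : p l i = p j i \/ p l j = p i j by apply: tp; rewrite // eq_sym.
    by right; rewrite /target wi e cVmul.
  left; rewrite /mass (negbTE ji) lw// e.
  by rewrite cdistxx min_l// (ltW eta_gt0).
apply: Psi_uniq => //; rewrite (@loF_lift _ _ _ _ (fun j => angle (target p w i j))); last by move=> j; exact: angleK.
have a1 : angle (cone : C) = 0 by rewrite /cone angle_exp// lexx ltr01.
rewrite /upF !add0r; apply/andP; split.
- apply: sumr_le0 => j _; have [->|->] := H j; first by rewrite mul0r.
  by rewrite a1 subr0 saw'0 mulrN1 oppr_le0 mass_ge0.
- apply: sumr_ge0 => j _; have [->|->] := H j; first by rewrite mul0r.
  by rewrite a1 subr0 saw0 mulr1 mass_ge0.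
Qed.

Lemma rho_id p w : treelike p -> tree p w -> rho p w = w.
Proof.
move=> tp tw; apply/funext => i.
by rewrite /rho Psi_tree// cmul1.
Qed.

(** By [Psi_lip], as forces and positions are those at [v] up to [e]. *)
Lemma rho_close p v w e : treelike p -> tree p v -> tclose e w v -> 0 <= e ->
  tclose (3 * n.+1%:R * e) w (rho p w).
Proof.
move=> tp tv wv e0 i; apply: le_trans (cdistM _ _) _.
rewrite -[Psi _ _]subr0 -(Psi_tree i tp tv).
apply: le_trans (Psi_lip _ _ (mass_small _ _ _) (mass_small _ _ _)) _.
have H1 : \sum_j cdist (target p w i j) (target p v i j) <= n%:R * e.
  rewrite mulr_natl -[X in _ *+ X]card_ord -sumr_const; apply: ler_sum => j _.
  rewrite /target ![cmul (cinv _) _]cmulC cdistMl /cdist -cinvM lenV.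
  by have := wv i; rewrite /cdist.
have H2 : \sum_j `|mass p w i j - mass p v i j| <= n%:R * e.
  rewrite mulr_natl -[X in _ *+ X]card_ord -sumr_const; apply: ler_sum => j _.
  rewrite /mass; case: ifP => _; first by rewrite subrr normr0.
  have h1 := cdist_tri (v j) (w j) (p i j).
  have h2 := cdist_tri (w j) (v j) (p i j).
  rewrite (cdistC (v j) (w j)) in h2; have := wv j.
  move: h1 h2; set a := cdist (w j) (p i j); set b := cdist (v j) (p i j).
  by rewrite ler_norml; case: (leP a eta); case: (leP b eta); lra.
have : n%:R * e <= n.+1%:R * e by apply: ler_wpM2r => //; rewrite ler_nat.
by move: H1 H2; set A := \sum_j _; set B := \sum_j _; lra.
Qed.

(** If the attraction towards the [j]-th circle does not suffice to bring the
    [i]-th coordinate to [p j i], it is outweighed by the other attractions. *)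
Lemma rho_neq p w i j : i != j -> rho p w i <> p j i ->
  \sum_(k | `[< p k i = p j i >]) mass p w i k <
  cdist (w i) (p j i) + \sum_(k | ~~ `[< p k i = p j i >]) mass p w i k.
Proof.
move=> ij neq; have sm := mass_small p w i.
have [t [et nt _]] := len_lift (target p w i j).
rewrite -/(cdist _ _) in nt.
rewrite ltNge; apply/negP => le; apply: neq.
rewrite /rho (_ : Psi _ _ = t) ?et ?cmulKV//.
apply: Psi_uniq => //.
have sE (s : R -> R) (c : R) : (forall u (k : int), s (u + k%:~R) = s u) -> (s 0 = c) ->
   \sum_k mass p w i k * s (t - angle (target p w i k)) =
   \sum_(k | `[< p k i = p j i >]) mass p w i k * c +
   \sum_(k | ~~ `[< p k i = p j i >]) mass p w i k * s (t - angle (target p w i k)).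
  move=> sD s0; rewrite (bigID (fun k => `[< p k i = p j i >]))/=; congr (_ + _).
  apply: eq_bigr => k /asboolP e; congr (_ * _).
  have [|m ->] := @ce_eq _ t (angle (target p w i k)).
    by rewrite et angleK /target e.
  by rewrite addrAC subrr sD.
rewrite /loF /upF (sE saw' (-1) (@saw'Dint R) saw'0).
rewrite (sE saw 1 (@sawDint R) saw0) -!mulr_suml.
have H1 : \sum_(k | ~~ `[< p k i = p j i >]) mass p w i k * saw' (t - angle (target p w i k))
   <= \sum_(k | ~~ `[< p k i = p j i >]) mass p w i k.
  by apply: ler_sum => k _; rewrite ler_piMr ?mass_ge0 ?saw'_le1.
have H2 : - \sum_(k | ~~ `[< p k i = p j i >]) mass p w i k <=
  \sum_(k | ~~ `[< p k i = p j i >]) mass p w i k * saw (t - angle (target p w i k)).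
  rewrite -sumrN; apply: ler_sum => k _; rewrite -mulrN1.
  by apply: ler_wpM2l; [exact: mass_ge0|exact: saw_geN1].
move: le; rewrite -nt => le.
have t1 := ler_norm t; have t2 := ler_norm (- t); rewrite normrN in t2.
move: H1 H2 le; set S1 := \sum_(_ | _) _; set S2 := \sum_(_ | _) _.
by set S3 := \sum_(_ | _) _; set S4 := \sum_(_ | _) _; lra.
Qed.

Let tug (a b s s' h : R) : 0 <= s -> 0 <= s' ->
  (h < b -> a + s <= h) -> (h < a -> b + s' <= h) ->
  Num.min b h + s' < a + s -> Num.min a h + s < b + s' -> False.
Proof.
move=> s0 s0'.
case: (leP a h) => ha; case: (leP b h) => hb; lra.
Qed.

Section RhoIn.
Variables (p : 'I_n -> T) (w v : T).
Hypothesis tp : treelike p.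
Hypothesis tv : tree p v.
Hypothesis wv : tclose eps w v.

Let SB i j := \sum_(k | [&& ~~ `[< p k i = p j i >], k != i & k != j]) mass p w i k.

Let rho_neq' i j : i != j -> rho p w i <> p j i ->
  mass p w i j + SB j i < cdist (w i) (p j i) + SB i j.
Proof.
move=> ij /(rho_neq ij) H.
have E1 : \sum_(k | ~~ `[< p k i = p j i >]) mass p w i k = SB i j.
  rewrite /SB big_mkcond [RHS]big_mkcond; apply: eq_bigr => k _.
  have [->|ki] := eqVneq k i; first by rewrite /mass eqxx/= andbF; case: ifP.
  have [->|kj] := eqVneq k j; last by rewrite !andbT.
  by rewrite /= asboolT.
have E2 : mass p w i j + SB j i <= \sum_(k | `[< p k i = p j i >]) mass p w i k.
  rewrite (bigD1 j) ?asboolT//= lerD2l /SB.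
  rewrite big_mkcond [leRHS]big_mkcond; apply: ler_sum => k _.
  case: ifP => [/and3P[/asboolPn h kj ki]|_]; last by case: ifP => // _; exact: mass_ge0.
  have e : p k i = p j i.
    by have [//|] := tp ij ki kj.
  rewrite asboolT// kj/=.
  have e2 : p j k = p i k.
    have [e3|//] : p i j = p k j \/ p i k = p j k.
      by apply: tp; rewrite // eq_sym.
    by case: h.
  by rewrite /mass (negbTE kj) (negbTE ki) e2.
by rewrite -E1; apply: le_lt_trans E2 H.
Qed.

(** When the [i]-th coordinate of [w] is far from the [j]-th circle, [v] is not on
    that circle, so the [j]-th coordinate of [w] is almost on the [i]-th one and
    the circles pulling it elsewhere pull weakly: the truncation at [eta] is
    harmless. *)
Let far i j : i != j -> eta < cdist (w i) (p j i) ->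
  cdist (w j) (p i j) + SB j i <= eta.
Proof.
move=> ij di; have [l lv] := tree_on_circle i tp tv.
have near k : k != l -> cdist (w k) (p l k) <= eps.
  by move=> kl; rewrite -lv//; exact: wv.
have lj : l != j.
  apply/eqP => lj; have := near i _; rewrite lj => /(_ ij) h.
  by move: di; rewrite ltNge (le_trans h eps_le_eta).
have key k : k != i -> k != j -> p k j <> p i j -> k != l /\ p l k = p j k.
  move=> ki kj nk.
  have [li|li] := eqVneq l i.
    rewrite li; split=> //.
    have [//|e] : p i k = p j k \/ p i j = p k j by apply: tp; rewrite // eq_sym.
    by case: nk.
  have nli : p l i <> p j i.
    move=> e; have := near i _; rewrite eq_sym => /(_ li); rewrite e => h.
    by move: di; rewrite ltNge (le_trans h eps_le_eta).
  have lij : p l j = p i j by have [] := tp ij li lj.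
  have kl : k != l by apply/eqP => kl; apply: nk; rewrite kl.
  split=> //; have [//|e] : p l k = p j k \/ p l j = p k j.
    by apply: tp; rewrite // eq_sym.
  by case: nk; rewrite -e.
have dj : cdist (w j) (p i j) <= eps.
  have [li|li] := eqVneq l i; first by rewrite -li near// eq_sym.
  have nli : p l i <> p j i.
    move=> e; have := near i _; rewrite eq_sym => /(_ li); rewrite e => h.
    by move: di; rewrite ltNge (le_trans h eps_le_eta).
  have lij : p l j = p i j by have [] := tp ij li lj.
  by rewrite -lij near// eq_sym.
have SBle : SB j i <= n%:R * eps.
  rewrite mulr_natl -[X in _ *+ X]card_ord -sumr_const /SB big_mkcond.
  apply: ler_sum => k _; case: ifP => [/and3P[/asboolPn nk kj ki]|_]; last exact: (ltW eps_gt0).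
  have [kl e] := key k ki kj nk.
  by apply: le_trans (mass_le_dist _ _ _ _) _; rewrite -e near.
by rewrite -eps_eta -natr1 mulrDl mul1r addrC; apply: lerD.
Qed.

(** For two coordinates the contributions of the other circles cancel, so both
    attractions cannot fail at once. *)
Lemma rho_in : tree p (rho p w).
Proof.
move=> i j ij; have [|ni] := pselect (rho p w i = p j i); first by left.
have [|nj] := pselect (rho p w j = p i j); first by right.
have ji : j != i by rewrite eq_sym.
exfalso; have h1 := rho_neq' ij ni; have h2 := rho_neq' ji nj.
move: h1 h2; rewrite /mass (negbTE ij) (negbTE ji).
have := far ij; have := far ji.
set a := cdist (w i) _; set b := cdist (w j) _.
set s := SB i j; set s' := SB j i.
have SB0 k l : 0 <= SB k l by apply: sumr_ge0 => ? _; exact: mass_ge0.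
exact: tug (SB0 _ _) (SB0 _ _).
Qed.

End RhoIn.

Lemma ctsrho (X : topologicalType) (p : X -> 'I_n -> T) (w : X -> T) :
  (forall i k, k != i -> continuous (fun x => p x i k)) -> continuous w ->
  continuous (fun x => rho (p x) (w x)).
Proof.
move=> cp cw; apply: cts_mkprod => i; rewrite /rho.
have cwi k : continuous (fun x => w x k) by exact: (@cts_app _ _ (fun _ => (C : topologicalType)) w k cw).
pose u x j := if j == i then cone else target (p x) (w x) i j.
have -> : (fun x => cmul (w x i) (circle_exp (Psi (mass (p x) (w x) i) (target (p x) (w x) i)))) =
  (fun x => cmul (w x i) (circle_exp (Psi (mass (p x) (w x) i) (u x)))).
  apply/funext => x; congr (cmul _ (circle_exp _)).
  apply: Psi_uniq; first exact: mass_small.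
  have := PsiP (u x) (mass_small (p x) (w x) i).
  have e s y : \sum_j mass (p x) (w x) i j * s (y - angle (u x j)) =
      \sum_j mass (p x) (w x) i j * s (y - angle (target (p x) (w x) i j)) :> R.
    by apply: eq_bigr => j _; rewrite /mass /u; case: eqP => // _; rewrite !mul0r.
  by rewrite /loF /upF !e.
apply: ctscmul => //; apply: ctsce; apply: ctsPsi => [x|j|j].
- exact: mass_small.
- rewrite /mass; case: (eqVneq j i) => ji; first exact: cts_cst.
  apply: ctsmin; last exact: cts_cst.
  by apply: ctscdist => //; exact: cp.
- rewrite /u /target; case: (eqVneq j i) => ji; first exact: cts_cst.
  by apply: ctscmul; [exact: ctscinv|apply: cp; rewrite eq_sym].
Qed.

End Retraction.

(** * Partitions of the circle *)

Section OneManifolds.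
Context {R : realType}.
Local Notation C := (circle R).
Local Notation ce := (@circle_exp R).
Implicit Types (A : set C) (t u : R).

Lemma nbhsR (t : R) (P : set R) :
  nbhs t P -> exists2 e, 0 < e & forall u, `|t - u| < e -> P u.
Proof. by move=> /nbhs_ballP[e /= e0 eP]; exists e => // u tu; exact: eP. Qed.

Lemma ce_nbhs A t : (\forall u \near t, A (ce u)) -> nbhs (ce t) A.
Proof.
move=> /nbhsR[e e0 eA].
have : \forall s \near ce t, len (cmul (cinv (ce t)) s) < Num.min e 12^-1.
  apply: (@cts_near _ _ (fun s => len (cmul (cinv (ce t)) s)) _ [set r | r < Num.min e 12^-1]).
  - by ctsC.
  - exact: open_lt.
  - by rewrite /= cVmul len1 lt_min e0 invr_gt0 ltr0n.
apply: filterS => s; rewrite lt_min => /andP[h1 h2].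
have [e1 e2] := tauP (ltW h2).
rewrite -(cmulKV (ce t) s) -e1 -ceD; apply: eA.
by rewrite opprD addrA subrr sub0r normrN e2.
Qed.

(** A 1-manifold in the circle is locally an arc: the image of a short interval
    under an inverse chart lifts to the line and is connected, hence is an
    interval. *)
Lemma manifold1_interval A t0 : @manifold1 R _ A -> A (ce t0) ->
  exists e (K : set R), [/\ 0 < e, is_interval K, K t0,
    exists2 t1, K t1 & t1 <> t0 & forall t, `|t0 - t| < e -> A (ce t) <-> K t].
Proof.
move=> mA At0; have [Ot [P [oO Ot0 oP [h [g [ch cg hg gh]]]]]] := mA _ At0.
have AO0 : (A `&` Ot) (ce t0) by [].
pose e0 : (A `&` Ot : set C) := exist _ (ce t0) (mem_set AO0).
pose u0 : R := set_val (h e0).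
have [hu0 Pu0] : (`[0, +oo[%classic `&` P : set R) u0 by exact: set_valP.
have u00 : 0 <= u0 by move: hu0; rewrite /= in_itv/= andbT.
pose HP := (`[0, +oo[%classic `&` P : set R).
have [eP eP0 ePP] : exists2 e, 0 < e & forall u, `|u0 - u| < e -> P u.
  by apply: nbhsR; exact: open_nbhs_nbhs.
(* shrink the chart so that the image stays in a short arc *)
have [d d0 dH] : exists2 d, 0 < d & forall y : HP, `|u0 - set_val y| < d ->
    cdist (ce t0) (set_val (g y)) < 12^-1.
  have c : continuous (fun y : HP => cdist (ce t0) (set_val (g y))).
    by ctsC.
  have : nbhs (h e0) [set y : HP | cdist (ce t0) (set_val (g y)) < 12^-1].
    by apply: (cts_near_lt c); rewrite hg /= cdistxx invr_gt0.
  move=> [_ [[W oW <-] Wu] WH].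
  have [d d0 dW] := nbhsR (open_nbhs_nbhs (conj oW Wu)).
  by exists d => // y hy; apply: WH; apply: dW.
pose r := Num.min eP d.
have r0 : 0 < r by rewrite lt_min eP0.
pose J : set R := [set u | 0 <= u /\ `|u0 - u| < r].
have JHP u : J u -> HP u.
  move=> [h1 h2]; split; first by rewrite /= in_itv/= h1.
  by apply: ePP; apply: lt_le_trans h2 _; rewrite ge_min lexx.
pose gam u : C := match pselect (J u) with
  | left h => set_val (g (exist _ u (mem_set (JHP u h)))) | right _ => ce t0 end.
have gamE u (hu : HP u) : J u -> gam u = set_val (g (exist _ u (mem_set hu))).
  move=> Ju; rewrite /gam; case: pselect => // h'; congr (set_val (g _)).
  exact: val_inj.
pose al s : R := t0 + tau (cmul (cinv (ce t0)) s).
have alK u : J u -> ce (al (gam u)) = gam u.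
  move=> Ju; rewrite /al ceD (gamE _ (JHP u Ju) Ju).
  have [|-> _] := @tauP R (cmul (cinv (ce t0)) (set_val (g (exist _ u (mem_set (JHP u Ju)))))).
    apply: ltW; apply: dH => /=; apply: lt_le_trans Ju.2 _.
    by rewrite ge_min lexx orbT.
  by rewrite cmulKV.
have Ju0 : J u0 by split=> //; rewrite subrr normr0.
have gam0 : gam u0 = ce t0.
  rewrite (gamE _ (JHP u0 Ju0) Ju0) (_ : exist _ _ _ = h e0) ?hg//.
  exact: val_inj.
have gaminj u v : J u -> J v -> gam u = gam v -> u = v.
  move=> Ju Jv; rewrite (gamE _ (JHP u Ju) Ju) (gamE _ (JHP v Jv) Jv) => /val_inj.
  by move=> /(can_inj gh) /(congr1 set_val).
pose K := (fun u => al (gam u)) @` J.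
have Kint : is_interval K.
  apply/connected_intervalP; apply: connected_continuous_connected.
    apply/connected_intervalP => a b [a0 ar] [b0 br] c /andP[ac cb].
    split; first exact: le_trans a0 ac.
    by move: ar br; rewrite !ltr_norml; lra.
  apply/subspace_sigL_continuousP.
  pose inc (y : J) : HP := exist _ (set_val y) (mem_set (JHP _ (set_valP y))).
  have -> : sigL J (fun u => al (gam u)) =
      fun y : J => t0 + tau (cmul (cinv (ce t0)) (set_val (g (inc y)))).
    apply/funext => y; rewrite /sigL/= /al.
    by rewrite (gamE _ (JHP _ (set_valP y)) (set_valP y)).
  have cinc : continuous inc by apply: cts_sub; exact: initial_continuous.
  have cgi : continuous (fun y => g (inc y)) by exact: cts_comp.
  by ctsC.
have [d' d'0 d'H] : exists2 d', 0 < d' & forall t, `|t0 - t| < d' -> Ot (ce t) /\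
    (forall e : (A `&` Ot : set C), set_val e = ce t -> `|u0 - set_val (h e)| < r).
  have : nbhs e0 [set e | `|u0 - set_val (h e)| < r].
    apply: (cts_near_lt (f := fun e : (A `&` Ot : set C) => `|u0 - set_val (h e)|)).
      by cts.
    by rewrite subrr normr0.
  move=> [_ [[W oW <-] Wu] WH].
  have : \forall t \near t0, W (ce t) /\ Ot (ce t).
    have cce : continuous (fun t : R => ce t) by apply: ctsce; exact: cts_id.
    have n1 := cts_near cce oW Wu; have n2 := cts_near cce oO Ot0.
    exact: filterI n1 n2.
  move=> /nbhsR[d' d'0 H]; exists d' => // t /H[Wt Ott]; split=> // e et.
  by apply: WH; rewrite /= et.
exists (Num.min d' 12^-1), K; split => //.
- by rewrite lt_min d'0 invr_gt0 ltr0n.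
- by exists u0 => //; rewrite gam0 /al cVmul tau1 addr0.
- have Ju1 : J (u0 + r / 2).
    split; first by rewrite addr_ge0// divr_ge0// ltW.
    by rewrite opprD addrA subrr sub0r normrN gtr0_norm; lra.
  exists (al (gam (u0 + r / 2))); first by exists (u0 + r / 2).
  move=> e; have := alK _ Ju1; rewrite e -gam0 => /(gaminj _ _ Ju0 Ju1).
  by lra.
- move=> t; rewrite lt_min => /andP[td tt]; have [Ott Ht] := d'H _ td.
  split=> [At|[u Ju <-]]; last first.
    rewrite alK// (gamE _ (JHP u Ju) Ju).
    by have [] := set_valP (g (exist _ u (mem_set (JHP u Ju)))).
  have AOt : (A `&` Ot) (ce t) by [].
  pose e : (A `&` Ot : set C) := exist _ (ce t) (mem_set AOt).
  have Ju : J (set_val (h e)).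
    split; last exact: Ht.
    by have [+ _] := set_valP (h e); rewrite /= in_itv/= andbT.
  exists (set_val (h e)) => //.
  rewrite (gamE _ (JHP _ Ju) Ju) (_ : exist _ _ _ = h e); last exact: val_inj.
  rewrite hg/= /al -ceN -ceD addrC tau_exp; first by ring.
  by rewrite addrC distrC ltW// -normrN opprB distrC.
Qed.

(** The interval is not reduced to a point, hence has interior points near each
    of its points. *)
Lemma manifold1_dense A t0 d : @manifold1 R _ A -> A (ce t0) -> 0 < d ->
  exists t, [/\ t != t0, `|t0 - t| < d & interior A (ce t)].
Proof.
move=> mA At0 d0.
have [e [K [e0 Ki Kt0 [t1 Kt1 t10] KA]]] := manifold1_interval mA At0.
pose m := Num.min (Num.min e d) `|t0 - t1|.
have m0 : 0 < m.
  rewrite !lt_min e0 d0 normr_gt0 subr_eq0/=; apply/eqP => e1.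
  by apply: t10.
have md : m <= d by rewrite !ge_min lexx orbT.
have me : m <= e by rewrite !ge_min lexx.
have m1 : m <= `|t0 - t1| by rewrite ge_min lexx orbT.
pose s := if t0 <= t1 then m / 2 else - (m / 2).
have st : `|t0 - (t0 + s)| < m.
  rewrite opprD addrA subrr sub0r normrN /s.
  by case: ifP => _; rewrite ?normrN gtr0_norm; lra.
exists (t0 + s); split.
- by rewrite -subr_eq0 addrC addKr /s; case: ifP => _; rewrite ?oppr_eq0 gt_eqF//; lra.
- exact: lt_le_trans st md.
- apply: ce_nbhs; apply/nbhs_ballP; exists (m / 4) => /=; first by lra.
  move=> u; rewrite /ball/= => us; apply/KA.
    rewrite ltr_norml; move: us st me; rewrite !ltr_norml; rewrite /s; case: ifP => _; lra.
  move: us m1; rewrite /s; case: (leP t0 t1) => t01.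
    rewrite (ler0_norm (_ : t0 - t1 <= 0)); last by lra.
    rewrite ltr_norml => us m1; apply: (Ki _ _ Kt0 Kt1); lra.
  rewrite (gtr0_norm (_ : 0 < t0 - t1)); last by lra.
  rewrite ltr_norml => us m1; apply: (Ki _ _ Kt1 Kt0); lra.
Qed.

(** Two intervals with two points in common share an open interval. *)
Lemma manifold1_overlap A A' t0 : @manifold1 R _ A -> @manifold1 R _ A' ->
  interior A `&` interior A' = set0 -> A (ce t0) -> A' (ce t0) ->
  exists2 e, 0 < e & forall t, `|t0 - t| < e -> A (ce t) -> A' (ce t) -> t = t0.
Proof.
move=> mA mA' d At At'.
have [e [K [e0 Ki Kt0 _ KA]]] := manifold1_interval mA At.
have [e' [K' [e'0 Ki' Kt0' _ KA']]] := manifold1_interval mA' At'.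
exists (Num.min e e'); first by rewrite lt_min e0.
move=> t; rewrite lt_min => /andP[te te'] At1 At1'; apply: contrapT => tt0.
have Kt : K t by apply/KA.
have Kt' : K' t by apply/KA'.
have tt : 0 < `|t0 - t|.
  by rewrite normr_gt0 subr_eq0; apply/eqP => e1; apply: tt0.
have H : forall u, `|(t0 + t) / 2 - u| < `|t0 - t| / 4 -> A (ce u) /\ A' (ce u).
  move=> u hu.
  have hu2 : `|t0 - u| < `|t0 - t|.
    move: hu tt; case: (leP t0 t) => h.
      by rewrite (ler0_norm (_ : t0 - t <= 0)) ?ltr_norml; lra.
    by rewrite (gtr0_norm (_ : 0 < t0 - t)) ?ltr_norml; lra.
  have hc (c : set R) : is_interval c -> c t0 -> c t -> c u.
    move=> ci c0 c1; move: hu; case: (leP t0 t) => h.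
      rewrite (ler0_norm (_ : t0 - t <= 0)) ?ltr_norml; last by lra.
      by move=> hu; apply: (ci _ _ c0 c1); lra.
    rewrite (gtr0_norm (_ : 0 < t0 - t)) ?ltr_norml; last by lra.
    by move=> hu; apply: (ci _ _ c1 c0); lra.
  by split; [apply/KA|apply/KA']; rewrite ?(lt_trans hu2)//; exact: hc.
have : (interior A `&` interior A') (ce ((t0 + t) / 2)).
  split; apply: ce_nbhs; apply/nbhs_ballP; exists (`|t0 - t| / 4) => /=;
    by [rewrite divr_gt0|move=> u /H[]].
by rewrite d.
Qed.

End OneManifolds.

Section ArcLength.
Context {R : realType}.
Local Notation C := (circle R).
Local Notation ce := (@circle_exp R).
Local Notation mu := (@lebesgue_measure R).
Implicit Types (J : set C) (s t : R).

Lemma closed_lift J : closed J -> closed (ce @^-1` J).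
Proof. by move=> cJ; apply: closed_comp => // x _; exact: ctsce cts_id _. Qed.

Lemma measurable_lift J (i : interval R) : closed J ->
  measurable ([set` i]%classic `&` ce @^-1` J).
Proof.
move=> cJ; apply: measurableI; first exact: measurable_itv.
by apply: measurable_realfun.closed_measurable; exact: closed_lift.
Qed.

Lemma lift_fin_num J (i : interval R) : closed J ->
  mu [set` i]%classic \is a fin_num ->
  mu ([set` i]%classic `&` ce @^-1` J) \is a fin_num.
Proof.
move=> cJ f; rewrite ge0_fin_numE; last exact: measure_ge0.
apply: le_lt_trans (_ : (mu [set` i]%classic < +oo)%E); last by rewrite -ge0_fin_numE.
by apply: le_measure; rewrite ?inE//; exact: measurable_lift.
Qed.

(** The collapse maps only move while their piece is being swept: this is what
    relates lengths to the order of the pieces on the circle. *)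
Lemma arc_length_split J s t : closed J -> 0 <= s -> s <= t ->
  exists r, [/\ 0 <= r, r <= t - s, arc_length J t = arc_length J s + r &
    (r = 0 \/ exists u, [/\ s < u, u < t & J (ce u)])].
Proof.
move=> cJ s0 st.
pose E := `]s, t]%classic `&` ce @^-1` J.
have mE : measurable E by exact: measurable_lift.
have mS : measurable (`[0, s]%classic `&` ce @^-1` J) by exact: measurable_lift.
have fE : mu E \is a fin_num.
  by apply: lift_fin_num => //; rewrite lebesgue_measure_itv/=; case: ifP.
have fS : mu (`[0, s]%classic `&` ce @^-1` J) \is a fin_num.
  by apply: lift_fin_num => //; rewrite lebesgue_measure_itv/=; case: ifP.
have EU : `[0, t]%classic `&` ce @^-1` J = (`[0, s]%classic `&` ce @^-1` J) `|` E.
  rewrite /E -setIUl; congr (_ `&` _); apply/seteqP; split=> u /=; rewrite !in_itv/=.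
    by move=> /andP[u0 ut]; case: (leP u s) => us; [left; rewrite u0|right].
  move=> [/andP[u0 us]|/andP[su ut]]; first by rewrite u0 (le_trans us).
  by rewrite ut (le_trans s0 (ltW su)).
have D : (`[0, s]%classic `&` ce @^-1` J) `&` E = set0.
  apply/seteqP; split=> // u [[/=]]; rewrite !in_itv/= => /andP[_ us] _ [].
  by rewrite /= in_itv/= => /andP[su _]; move: us; rewrite leNgt su.
exists (fine (mu E)); split.
- exact: fine_ge0.
- rewrite -lee_fin fineK//.
  have -> : ((t - s)%:E = mu `]s, t]%classic)%E.
    rewrite lebesgue_measure_itv/= lte_fin; case: ltP => //= ts.
    have -> : t = s by apply/eqP; rewrite eq_le ts.
    by rewrite subrr.
  apply: le_measure; rewrite ?inE//; by move=> ? [].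
- by rewrite /arc_length EU measureU// fineD.
- have [[u [h1 h2 h3]]|H] := pselect (exists u, [/\ s < u, u < t & J (ce u)]).
    by right; exists u.
  left; suff -> : mu E = 0%E by [].
  apply: countable_lebesgue_measure0; apply: finite_set_countable.
  apply: (sub_finite_set _ (finite_set1 t)).
  move=> u [/=]; rewrite in_itv/= => /andP[su ut] Ju.
  case: (ltgtP u t) ut => // ut _; exfalso; apply: H; exists u; split=> //.
Qed.

Lemma arc_length0 J : closed J -> arc_length J 0 = 0.
Proof.
move=> cJ; rewrite /arc_length; set E := _ `&` _; suff -> : mu E = 0%E by [].
apply: countable_lebesgue_measure0; apply: finite_set_countable.
apply: (sub_finite_set _ (finite_set1 0)).
by move=> u [/=]; rewrite in_itv/= => /andP[u0 u1] _; apply/eqP; rewrite eq_le u0 u1.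
Qed.

Lemma mu_union0 (I : eqType) (r : seq I) (F : I -> set R) : uniq r ->
  (forall i, measurable (F i)) ->
  (forall i j, i != j -> finite_set (F i `&` F j)) ->
  (mu (\big[setU/set0]_(i <- r) F i) = \sum_(i <- r) mu (F i))%E.
Proof.
move=> ur mF fF; elim: r ur => [|i r IH] /=; first by rewrite !big_nil measure0.
move=> /andP[ir ur]; rewrite !big_cons -IH//; set U := \big[setU/set0]_(_ <- _) _.
have mU : measurable U by apply: bigsetU_measurable.
have f0 : mu (F i `&` U) = 0%E.
  apply: countable_lebesgue_measure0; apply: finite_set_countable.
  have : forall j, j \in r -> j != i by move=> j jr; apply: contraNneq ir => <-.
  rewrite /U; elim: r {IH ir ur U mU} => [|j r IH] H; first by rewrite big_nil setI0.
  rewrite big_cons setIUr finite_setU; split.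
    by apply: fF; rewrite eq_sym; apply: H; rewrite mem_head.
  by apply: IH => k kr; apply: H; rewrite inE kr orbT.
have -> : F i `|` U = (F i `\` U) `|` U.
  by rewrite setDE setUIl (setUC (~` U)) setUv setIT.
rewrite measureU//; last by rewrite setDE -setIA setICl setI0.
  have e : mu (F i) = (mu (F i `\` U) + mu (F i `&` U))%E by exact: (measureDI mu (mF i) mU).
  by rewrite e f0 adde0.
exact: (measurableD (mF i) mU).
Qed.

End ArcLength.

(** * The image of a cactus *)

Section Partition.
Context {R : realType} {n : nat}.
Local Notation C := (circle R).
Local Notation T := (torus R n).
Local Notation ce := (@circle_exp R).
Local Notation mu := (@lebesgue_measure R).
Variable x : 'I_n -> set C.
Hypothesis hx : cactus_partition x.
Implicit Types (i j k : 'I_n) (s t u : R).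

Let L j t := n%:R * arc_length (x j) t.
Let q j t : C := ce (L j t).
Let int j : set C := interior (x j).

Let xcl j : closed (x j). Proof. exact: (@cactus_closed _ _ _ hx j). Qed.

Let xman j : @manifold1 R _ (x j).
Proof. exact: (@cactus_manifold _ _ _ hx j). Qed.

Let xdisj j k : j != k -> interior (x j) `&` interior (x k) = set0.
Proof. exact: (@cactus_disjoint _ _ _ hx j k). Qed.

Let L0 j : L j 0 = 0.
Proof. by rewrite /L arc_length0 ?mulr0//; exact: xcl. Qed.

Let L_split j s t : 0 <= s -> s <= t ->
  exists r, [/\ 0 <= r, r <= n%:R * (t - s), L j t = L j s + r &
    (r = 0 \/ exists u, [/\ s < u, u < t & x j (ce u)])].
Proof.
move=> s0 st; have [r [r0 rt e H]] := arc_length_split (@xcl j) s0 st.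
exists (n%:R * r); split.
- by rewrite mulr_ge0.
- by rewrite ler_wpM2l.
- by rewrite /L e mulrDr.
- by case: H => [->|H]; [left; rewrite mulr0|right].
Qed.

Let L_mono j s t : 0 <= s -> s <= t -> L j s <= L j t.
Proof. by move=> s0 st; have [r [r0 _ -> _]] := L_split j s0 st; rewrite lerDl. Qed.

Let L_lip j s t : 0 <= s -> 0 <= t -> `|L j s - L j t| <= n%:R * `|s - t|.
Proof.
have H u v : 0 <= u -> u <= v -> `|L j u - L j v| <= n%:R * `|u - v|.
  move=> u0 uv; have [r [r0 rt -> _]] := L_split j u0 uv.
  by rewrite opprD addrA subrr sub0r normrN ger0_norm// distrC ger0_norm// subr_ge0.
by move=> s0 t0; case: (leP s t) => st; [exact: H|rewrite distrC (distrC s); exact: (H _ _ t0 (ltW st))].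
Qed.

Let L_unif (e : R) : 0 < e -> exists2 d, 0 < d &
  forall s t, `|s - t| <= d -> n%:R * `|s - t| <= e.
Proof.
move=> e0; exists (e / n.+1%:R); first by rewrite divr_gt0.
move=> s t st; apply: (@le_trans _ _ (n.+1%:R * (e / n.+1%:R))).
  by apply: ler_pM => //; rewrite ler_nat.
by rewrite mulrC divfK// pnatr_eq0.
Qed.

Let L_lt j s t : 0 <= s -> s <= t -> L j s < L j t ->
  exists u, [/\ s < u, u < t & x j (ce u)].
Proof.
move=> s0 st; have [r [r0 rt -> [->|//]]] := L_split j s0 st.
by rewrite addr0 ltxx.
Qed.

Let dense j t (d : R) : x j (ce t) -> 0 < d ->
  exists u, [/\ u != t, `|t - u| < d & int j (ce u)].
Proof. by move=> xt d0; exact: manifold1_dense (@xman j) xt d0. Qed.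

Let dense_in j a t b : x j (ce t) -> a < t -> t < b ->
  exists u, [/\ a < u, u < b & int j (ce u)].
Proof.
move=> xt ta tb.
have d0 : 0 < Num.min (t - a) (b - t) by rewrite lt_min !subr_gt0 ta.
have [u [_ tu iu]] := dense xt d0.
by exists u; split=> //; move: tu; rewrite lt_min !ltr_norml; lra.
Qed.

Let overlap i j : i != j ->
  finite_set ((`[0, 1]%classic `&` ce @^-1` (x i)) `&` (`[0, 1]%classic `&` ce @^-1` (x j))).
Proof.
move=> ij; set S := _ `&` _.
have clS : closed S.
  by apply: closedI; apply: closedI;
    [exact: itv_closed|exact: closed_lift (@xcl _)
    |exact: itv_closed|exact: closed_lift (@xcl _)].
have cS : compact S.
  by apply: (subclosed_compact clS (@segment_compact _ 0 1)) => u [[]].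
have /choice[e He] : forall t, exists e, S t ->
    0 < e /\ forall u, `|t - u| < e -> S u -> u = t.
  move=> t; have [[[_ xi] [_ xj]]|nS] := pselect (S t); last by exists 0.
  have [e e0 H] := manifold1_overlap (@xman i) (@xman j)
    (xdisj ij) xi xj.
  by exists e => _; split=> // u tu [[_ ui] [_ uj]]; exact: H.
have := compact_cover_compact cS.
move=> /(_ _ S (fun t => ball t (e t))) [].
- by move=> t /He[e0 _]; exact: ball_open.
- by move=> t St; exists t => //; apply: ballxx; have [] := He t St.
move=> D DS SD; apply: (sub_finite_set _ (finite_fset D)) => u Su.
have [t /= tD tu] := SD u Su.
have /He[_ H] : S t by have := DS t tD; rewrite inE.
by rewrite (H u tu Su).
Qed.

(** The pieces cover the circle and overlap in finite sets, so that their common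
    length is [1 / n]. *)
Let L1 j : L j 1 = 1.
Proof.
have m i : measurable (`[0, 1]%classic `&` ce @^-1` (x i)).
  exact: measurable_lift (@xcl i).
have := mu_union0 (index_enum_uniq 'I_n) m overlap.
have -> : \big[setU/set0]_(i <- index_enum 'I_n) (`[0, 1]%classic `&` ce @^-1` (x i)) = `[0, 1]%classic.
  rewrite -(@bigcup_seq _ _ (index_enum 'I_n)); apply/seteqP; split => [t [i _ []//]|t t01].
  have : setT (ce t) by [].
  rewrite -(cactus_cover hx) => -[i _ xt]; exists i => //=.
  by rewrite mem_index_enum.
rewrite lebesgue_measure_itv/= lte_fin ltr01 oppr0 adde0.
have f i : mu (`[0, 1]%classic `&` ce @^-1` (x i)) = (arc_length (x i) 1)%:E.
  rewrite /arc_length fineK//; apply: lift_fin_num; first exact: xcl.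
  by rewrite lebesgue_measure_itv/= lte_fin ltr01 oppr0 adde0.
rewrite (eq_bigr (fun i => (arc_length (x j) 1)%:E)); last first.
  by move=> i _; rewrite f (@cactus_length _ _ _ hx i j).
rewrite sumEFin => -[]; rewrite sumr_const card_ord /L mulr_natl => <-.
by [].
Qed.

Let q0 j : q j 1 = q j 0.
Proof. by rewrite /q L0 L1 -[1]/((1%:Z)%:~R) ce_int. Qed.

Let q_close j s t : 0 <= s -> 0 <= t -> cdist (q j s) (q j t) <= n%:R * `|s - t|.
Proof.
move=> s0 t0; apply: le_trans (L_lip j s0 t0).
rewrite cdistC (_ : q j s = cmul (q j t) (ce (L j s - L j t))); last first.
  by rewrite /q -ceD addrC subrK.
exact: cdistM.
Qed.

Let int_x j (s : C) : int j s -> x j s.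
Proof. exact: interior_subset. Qed.

(** If the [k]-th projection distinguished two points of the [j]-th piece, the
    [k]-th piece would have interior points in both arcs between them. *)
Let q_const_int j k s t : k != j -> 0 < s -> s < 1 -> 0 < t -> t < 1 ->
  int j (ce s) -> int j (ce t) -> q k s = q k t.
Proof.
move=> kj; wlog st : s t / s < t.
  move=> H s0 s1 t0 t1 hs ht; case: (ltgtP s t) => [h|h|->//].
    exact: H.
  by rewrite (H t s).
move=> s0 s1 t0 t1 hs ht.
have [e|ne] := eqVneq (L k s) (L k t); first by rewrite /q e.
have [e|ne1] := eqVneq (L k t) (L k s + 1).
  by rewrite /q e -[1]/((1%:Z)%:~R) ceDint.
exfalso.
have Lst : L k s < L k t by rewrite lt_neqAle ne (L_mono k (ltW s0) (ltW st)).
have [u [su ut xu]] := L_lt (ltW s0) (ltW st) Lst.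
have [v [sv vt iv]] := dense_in xu su ut.
have [r [r0 _ e1 H1]] := L_split k (lexx 0) (ltW s0).
have [r' [r'0 _ e2 H2]] := L_split k (ltW t0) (ltW t1).
rewrite L0 add0r in e1; rewrite L1 in e2.
have [w [vw wt iw]] : exists w, [/\ t < w, w < s + 1 & int k (ce w)].
  case: H1 => [r0'|[w [w0 ws xw]]].
    case: H2 => [r0''|[w [tw w1 xw]]].
      by exfalso; move/eqP: ne1; apply; lra.
    have [w' [tw' w1' iw']] := dense_in xw tw w1.
    by exists w'; split=> //; apply: lt_trans w1' _; rewrite ltrDr.
  have [w' [w0' ws' iw']] := dense_in xw w0 ws.
  exists (w' + 1); split; [lra|lra|].
  by rewrite -[1]/((1%:Z)%:~R) ceDint.
have jk : j != k by rewrite eq_sym.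
apply: (@cactus_noncrossing _ _ _ hx _ _ jk).
exists (ce s), (ce v), (ce t), (ce w); split => //.
by exists s, v, t, w; split.
Qed.

Let ex_point j : exists t, [/\ 0 < t, t < 1 & int j (ce t)].
Proof.
have [u [u0 u1 xu]] : exists u, [/\ 0 < u, u < 1 & x j (ce u)].
  by apply: L_lt => //; rewrite L0 L1.
exact: dense_in xu u0 u1.
Qed.

Let q_const j k s t : k != j -> 0 <= s <= 1 -> 0 <= t <= 1 ->
  x j (ce s) -> x j (ce t) -> q k s = q k t.
Proof.
move=> kj; have [t0 [t00 t01 it0]] := ex_point j.
suff H u : 0 <= u < 1 -> x j (ce u) -> q k u = q k t0.
  have H' u : 0 <= u <= 1 -> x j (ce u) -> q k u = q k t0.
    move=> /andP[u0]; rewrite le_eqVlt => /orP[/eqP ->|u1]; last by apply: H; rewrite u0.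
    have -> : ce 1 = ce 0 by rewrite -[1]/((1%:Z)%:~R) ce_int.
    by rewrite q0; apply: H; rewrite lexx ltr01.
  by move=> hs ht xs xt; rewrite (H' s)// (H' t).
move=> /andP[u0 u1] xu; apply: cdist_eq0.
apply/eqP; rewrite eq_le cdist_ge0 andbT; apply/ler_addgt0Pl => e e0; rewrite addr0.
(* approximate u by interior points inside ]0, 1[, up to an integer *)
pose m := if u == 0 then 1 else u.
have m0 : 0 < m by rewrite /m; case: eqVneq => // nu; rewrite lt_neqAle eq_sym nu.
have [d d0 hd] := L_unif e0.
have d0' : 0 < Num.min (Num.min m (1 - u)) d by rewrite !lt_min m0 subr_gt0 u1.
have [v [vu uv iv]] := dense xu d0'.
move: uv; rewrite !lt_min => /andP[/andP[vm v1] /ltW/hd ne].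
have [v0|v0] := leP 0 v.
  have v0' : 0 < v.
    move: vm vu; rewrite /m; case: eqVneq => [->|nu].
      by move=> _ nv; rewrite lt_neqAle eq_sym nv.
    by rewrite ltr_norml; lra.
  rewrite -(@q_const_int j k v t0)//; last by move: v1; rewrite ltr_norml; lra.
  by apply: le_trans (q_close k u0 v0) ne.
have u00 : u = 0.
  move: vm; rewrite /m; case: eqVneq => // nu; rewrite ltr_norml; lra.
have iv1 : int j (ce (v + 1)) by rewrite -[1]/((1%:Z)%:~R) ceDint.
have v10 : 0 < v + 1.
  by move: vm; rewrite /m u00 eqxx ltr_norml; lra.
rewrite -(@q_const_int j k (v + 1) t0)//; last by lra.
rewrite u00 -q0; apply: le_trans (q_close k ler01 (ltW v10)) _.
by move: ne; rewrite u00 sub0r opprD addrCA subrr addr0.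
Qed.

(** The last parameter at which the length swept is [v] belongs to the [j]-th
    piece, because the length increases right after it. *)
Let q_surj j v : 0 <= v < 1 -> exists t, [/\ 0 <= t <= 1, x j (ce t) & q j t = ce v].
Proof.
move=> /andP[v0 v1].
pose E := [set t | [/\ 0 <= t, t <= 1 & L j t <= v]].
have E0 : E 0 by split=> //; rewrite L0.
have hE : has_sup E by split; [exists 0|exists 1 => t []].
pose s := sup E.
have s0 : 0 <= s by apply: ub_le_sup => //; case: hE.
have s1 : s <= 1 by apply: ge_sup; [exists 0|move=> t []].
have Ls : L j s <= v.
  apply/ler_addgt0Pl => e e0.
  have [d d0 hd] := L_unif e0.
  have [t [t0 t1 Lt] st] := sup_adherent d0 hE; rewrite -/s in st.
  have ts : t <= s by apply: ub_le_sup => //; case: hE.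
  have std : `|s - t| <= d by rewrite ger0_norm; lra.
  have := le_trans (L_lip j s0 t0) (hd _ _ std).
  by rewrite ler_norml; lra.
have s1' : s < 1.
  rewrite lt_neqAle s1 andbT; apply/eqP => e; move: Ls; rewrite e L1; lra.
have gt t : s < t -> t <= 1 -> v < L j t.
  move=> st t1; rewrite ltNge; apply/negP => h.
  have : t <= s by apply: ub_le_sup; [case: hE|split=> //; exact: ltW (le_lt_trans s0 st)].
  by rewrite leNgt st.
have Lsv : L j s = v.
  apply/eqP; rewrite eq_le Ls/=; apply/ler_addgt0Pl => e e0.
  have [d d0 hd] := L_unif e0.
  pose r := Num.min (1 - s) d.
  have m0 : 0 < r by rewrite lt_min subr_gt0 s1'.
  have m1 : r <= 1 - s by rewrite ge_min lexx.
  have m2 : r <= d by rewrite ge_min lexx orbT.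
  have st : s < s + r by rewrite ltrDl.
  have t1 : s + r <= 1 by lra.
  have std : `|s + r - s| <= d by rewrite ger0_norm; lra.
  have := le_trans (L_lip j (le_trans s0 (ltW st)) s0) (hd _ _ std).
  by have := gt _ st t1; rewrite ler_norml; lra.
exists s; split; [by rewrite s0| |by rewrite /q Lsv].
have cl : closed (ce @^-1` x j) by exact: closed_lift (@xcl j).
apply: cl => B /nbhs_ballP[e /= e0 eB].
pose r := Num.min (1 - s) e.
have m0 : 0 < r by rewrite lt_min subr_gt0 s1' e0.
have m1 : r <= 1 - s by rewrite ge_min lexx.
have m2 : r <= e by rewrite ge_min lexx orbT.
have st : s < s + r by rewrite ltrDl.
have t1 : s + r <= 1 by lra.
have Lst : L j s < L j (s + r) by rewrite Lsv; exact: gt.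
have [u [su ut xu]] := L_lt s0 (ltW st) Lst.
by exists u; split=> //; apply: eB; rewrite /ball/= ltr_norml; lra.
Qed.

(** Off two given pieces both projections are locally constant, so they can be
    computed at the next point that belongs to one of the two pieces. *)
Let wedge i j ti tj t : i != j -> 0 <= ti <= 1 -> x i (ce ti) ->
  0 <= tj <= 1 -> x j (ce tj) -> 0 <= t <= 1 ->
  q i t = q i tj \/ q j t = q j ti.
Proof.
move=> ij hti xi htj xj.
have ji : j != i by rewrite eq_sym.
pose E s := [set u | [/\ s <= u, u <= 1 & x i (ce u) \/ x j (ce u)]].
have main s : 0 <= s -> E s !=set0 -> q i s = q i tj \/ q j s = q j ti.
  move=> s0 Es.
  have hE : has_inf (E s) by split=> //; exists s => u [].
  have s1 : s <= 1 by case: Es => u [su u1 _]; exact: le_trans su u1.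
  have si : s <= inf (E s) by apply: lb_le_inf => // u [].
  have cE : closed (E s).
    have -> : E s = `[s, 1]%classic `&` (ce @^-1` x i `|` ce @^-1` x j).
      apply/seteqP; split=> u /=; rewrite in_itv/=.
        by move=> [-> -> h]; split.
      by move=> [/andP[h1 h2] h]; split.
    apply: closedI; first exact: itv_closed.
    by apply: closedU; exact: closed_lift (@xcl _).
  have Ei : E s (inf (E s)).
    apply: cE => B /nbhs_ballP[e /= e0 eB].
    have [u Eu ue] := inf_adherent e0 hE.
    exists u; split=> //; apply: eB; rewrite /ball/= ltr_norml.
    have iu : inf (E s) <= u by apply: ge_inf => //; case: hE.
    by apply/andP; split; lra.
  set w := inf (E s) in si Ei *.
  have w01 : 0 <= w <= 1 by case: Ei => _ -> _; rewrite (le_trans s0 si).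
  have Lw k : k = i \/ k = j -> L k s = L k w.
    move=> hk; apply/eqP; rewrite eq_le L_mono//= leNgt; apply/negP => h.
    have [u [su uw xu]] := L_lt s0 si h.
    have : w <= u.
      apply: ge_inf; first by case: hE.
      split; [exact: ltW| |by case: hk => <-; [left|right]].
      by rewrite (le_trans (ltW uw))//; case/andP: w01.
    by rewrite leNgt uw.
  rewrite /q Lw; last by left.
  rewrite (Lw j); last by right.
  case: Ei => _ _ [xw|xw].
    by right; exact: q_const xw xi.
  by left; exact: q_const xw xj.
move=> /andP[t0 t1].
have [Et|Et] := pselect (E t !=set0); first exact: main.
have Lt1 k : k = i \/ k = j -> L k t = L k 1.
  move=> hk; apply/eqP; rewrite eq_le L_mono//= leNgt; apply/negP => h.
  have [u [su uw xu]] := L_lt t0 t1 h.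
  by apply: Et; exists u; split; [exact: ltW|exact: ltW|case: hk => <-; [left|right]].
have E0 : E 0 !=set0 by exists ti; case/andP: hti => ? ?; split=> //; left.
have := main 0 (lexx 0) E0.
by rewrite -(q0 i) -(q0 j) /q -Lt1; [rewrite -Lt1; [|right]|left].
Qed.

Let t_ j : R := xget 0 [set t | [/\ 0 <= t, t <= 1 & x j (ce t)]].

Let t_P j : 0 <= t_ j <= 1 /\ x j (ce (t_ j)).
Proof.
rewrite /t_; case: xgetP => [t _ [t0 t1 xt]|H]; first by rewrite t0 t1.
have [u [u0 u1 iu]] := ex_point j.
by exfalso; apply: (H u); split; [exact: ltW|exact: ltW|exact: int_x].
Qed.

Variable z : T.

(** The [j]-th piece is mapped onto a circle in direction [j]; its other
    coordinates are the constant values of the other projections. *)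
Definition lobe_matrix j : T := fun k => cmul (z k) (q k (t_ j)).

Let projE t : 0 <= t < 1 -> cactus_proj x z (ce t) = fun k => cmul (z k) (q k t).
Proof.
by move=> t01; apply/funext => k; rewrite /cactus_proj translationE /collapse angle_exp.
Qed.

Let projE1 t : 0 <= t <= 1 -> cactus_proj x z (ce t) = fun k => cmul (z k) (q k t).
Proof.
move=> /andP[t0]; rewrite le_eqVlt => /orP[/eqP ->|t1]; last by rewrite projE// t0.
have -> : ce 1 = ce 0 by rewrite -[1]/((1%:Z)%:~R) ce_int.
by rewrite projE ?lexx ?ltr01//; apply/funext => k; rewrite q0.
Qed.

Lemma lobe_matrix_treelike : treelike lobe_matrix.
Proof.
move=> i j k ij ki kj; have [ti xi] := t_P i; have [tj xj] := t_P j.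
have [tk _] := t_P k.
by rewrite /lobe_matrix; have [->|->] := wedge ij ti xi tj xj tk; [left|right].
Qed.

Lemma lobe_image j : cactus_proj x z @` (x j) =
  [set w : T | forall k, k != j -> w k = lobe_matrix j k].
Proof.
have [tj xj] := t_P j.
apply/seteqP; split=> [w [s xs <-] k kj|w /= hw].
  have [a01 e] := angleP s.
  have a01' : 0 <= angle s <= 1 by case/andP: a01 => -> /ltW.
  rewrite -e projE// /lobe_matrix (@q_const j k (angle s) (t_ j))//.
  by rewrite e.
have [a01 e] := angleP (cmul (cinv (z j)) (w j)).
have [t [t01 xt qt]] := q_surj j a01.
exists (ce t) => //; rewrite projE1//; apply/funext => k.
have [->|kj] := eqVneq k j; first by rewrite qt e cmulKV.
by rewrite hw// /lobe_matrix (@q_const j k t (t_ j)).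
Qed.

Lemma proj_range : (0 < n)%N -> range (cactus_proj x z) = tree lobe_matrix.
Proof.
move=> n0; apply/seteqP; split=> [w [s _ <-] i j ij|w tw].
  have [a01 e] := angleP s.
  have a01' : 0 <= angle s <= 1 by case/andP: a01 => -> /ltW.
  have [ti xi] := t_P i; have [tj xj] := t_P j.
  rewrite -e projE// /lobe_matrix.
  by have [->|->] := wedge ij ti xi tj xj a01'; [left|right].
have [l lw] := tree_on_circle (Ordinal n0) lobe_matrix_treelike tw.
have : [set w : T | forall k, k != l -> w k = lobe_matrix l k] w by [].
by rewrite -lobe_image => -[s _ <-]; exists s.
Qed.

End Partition.

(** * The space of cacti *)

Section CircleTopology.
Context {R : realType}.
Local Notation C := (circle R).

Lemma compact_circle : compact [set: C].
Proof.
have -> : [set: C] = (@circle_exp R) @` `[0, 1]%classic.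
  apply/seteqP; split=> // s _; have [/andP[a0 a1] e] := angleP s.
  by exists (angle s) => //=; rewrite in_itv/= a0 ltW.
apply: continuous_compact; last exact: segment_compact.
by apply: continuous_subspaceT; exact: ctsce cts_id.
Qed.

Lemma regular_circle : regular_space C.
Proof. exact: uniform_regular. Qed.

Lemma nbhs_cdist (s : C) (U : set C) : nbhs s U ->
  exists2 e : R, 0 < e & forall t, cdist s t < e -> U t.
Proof.
move=> nU; have c : continuous (fun r : R => cmul s (circle_exp r)) by ctsC.
have : \forall r \near 0, U (cmul s (circle_exp r)).
  by apply: (c 0); rewrite -/(@cone R) cmul1.
move=> /nbhsR[e e0 eU]; exists e => // t st.
have [r [r1 r2 _]] := len_lift (cmul (cinv s) t).
rewrite -(cmulKV s t) -r1; apply: eU.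
by rewrite sub0r normrN r2.
Qed.

Lemma cts_cdist (X : topologicalType) (f : X -> C) :
  (forall x (e : R), 0 < e -> \forall y \near x, cdist (f x) (f y) < e) ->
  continuous f.
Proof.
move=> H x U /nbhs_cdist[e e0 eU].
by apply: filterS (H x e e0) => y; exact: eU.
Qed.

Lemma circle_avoid n (v : 'I_n -> C) : exists s, forall i, s <> v i.
Proof.
pose g (k : 'I_n.+1) : C := circle_exp ((k : nat)%:R / n.+1%:R).
have gI : injective g.
  move=> k l e; apply: val_inj; apply/eqP; rewrite -(eqr_nat R); apply/eqP.
  have b (m : 'I_n.+1) : 0 <= ((m : nat)%:R / n.+1%:R : R) < 1.
    by rewrite divr_ge0//= ltr_pdivrMr// mul1r ltr_nat.
  have := congr1 (@angle R) e; rewrite !angle_exp//.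
  by move/(mulIf _); apply; rewrite invr_neq0// pnatr_eq0.
apply: contrapT => H.
have /choice[h Hh] : forall k : 'I_n.+1, exists i, g k = v i.
  move=> k; apply: contrapT => nk; apply: H; exists (g k) => i e.
  by apply: nk; exists i.
have : injective h by move=> k l e; apply: gI; rewrite !Hh e.
by move/(@leq_card 'I_n.+1 'I_n); rewrite !card_ord ltnn.
Qed.

End CircleTopology.

Section CactiSpace.
Context {R : realType} {n : nat}.
Local Notation C := (circle R).
Local Notation T := (torus R n).
Implicit Types (c : cacti R n) (i j k : 'I_n).

Definition lobes c i : T := xget (fun=> circle_exp 0) (cacti_lobe c i).

Lemma cacti_bndE c i s : cacti_bnd c i s = fun k => if k == i then s else lobes c i k.
Proof. by []. Qed.

Lemma mon_circle_surj (f : R -> R) (s : C) : Mon R f -> exists t, mon_circle f t = s.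
Proof.
move=> [cf _ f0 f1]; have [/andP[a0 a1] e] := angleP s.
have [|r + fr] := @IVT _ f 0 1 (angle s) ler01 cf.
  by rewrite f0 f1 min_l// max_r// a0 ltW.
rewrite in_itv/= => /andP[r0]; rewrite le_eqVlt => /orP[/eqP r1|r1].
  by move: a1; rewrite -fr r1 f1 ltxx.
by exists (circle_exp r); rewrite /mon_circle angle_exp ?r0// fr.
Qed.

Lemma cactus_map_range x (f : R -> R) (z : T) : Mon R f ->
  range (cactus_map x f z) = range (cactus_proj x z).
Proof.
move=> mf; apply/seteqP; split=> w [s _ <-]; first by exists (mon_circle f s).
by have [t <-] := mon_circle_surj s mf; exists t.
Qed.

(** The [i]-th lobe is the only circle in direction [i] contained in the
    realization, so it does not depend on the presentation of the cactus. *)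
Lemma lobes_spec c : exists M : 'I_n -> T,
  [/\ treelike M, cacti_real c = tree M & forall i k, k != i -> lobes c i k = M i k].
Proof.
have [_ [x [f [z [hx mf cE']]]]] := set_valP c.
have cE : cacti_fun c = cactus_map x f z := cE'.
have [n0|n0] := posnP n.
  have no (i : 'I_n) : False by move: (ltn_ord i); rewrite {2}n0.
  exists (fun _ _ => cone); split=> [i|| i]; [by case: (no i)| |by case: (no i)].
  apply/seteqP; split=> [w _ i|w _]; first by case: (no i).
  by exists cone => //; apply/funext => i; case: (no i).
have hx' : cactus_partition x by case: hx => // e; exfalso; move/eqP: e; rewrite eqn0Ngt n0.
exists (lobe_matrix x z); split; first exact: lobe_matrix_treelike.
  by rewrite /cacti_real cE cactus_map_range// proj_range.
move=> i k ki; rewrite /lobes; case: xgetP => [p _ [x' [f' [z' [hx2 mf2 cE2 im]]]]|H].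
  have [s Hs] := circle_avoid (fun j => lobe_matrix x z j i).
  pose w : T := fun k => if k == i then s else p k.
  have rw : range (cactus_proj x' z') w.
    have : [set w : T | forall k, k != i -> w k = p k] w.
      by move=> l li; rewrite /w (negbTE li).
    by rewrite -im => -[t _ <-]; exists t.
  have : tree (lobe_matrix x z) w.
    rewrite -(proj_range hx' z n0) -(cactus_map_range x z mf) -cE.
    by move: rw; rewrite -(cactus_map_range x' z' mf2) -cE2.
  have ik : i != k by rewrite eq_sym.
  move=> /(_ i k ik); rewrite /w eqxx (negbTE ki) => -[e|//].
  by case: (Hs k).
exfalso; apply: (H (lobe_matrix x z i)).
by exists x, f, z; split => //; exact: lobe_image.
Qed.

Lemma lobes_treelike c : treelike (lobes c).
Proof.
have [M [tM _ LM]] := lobes_spec c => i j k ij ki kj.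
have ji : j != i by rewrite eq_sym.
by rewrite !LM// 1?eq_sym//; apply: tM.
Qed.

Lemma cacti_realE c : cacti_real c = tree (lobes c).
Proof.
have [M [_ -> LM]] := lobes_spec c.
apply/seteqP; split=> w tw i j ij; have := tw i j ij;
  have ji : j != i by rewrite eq_sym.
  by rewrite !LM.
by rewrite !LM.
Qed.

Lemma cacti_fun_tree c s : tree (lobes c) (cacti_fun c s).
Proof. by rewrite -cacti_realE; exists s. Qed.

Lemma cacti_bnd_tree c i s : tree (lobes c) (cacti_bnd c i s).
Proof.
apply: (@on_circle_tree _ _ _ i); first exact: lobes_treelike.
by move=> k ki; rewrite cacti_bndE (negbTE ki).
Qed.

Lemma cacti_cts c : continuous (cacti_fun c : C -> T).
Proof. by have [] := set_valP c. Qed.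

Lemma cts_cacti_fun (X : topologicalType) (c : X -> cacti R n) (s : X -> C) :
  continuous c -> continuous s -> continuous (fun x => cacti_fun (c x) (s x)).
Proof.
move=> cc cs.
have ev : continuous (uncurry (fun c : cacti R n => (cacti_fun c : C -> T))).
  apply: continuous_uncurry_regular.
  - move=> s0 _; exists setT; first exact: filterT.
    by split; [exact: compact_circle|exact: closedT].
  - exact: regular_circle.
  - exact: initial_continuous.
  - exact: cacti_cts.
exact: (cts_comp ev (cts_pair cc cs)).
Qed.

Lemma cts_torus (X : topologicalType) (w : X -> T) (k : 'I_n) :
  continuous w -> continuous (fun x => w x k).
Proof. exact: (@cts_app _ _ (fun _ => (C : topologicalType))). Qed.

(** Evaluation is continuous and the circle is compact. *)
Lemma cacti_near c (e : R) : 0 < e ->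
  \forall c' \near c, forall s, tclose e (cacti_fun c' s) (cacti_fun c s).
Proof.
move=> e0; apply: tube; first exact: compact_circle.
move=> s.
have c1 : continuous (fun p : cacti R n * C => cacti_fun p.1 p.2).
  by apply: cts_cacti_fun; cts.
have c2 : continuous (fun p : cacti R n * C => cacti_fun c p.2).
  by apply: cts_cacti_fun; cts.
have H k : nbhs (c, s) [set p : cacti R n * C | cdist (cacti_fun p.1 p.2 k) (cacti_fun c p.2 k) < e].
  apply: (cts_near_lt (f := fun p : cacti R n * C => cdist (cacti_fun p.1 p.2 k) (cacti_fun c p.2 k))).
    by apply: ctscdist; [exact: (@cts_torus _ _ k c1)|exact: (@cts_torus _ _ k c2)].
  by rewrite cdistxx.
have H' := @filter_forall _ _ _ _ (nbhs_filter ((c, s) : cacti R n * C)) H.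
by apply: (filterS _ H') => p hp k; exact: ltW (hp k).
Qed.

(** Choose [s] away from the [i]-th coordinates of all other lobes of [c]. The
    point of the [i]-th lobe of a nearby cactus with [i]-th coordinate [s] is
    close to a point of [c], which can only lie on the [i]-th lobe of [c]. *)
Lemma cts_lobes i k : k != i -> continuous (fun c => lobes c i k).
Proof.
move=> ki; apply: cts_cdist => c e e0.
have [s Hs] := circle_avoid (fun j => lobes c j i).
pose e' := Num.min e (cdist s (lobes c k i)) / 2.
have d0 : 0 < cdist s (lobes c k i).
  rewrite lt_neqAle cdist_ge0 andbT eq_sym; apply/eqP => /cdist_eq0.
  exact: Hs.
have m0 : 0 < Num.min e (cdist s (lobes c k i)) by rewrite lt_min e0.
have e'0 : 0 < e' by rewrite divr_gt0.
have m1 : Num.min e (cdist s (lobes c k i)) <= e by rewrite ge_min lexx.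
have m2 : Num.min e (cdist s (lobes c k i)) <= cdist s (lobes c k i) by rewrite ge_min lexx orbT.
have := cacti_near c e'0; apply: filterS => c' Hc'.
have : cacti_real c' (cacti_bnd c' i s) by rewrite cacti_realE; exact: cacti_bnd_tree.
move=> [t _ et].
have ht : tclose e' (cacti_bnd c' i s) (cacti_fun c t) by rewrite -et; exact: Hc'.
have ik : i != k by rewrite eq_sym.
have := cacti_fun_tree c t ik => -[h|h].
  have := ht i; rewrite cacti_bndE eqxx h => h2.
  by move: m0 m2 h2; rewrite /e'; lra.
rewrite cdistC; have := ht k; rewrite cacti_bndE (negbTE ki) h => h2.
by apply: le_lt_trans h2 _; rewrite /e'; lra.
Qed.

Lemma cts_cacti_bnd (X : topologicalType) (c : X -> cacti R n) (s : X -> C) i :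
  continuous c -> continuous s -> continuous (fun x => cacti_bnd (c x) i (s x)).
Proof.
move=> cc cs; apply: cts_mkprod => k; rewrite /cacti_bnd.
case: (eqVneq k i) => [_|ki]; first exact: cs.
exact: cts_comp (cts_lobes ki) cc.
Qed.

End CactiSpace.

(** * Plane geometry of framed little discs *)

Section Plane.
Context {R : realType}.
Local Notation E := (R * R)%type.
Implicit Types (x y z w : E) (t : R).

Definition vadd x y : E := (x.1 + y.1, x.2 + y.2).
Definition vsub x y : E := (x.1 - y.1, x.2 - y.2).
Definition vscale t x : E := (t * x.1, t * x.2).
Definition pmul x y : E := (x.1 * y.1 - x.2 * y.2, x.1 * y.2 + x.2 * y.1).
Definition pinv x : E :=
  (x.1 / (x.1 ^+ 2 + x.2 ^+ 2), - x.2 / (x.1 ^+ 2 + x.2 ^+ 2)).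
Definition n2 x : R := Num.sqrt (x.1 ^+ 2 + x.2 ^+ 2).

Lemma sqn_ge0 x : 0 <= x.1 ^+ 2 + x.2 ^+ 2.
Proof. by rewrite addr_ge0// sqr_ge0. Qed.

Lemma n2_ge0 x : 0 <= n2 x. Proof. exact: sqrtr_ge0. Qed.

Lemma n2_sqr x : n2 x ^+ 2 = x.1 ^+ 2 + x.2 ^+ 2.
Proof. by rewrite sqr_sqrtr// sqn_ge0. Qed.

Lemma n2_le x t : 0 <= t -> (n2 x <= t) = (x.1 ^+ 2 + x.2 ^+ 2 <= t ^+ 2).
Proof. by move=> t0; rewrite -n2_sqr ler_sqr// nnegrE n2_ge0. Qed.

Lemma n2_lt x t : 0 <= t -> (n2 x < t) = (x.1 ^+ 2 + x.2 ^+ 2 < t ^+ 2).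
Proof. by move=> t0; rewrite -n2_sqr ltr_sqr// nnegrE n2_ge0. Qed.

Lemma n2_triangle x y : n2 (vadd x y) <= n2 x + n2 y.
Proof.
rewrite n2_le ?addr_ge0 ?n2_ge0//= [leRHS]sqrrD !n2_sqr.
have h : x.1 * y.1 + x.2 * y.2 <= n2 x * n2 y.
  apply: (@le_trans _ _ `|x.1 * y.1 + x.2 * y.2|); first exact: ler_norm.
  rewrite -(ler_sqr (normr_ge0 _)) ?nnegrE ?mulr_ge0 ?n2_ge0//.
  rewrite exprMn !n2_sqr real_normK ?num_real//.
  have := sqr_ge0 (x.1 * y.2 - x.2 * y.1); nra.
nra.
Qed.

Lemma n2M x y : n2 (pmul x y) = n2 x * n2 y.
Proof. by rewrite /n2 -sqrtrM ?sqn_ge0//; congr Num.sqrt; rewrite /=; ring. Qed.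

Lemma n2Z t x : n2 (vscale t x) = `|t| * n2 x.
Proof.
rewrite /n2 -sqrtr_sqr -sqrtrM ?sqr_ge0//; congr Num.sqrt; rewrite /=; ring.
Qed.

Lemma n2C x y : n2 (vsub x y) = n2 (vsub y x).
Proof. by rewrite /n2 /=; congr Num.sqrt; ring. Qed.

Lemma n2_tri y x z : n2 (vsub x z) <= n2 (vsub x y) + n2 (vsub y z).
Proof.
apply: le_trans (n2_triangle _ _).
by rewrite (_ : vadd _ _ = vsub x z)//; congr (_, _); rewrite /=; ring.
Qed.

Lemma n2_sub_ge x y : n2 x - n2 y <= n2 (vsub x y).
Proof.
have := n2_triangle (vsub x y) y.
by rewrite (_ : vadd _ _ = x); [lra|case: x => a b; congr (_, _); rewrite /=; ring].
Qed.

Lemma vsubxx x : vsub x x = (0, 0). Proof. by rewrite /vsub !subrr. Qed.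

Lemma n20 : n2 (0, 0) = 0. Proof. by rewrite /n2 /= expr0n/= addr0 sqrtr0. Qed.

(** Continuous everywhere, and the radial projection on vectors of norm at
    least 1/2. *)
Definition nrmlz x : E := vscale (Num.max (n2 x) 2^-1)^-1 x.

Let mx0 x : 0 < Num.max (n2 x) 2^-1.
Proof. by rewrite lt_max invr_gt0 ltr0n orbT. Qed.

Lemma n2_nrmlz x : n2 (nrmlz x) <= 1.
Proof.
rewrite n2Z gtr0_norm ?invr_gt0// mulrC ler_pdivrMr// mul1r.
by rewrite le_max lexx.
Qed.

Lemma nrmlzE x : 2^-1 <= n2 x -> nrmlz x = vscale (n2 x)^-1 x.
Proof. by move=> h; rewrite /nrmlz max_l. Qed.

Lemma nrmlz_id x : n2 x = 1 -> nrmlz x = x.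
Proof.
move=> h; rewrite nrmlzE h ?invf_le1 ?ler1n ?ltr0n// invr1.
by case: x {h} => a b; rewrite /vscale /= !mul1r.
Qed.

Lemma n2_nrmlz_sub x : 2^-1 <= n2 x -> n2 (vsub (nrmlz x) x) = `|1 - n2 x|.
Proof.
move=> h; have h0 : n2 x != 0 by rewrite gt_eqF// (lt_le_trans _ h)// invr_gt0 ltr0n.
rewrite nrmlzE// (_ : vsub _ _ = vscale ((n2 x)^-1 - 1) x); last first.
  by rewrite /vsub /vscale /=; congr (_, _); ring.
rewrite n2Z -[X in _ * X](@ger0_norm _ (n2 x)) ?n2_ge0// -normrM.
by rewrite mulrBl mulVf// mul1r.
Qed.

(** The identity outside of the unit disc, and on it the radial projection to the
    boundary, truncated near the centre. *)
Definition push x : E := vscale (Num.max 1 (Num.max (n2 x) 2^-1)^-1) x.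

Lemma push_out x : 1 <= n2 x -> push x = x.
Proof.
move=> h; rewrite /push max_l; first by case: x {h} => a b; rewrite /vscale /= !mul1r.
by rewrite invf_le1// le_max h.
Qed.

Lemma push_in x : 2^-1 <= n2 x -> n2 x <= 1 -> push x = nrmlz x.
Proof.
move=> h1 h2; rewrite /push max_r// invf_ge1// ge_max h2/=.
by rewrite invf_le1 ?ler1n.
Qed.

Section PlaneContinuity.
Context {X : topologicalType}.
Implicit Types f g : X -> E.

Lemma ctsvadd f g : continuous f -> continuous g -> continuous (fun p => vadd (f p) (g p)).
Proof.
move=> cf cg.
change (continuous (fun p => ((f p).1 + (g p).1, (f p).2 + (g p).2))); cts.
Qed.

Lemma ctsvsub f g : continuous f -> continuous g -> continuous (fun p => vsub (f p) (g p)).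
Proof.
move=> cf cg.
change (continuous (fun p => ((f p).1 - (g p).1, (f p).2 - (g p).2))); cts.
Qed.

Lemma ctsvscale (r : X -> R) f : continuous r -> continuous f ->
  continuous (fun p => vscale (r p) (f p)).
Proof.
move=> cr cf.
change (continuous (fun p => (r p * (f p).1, r p * (f p).2))); cts.
Qed.

Lemma ctspmul f g : continuous f -> continuous g -> continuous (fun p => pmul (f p) (g p)).
Proof.
move=> cf cg.
change (continuous (fun p => ((f p).1 * (g p).1 - (f p).2 * (g p).2,
  (f p).1 * (g p).2 + (f p).2 * (g p).1))); cts.
Qed.

Lemma ctsn2 f : continuous f -> continuous (fun p => n2 (f p)).
Proof. by move=> cf; rewrite /n2; cts. Qed.

Lemma ctspinv f : (forall p, n2 (f p) != 0) -> continuous f ->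
  continuous (fun p => pinv (f p)).
Proof.
move=> f0 cf.
change (continuous (fun p => ((f p).1 / ((f p).1 ^+ 2 + (f p).2 ^+ 2),
  - (f p).2 / ((f p).1 ^+ 2 + (f p).2 ^+ 2)))).
have c : continuous (fun p => ((f p).1 ^+ 2 + (f p).2 ^+ 2)^-1).
  by apply: ctsV; [move=> p; rewrite -n2_sqr sqrf_eq0|cts].
by cts.
Qed.

Lemma ctsnrmlz f : continuous f -> continuous (fun p => nrmlz (f p)).
Proof.
move=> cf; apply: ctsvscale => //; apply: ctsV.
  by move=> p; rewrite gt_eqF.
by apply: ctsmax; [exact: ctsn2|cts].
Qed.

Lemma ctspush f : continuous f -> continuous (fun p => push (f p)).
Proof.
move=> cf; apply: ctsvscale => //; apply: ctsmax; first by cts.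
apply: ctsV; first by move=> p; rewrite gt_eqF.
by apply: ctsmax; [exact: ctsn2|cts].
Qed.

Lemma ctsvsum {I : finType} (f : I -> X -> E) : (forall i, continuous (f i)) ->
  continuous (fun p => (\sum_i (f i p).1, \sum_i (f i p).2) : E).
Proof.
move=> cf; apply: cts_pair; apply: ctssum => i; have := cf i => c; cts.
Qed.

End PlaneContinuity.

Local Notation D := (disc R).
Local Notation C := (circle R).

Lemma discP (z : D) : n2 (set_val z) <= 1.
Proof. by rewrite n2_le// expr1n; exact: (set_valP z). Qed.

Lemma open_discP (z : D) : open_disc R z <-> n2 (set_val z) < 1.
Proof. by rewrite n2_lt// expr1n. Qed.

Lemma vsum1 {I : finType} (d : I -> E) i : (forall j, j != i -> d j = (0, 0)) ->
  (\sum_j (d j).1, \sum_j (d j).2) = d i.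
Proof.
move=> d0; rewrite [RHS]surjective_pairing (bigD1 i)// big1 => [|j ji]; last by rewrite d0.
congr (_, _); first exact: addr0.
by rewrite (bigD1 i)// big1 => [|j ji]; [exact: addr0|rewrite d0].
Qed.

Lemma circle_n2 (s : C) : n2 (set_val s) = 1.
Proof. by rewrite /n2 circleP sqrtr1. Qed.

Lemma toD_subproof z : vscale (Num.max 1 (n2 z))^-1 z \in D.
Proof.
have m0 : 0 < Num.max 1 (n2 z) by rewrite lt_max ltr01.
have : n2 (vscale (Num.max 1 (n2 z))^-1 z) <= 1.
  by rewrite n2Z gtr0_norm ?invr_gt0// mulrC ler_pdivrMr// mul1r le_max lexx orbT.
by rewrite n2_le// expr1n inE.
Qed.

Definition toD z : D := exist _ (vscale (Num.max 1 (n2 z))^-1 z) (toD_subproof z).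

Lemma toD_val z : n2 z <= 1 -> set_val (toD z) = z.
Proof.
move=> h; change (vscale (Num.max 1 (n2 z))^-1 z = z); rewrite max_l// invr1.
by case: z {h} => a b; rewrite /vscale /= !mul1r.
Qed.

Lemma toDK (z : D) : toD (set_val z) = z.
Proof. by apply: val_inj; rewrite -[LHS]/(set_val (toD (set_val z))) toD_val ?discP. Qed.

Lemma ctstoD (X : topologicalType) (f : X -> E) : continuous f ->
  continuous (fun p => toD (f p)).
Proof.
move=> cf; apply: cts_sub.
change (continuous (fun p => vscale (Num.max 1 (n2 (f p)))^-1 (f p))).
apply: ctsvscale => //; apply: ctsV.
  by move=> p; rewrite gt_eqF// lt_max ltr01.
by apply: ctsmax; [cts|exact: ctsn2].
Qed.

Lemma compact_disc : compact [set: D].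
Proof.
have -> : [set: D] = toD @` (`[-1, 1]%classic `*` `[-1, 1]%classic).
  apply/seteqP; split=> // z _; exists (set_val z); last exact: toDK.
  have h : (set_val z).1 ^+ 2 + (set_val z).2 ^+ 2 <= 1 := set_valP z.
  by split; rewrite /= in_itv/=; nra.
apply: continuous_compact.
  by apply: continuous_subspaceT; exact: ctstoD cts_id.
by apply: compact_setX; exact: segment_compact.
Qed.

Lemma regular_disc : regular_space D.
Proof. exact: uniform_regular. Qed.

Lemma cunit_subproof x : (if n2 x == 0 then (1, 0) else vscale (n2 x)^-1 x) \in C.
Proof.
rewrite inE /circle/=; case: eqP => [_|/eqP h] /=; first by rewrite expr1n expr0n addr0.
have := n2Z (n2 x)^-1 x; rewrite normfV ger0_norm ?n2_ge0// mulVf//.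
by move=> /(congr1 (fun r => r ^+ 2)); rewrite n2_sqr expr1n.
Qed.

(** The value at the zero vector is a dummy. *)
Definition cunit x : C :=
  exist _ (if n2 x == 0 then (1, 0) else vscale (n2 x)^-1 x) (cunit_subproof x).

Lemma cunit_val x : 2^-1 <= n2 x -> set_val (cunit x) = nrmlz x.
Proof.
move=> h; rewrite nrmlzE//.
change ((if n2 x == 0 then (1, 0) else vscale (n2 x)^-1 x) = vscale (n2 x)^-1 x).
by rewrite gt_eqF//; apply: lt_le_trans h; rewrite invr_gt0 ltr0n.
Qed.

Lemma cunitK (s : C) : cunit (set_val s) = s.
Proof.
apply: val_inj; rewrite -[LHS]/(set_val (cunit (set_val s))) cunit_val ?nrmlz_id ?circle_n2//.
by rewrite invf_le1 ?ler1n.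
Qed.

Lemma ctscunit (X : topologicalType) (f : X -> E) : (forall p, 2^-1 <= n2 (f p)) ->
  continuous f -> continuous (fun p => cunit (f p)).
Proof.
move=> f0 cf; apply: cts_sub.
rewrite (_ : (fun p => _) = (fun p => nrmlz (f p))); first exact: ctsnrmlz.
by apply/funext => p; rewrite cunit_val.
Qed.

End Plane.

Section DiscCoordinates.
Context {R : realType} {n : nat}.
Local Notation E := (R * R)%type.
Local Notation D := (disc R).
Local Notation C := (circle R).
Implicit Types (a : fDo R n) (i j : 'I_n) (x y z : E).

Definition ctr a i : E := set_val (little_disc (set_val a) i (toD (0, 0))).
Definition axis a i : E :=
  vsub (set_val (little_disc (set_val a) i (toD (1, 0)))) (ctr a i).

(** The similarity of the plane extending the [i]-th little disc. *)
Definition aff a i x : E := vadd (ctr a i) (pmul (axis a i) x).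

(** Its inverse: the coordinates relative to the [i]-th little disc. *)
Definition rel a i z : E := pmul (pinv (axis a i)) (vsub z (ctr a i)).

Let n2_10 : n2 ((1, 0) : E) = 1.
Proof. by rewrite /n2 /= expr1n expr0n/= addr0 sqrtr1. Qed.

Lemma disc_affine a i : 0 < n2 (axis a i) /\
  forall x : D, set_val (little_disc (set_val a) i x) = aff a i (set_val x).
Proof.
have [[_ /(_ i) [r [th [p [r0 H]]]]] _] : fDo R n (set_val a) := set_valP a.
have e0 : set_val (toD ((0, 0) : E)) = (0, 0) by rewrite toD_val// n20.
have e1 : set_val (toD ((1, 0) : E)) = (1, 0) by rewrite toD_val// n2_10.
have cE : ctr a i = p.
  rewrite /ctr H e0/= !mulr0 subr0 addr0 !mulr0 !addr0.
  by case: p {H}.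
have aE : axis a i = (r * cos th, r * sin th).
  by rewrite /axis cE H e1 /vsub /=; congr (_, _); ring.
split.
  rewrite aE /n2/= !exprMn -mulrDr cos2Dsin2 mulr1 sqrtr_sqr gtr0_norm//.
by move=> x; rewrite H /aff cE aE /vadd /pmul /=; congr (_, _); ring.
Qed.

Lemma axis_gt0 a i : 0 < n2 (axis a i). Proof. by case: (disc_affine a i). Qed.

Lemma discE a i (x : D) : set_val (little_disc (set_val a) i x) = aff a i (set_val x).
Proof. by case: (disc_affine a i). Qed.

Let s0 a i : (axis a i).1 ^+ 2 + (axis a i).2 ^+ 2 != 0.
Proof. by rewrite -n2_sqr sqrf_eq0 gt_eqF// axis_gt0. Qed.

Lemma affK a i x : rel a i (aff a i x) = x.
Proof.
have h := s0 a i; rewrite /rel /aff /pmul /pinv /vadd /vsub /=.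
by rewrite [RHS]surjective_pairing; congr (_, _); field.
Qed.

Lemma relK a i z : aff a i (rel a i z) = z.
Proof.
have h := s0 a i; rewrite /rel /aff /pmul /pinv /vadd /vsub /=.
by rewrite [RHS]surjective_pairing; congr (_, _); field.
Qed.

Lemma n2_aff a i x y :
  n2 (vsub (aff a i x) (aff a i y)) = n2 (axis a i) * n2 (vsub x y).
Proof.
by rewrite -n2M; congr n2; rewrite /aff /pmul /vadd /vsub /=; congr (_, _); ring.
Qed.

Lemma n2_rel a i x y :
  n2 (vsub x y) = n2 (axis a i) * n2 (vsub (rel a i x) (rel a i y)).
Proof. by rewrite -n2_aff !relK. Qed.

Lemma aff_in a i x : n2 x <= 1 -> n2 (aff a i x) < 1.
Proof.
move=> x1; have [_ /(_ i (toD x))] : fDo R n (set_val a) := set_valP a.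
by move/open_discP; rewrite discE toD_val.
Qed.

Lemma aff_disjoint a i j x y : n2 x <= 1 -> n2 y <= 1 -> aff a i x = aff a j y -> i = j.
Proof.
move=> x1 y1 e.
have [[[_ inj _] _] _] : fDo R n (set_val a) := set_valP a.
have : little_disc (set_val a) i (toD x) = little_disc (set_val a) j (toD y).
  by apply: set_val_inj; rewrite !discE !toD_val.
by move/inj => /(congr1 (fun p : {_ : 'I_n & D} => projT1 p)).
Qed.

Lemma axis_le1 a i : n2 (axis a i) <= 1.
Proof.
have h1 : n2 (aff a i (1, 0)) < 1 by apply: aff_in; rewrite n2_10.
have h2 : n2 (aff a i (-1, 0)) < 1.
  by apply: aff_in; rewrite /n2 /= sqrrN expr1n expr0n/= addr0 sqrtr1.
have := n2_triangle (aff a i (1, 0)) (vscale (-1) (aff a i (-1, 0))).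
rewrite n2Z normrN1 mul1r (_ : vadd _ _ = vscale 2 (axis a i)); last first.
  by rewrite /aff /vadd /vscale /pmul /=; congr (_, _); ring.
by rewrite n2Z ger0_norm//; lra.
Qed.

Lemma discs_realP a (z : D) :
  discs_real a z <-> forall i, 1 <= n2 (rel a i (set_val z)).
Proof.
split=> [H i|H i [x ox e]].
  rewrite leNgt; apply/negP => h; apply: (H i).
  exists (toD (rel a i (set_val z))).
    by apply/open_discP; rewrite toD_val ?ltW.
  by apply: set_val_inj; rewrite discE toD_val ?relK// ltW.
have := H i; rewrite -e discE affK leNgt => /negP; apply.
exact/open_discP.
Qed.

Section CtsDiscs.
Context {X : topologicalType}.
Variables (a : X -> fDo R n).
Hypothesis ca : continuous a.

Lemma cts_little_disc i (p : D) : continuous (fun u : X => little_disc (set_val (a u)) i p).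
Proof.
have c : continuous (fun g : discs_maps R n => g (existT _ i p)).
  move=> g U; rewrite nbhsE => -[V [oV Vg] VU].
  have oS := @compact_open_open {i : 'I_n & D} D _ V (@compact_set1 _ (existT _ i p)) oV.
  have : nbhs g [set h | h @` [set existT _ i p] `<=` V].
    by apply: open_nbhs_nbhs; split=> // _ [_ -> <-].
  by apply: filterS => h hV; apply: VU; apply: hV; exists (existT _ i p).
exact: (cts_comp c (cts_val ca)).
Qed.

Lemma ctsctr i : continuous (fun u : X => ctr (a u) i).
Proof. by rewrite /ctr; apply: cts_val; exact: cts_little_disc. Qed.

Lemma ctsaxis i : continuous (fun u : X => axis (a u) i).
Proof.
rewrite /axis; apply: ctsvsub; last exact: ctsctr.
by apply: cts_val; exact: cts_little_disc.
Qed.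

Lemma ctsaff i (z : X -> E) : continuous z -> continuous (fun u : X => aff (a u) i (z u)).
Proof.
move=> cz; apply: ctsvadd; first exact: ctsctr.
by apply: ctspmul => //; exact: ctsaxis.
Qed.

Lemma ctsrel i (z : X -> E) : continuous z -> continuous (fun u : X => rel (a u) i (z u)).
Proof.
move=> cz; apply: ctspmul; last by apply: ctsvsub => //; exact: ctsctr.
apply: ctspinv; last exact: ctsaxis.
by move=> u; rewrite gt_eqF// axis_gt0.
Qed.

End CtsDiscs.

(** The boundary circles: the little discs, and the outer circle for [None]. *)
Definition dbnd a (b : option 'I_n) (s : C) : D :=
  if b is Some i then little_disc (set_val a) i (circle_disc s) else circle_disc s.

Definition dbnd_val a (b : option 'I_n) (s : C) : E :=
  if b is Some i then aff a i (set_val s) else set_val s.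

Lemma dbndE a b s : set_val (dbnd a b s) = dbnd_val a b s.
Proof. by case: b => [i|] //=; rewrite discE. Qed.

Lemma dbnd_real a b s : discs_real a (dbnd a b s).
Proof.
case: b => [i|].
  by have := discs_bnd_subproof a i s; rewrite inE.
by have := discs_out_subproof a s; rewrite inE.
Qed.

(** Radial projection of the inside of the little discs to their boundaries,
    truncated near their centres. *)
Definition puncture a y : E :=
  let d i := vsub (aff a i (push (rel a i y))) y in
  vadd y (\sum_i (d i).1, \sum_i (d i).2).

Lemma puncture_id a y : (forall i, 1 <= n2 (rel a i y)) -> puncture a y = y.
Proof.
move=> h; rewrite /puncture !big1; first by rewrite /vadd /= !addr0; case: y {h}.
  by move=> i _; rewrite push_out// relK /= subrr.
by move=> i _; rewrite push_out// relK /= subrr.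
Qed.

Lemma puncture_in a y i : 2^-1 <= n2 (rel a i y) -> n2 (rel a i y) <= 1 ->
  puncture a y = aff a i (nrmlz (rel a i y)).
Proof.
move=> h1 h2.
have h j : j != i -> 1 <= n2 (rel a j y).
  move=> ji; rewrite leNgt; apply/negP => h; move/eqP: ji; apply.
  by apply: (@aff_disjoint a j i (rel a j y) (rel a i y)); rewrite ?relK// ltW.
pose d j := vsub (aff a j (push (rel a j y))) y.
change (vadd y (\sum_j (d j).1, \sum_j (d j).2) = aff a i (nrmlz (rel a i y))).
have d0 j : j != i -> d j = (0, 0) by move=> ji; rewrite /d push_out ?h// relK vsubxx.
rewrite (vsum1 d0) /d push_in//; set w := aff _ _ _.
by rewrite /vadd /vsub [RHS]surjective_pairing /= !(addrC _ (_ - _)) !subrK.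
Qed.

Lemma puncture_real a y : n2 y <= 1 -> (forall i, 2^-1 <= n2 (rel a i y)) ->
  n2 (puncture a y) <= 1 /\ discs_real a (toD (puncture a y)).
Proof.
move=> y1 h.
have [[i hi]|H] := pselect (exists i, n2 (rel a i y) < 1).
  have e := puncture_in (h i) (ltW hi).
  have e2 : puncture a y = set_val (dbnd a (Some i) (cunit (rel a i y))).
    by rewrite dbndE /= cunit_val.
  split; first by rewrite e2 discP.
  by rewrite e2 toDK; exact: dbnd_real.
have H' i : 1 <= n2 (rel a i y).
  by rewrite leNgt; apply/negP => hi; apply: H; exists i.
rewrite puncture_id//; split=> //; apply/discs_realP => i.
by rewrite toD_val.
Qed.

Lemma cts_puncture (X : topologicalType) (a : X -> fDo R n) (y : X -> E) :
  continuous a -> continuous y -> continuous (fun u : X => puncture (a u) (y u)).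
Proof.
move=> ca cy; apply: ctsvadd => //.
apply: (@ctsvsum _ _ _ (fun i (u : X) => vsub (aff (a u) i (push (rel (a u) i (y u)))) (y u))).
move=> i; apply: ctsvsub => //; apply: ctsaff => //.
by apply: ctspush; exact: ctsrel.
Qed.

End DiscCoordinates.

Arguments dbnd_real {R n} a b s.

(** * Comparison of nearby configurations of discs *)

Section DiscTransport.
Context {R : realType} {n : nat}.
Local Notation E := (R * R)%type.
Local Notation D := (disc R).
Local Notation C := (circle R).
Local Notation Bd := (option 'I_n).
Implicit Types (a : fDo R n) (i j : 'I_n) (b : Bd) (y : E) (z : D).

Definition clamp (r : R) : R := Num.max 0 (Num.min r 1).

Lemma clamp_ge0 r : 0 <= clamp r. Proof. by rewrite le_max lexx. Qed.

Lemma clamp_le1 r : clamp r <= 1.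
Proof. by rewrite ge_max ler01 ge_min lexx orbT. Qed.

Lemma clamp1 r : 1 <= r -> clamp r = 1.
Proof. by move=> r1; rewrite /clamp min_r// max_r. Qed.

Lemma clamp_gt0 r : 0 < clamp r -> 0 < r.
Proof. by rewrite lt_max ltxx/= lt_min => /andP[]. Qed.

Definition dcoord a b y : E := if b is Some i then rel a i y else y.

Definition bpoint a1 a2 b y : E :=
  if b is Some i then aff a1 i (nrmlz (rel a2 i y)) else nrmlz y.

Definition bdir a b z : C := cunit (dcoord a b (set_val z)).

Lemma bpointE a1 a2 b z : 2^-1 <= n2 (dcoord a2 b (set_val z)) ->
  bpoint a1 a2 b (set_val z) = set_val (dbnd a1 b (bdir a2 b z)).
Proof. by rewrite dbndE; case: b => [i|] h /=; rewrite cunit_val. Qed.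

Lemma n2_bpoint a1 a2 b y : n2 (bpoint a1 a2 b y) <= 1.
Proof. by case: b => [i|]; [rewrite ltW// aff_in//|]; exact: n2_nrmlz. Qed.

Variables (a0 : fDo R n) (del : R).

(** Signed distance, in units of the radius, to the boundary circle [b]. *)
Definition depth b y : R :=
  if b is Some i then n2 (rel a0 i y) - 1 else 1 - n2 y.

(** The inner collar, where boundary values are corrected, is [lam b > 0]. The
    outer one is wider, so that [chi b = 1] wherever [lam b > 0]. *)
Definition lam b z : R := clamp (2 - depth b (set_val z) / del).
Definition chi b z : R := clamp (4 - depth b (set_val z) / del).

Definition spread a1 a2 z : E :=
  let d b := vscale (chi b z) (vsub (bpoint a1 a2 b (set_val z)) (set_val z)) in
  vadd (set_val z) (\sum_b (d b).1, \sum_b (d b).2).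

(** A map [|a2| -> |a1|] close to the identity that crushes the inner collar of
    each boundary circle radially onto the corresponding boundary circle: there,
    a map with given boundary values precomposed with [carry] takes those
    values. *)
Definition carry a2 a1 z : D := toD (puncture a1 (spread a1 a2 z)).

(** The straight path from the round trip of [z] to [z], kept off the little
    discs. *)
Definition back a1 a2 (u : R) z : D :=
  toD (puncture a1 (vadd (vscale (1 - u) (set_val (carry a2 a1 (carry a1 a2 z))))
                         (vscale u (set_val z)))).

Lemma cts_depth (X : topologicalType) b (y : X -> E) : continuous y ->
  continuous (fun x => depth b (y x)).
Proof.
move=> cy; case: b => [i|] /=.
  apply: ctsB; last by cts.
  by apply: ctsn2; apply: ctsrel => //; exact: cts_cst.
by apply: ctsB; [cts|exact: ctsn2].
Qed.

Let cts_clamp (X : topologicalType) (f : X -> R) : continuous f ->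
  continuous (fun x => clamp (f x)).
Proof. by move=> cf; rewrite /clamp; cts. Qed.

Lemma cts_lam (X : topologicalType) b (z : X -> D) : continuous z ->
  continuous (fun x => lam b (z x)).
Proof.
move=> cz; apply: cts_clamp; apply: ctsB; first by cts.
by apply: ctsM; [apply: cts_depth; cts|cts].
Qed.

Let cts_chi (X : topologicalType) b (z : X -> D) : continuous z ->
  continuous (fun x => chi b (z x)).
Proof.
move=> cz; apply: cts_clamp; apply: ctsB; first by cts.
by apply: ctsM; [apply: cts_depth; cts|cts].
Qed.

Section CarryContinuity.
Context {X : topologicalType}.
Variables (a1 a2 : X -> fDo R n) (z : X -> D).
Hypotheses (c1 : continuous a1) (c2 : continuous a2) (cz : continuous z).

Lemma cts_carry : continuous (fun x => carry (a2 x) (a1 x) (z x)).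
Proof.
apply: ctstoD; apply: cts_puncture => //; apply: ctsvadd; first by cts.
apply: (@ctsvsum _ _ _ (fun b x => vscale (chi b (z x))
  (vsub (bpoint (a1 x) (a2 x) b (set_val (z x))) (set_val (z x))))) => b.
apply: ctsvscale; first exact: cts_chi.
apply: ctsvsub; last by cts.
case: b => [i|] /=; last by apply: ctsnrmlz; cts.
by apply: ctsaff => //; apply: ctsnrmlz; apply: ctsrel => //; cts.
Qed.

End CarryContinuity.

Lemma cts_back (X : topologicalType) (a1 a2 : X -> fDo R n) (u : X -> R) (z : X -> D) :
  continuous a1 -> continuous a2 -> continuous u -> continuous z ->
  continuous (fun x => back (a1 x) (a2 x) (u x) (z x)).
Proof.
move=> c1 c2 cu cz; apply: ctstoD; apply: cts_puncture => //; apply: ctsvadd.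
  apply: ctsvscale; first by cts.
  by apply: cts_val; apply: cts_carry => //; exact: cts_carry.
by apply: ctsvscale => //; cts.
Qed.

(** [del] is small enough for the collars to be disjoint, and [U] for [carry] and
    [back] to move points by a few multiples of [del] only. *)
Record collared (U : set (fDo R n)) : Prop := {
  collar_pos : 0 < del;
  collar_small : 1000 * del <= 1;
  collar_radius : forall i, 1000 * del <= n2 (axis a0 i);
  collar_disjoint : forall z b b', b != b' ->
    depth b (set_val z) < 5 * del -> 5 * del <= depth b' (set_val z);
  collar_rel : forall a i z, U a ->
    `|n2 (rel a i (set_val z)) - n2 (rel a0 i (set_val z))| < del;
  collar_bpoint : forall a1 a2 i z, U a1 -> U a2 ->
    n2 (vsub (bpoint a1 a2 (Some i) (set_val z))
             (bpoint a0 a0 (Some i) (set_val z))) < del }.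

Variable U : set (fDo R n).
Hypothesis HU : collared U.
Let del0 := collar_pos HU.
Let del_small := collar_small HU.
Let del_radius := collar_radius HU.
Let separated := collar_disjoint HU.
Let near_rel := collar_rel HU.
Let near_bpoint := collar_bpoint HU.

Local Ltac dlra := move: del0 del_small; lra.

Lemma lam_gt0 b z : 0 < lam b z -> depth b (set_val z) < 2 * del.
Proof. by move/clamp_gt0; rewrite subr_gt0 ltr_pdivrMr. Qed.

Let chi_gt0 b z : 0 < chi b z -> depth b (set_val z) < 4 * del.
Proof. by move/clamp_gt0; rewrite subr_gt0 ltr_pdivrMr. Qed.

Lemma lam1 b z : depth b (set_val z) <= del -> lam b z = 1.
Proof.
move=> h; apply: clamp1.
have : depth b (set_val z) / del <= 1 by rewrite ler_pdivrMr// mul1r.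
by dlra.
Qed.

Let chi1 b z : depth b (set_val z) <= 3 * del -> chi b z = 1.
Proof.
move=> h; apply: clamp1.
have : depth b (set_val z) / del <= 3 by rewrite ler_pdivrMr.
by dlra.
Qed.

Lemma lam_uniq b b' z : 0 < lam b z -> b' != b -> lam b' z = 0.
Proof.
move=> /lam_gt0 h bb'; rewrite eq_sym in bb'.
have h' : 5 * del <= depth b' (set_val z) by apply: (separated (z := z) bb'); dlra.
apply/eqP; rewrite eq_le clamp_ge0 andbT leNgt; apply/negP => /lam_gt0; dlra.
Qed.

Let chi_uniq b b' z : 0 < chi b z -> b' != b -> chi b' z = 0.
Proof.
move=> /chi_gt0 h bb'; rewrite eq_sym in bb'.
have h' : 5 * del <= depth b' (set_val z) by apply: (separated (z := z) bb'); dlra.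
apply/eqP; rewrite eq_le clamp_ge0 andbT leNgt; apply/negP => /chi_gt0; dlra.
Qed.

Let spread_active a1 a2 z b : 0 < chi b z ->
  spread a1 a2 z = vadd (set_val z)
    (vscale (chi b z) (vsub (bpoint a1 a2 b (set_val z)) (set_val z))).
Proof.
move=> cb; rewrite /spread.
pose d b := vscale (chi b z) (vsub (bpoint a1 a2 b (set_val z)) (set_val z)).
have d0 b' : b' != b -> d b' = (0, 0).
  by move=> bb; rewrite /d (chi_uniq cb bb) /vscale !mul0r.
by congr (vadd _ _); exact: (vsum1 d0).
Qed.

Let spread_idle a1 a2 z : (forall b, chi b z <= 0) -> spread a1 a2 z = set_val z.
Proof.
move=> c0; rewrite /spread.
have e b : chi b z = 0 by apply/eqP; rewrite eq_le c0 clamp_ge0.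
rewrite !big1; first by rewrite /vadd /= !addr0; case: (set_val z).
  by move=> b _; rewrite e /vscale /= mul0r.
by move=> b _; rewrite e /vscale /= mul0r.
Qed.

Let axis0 i : 0 < n2 (axis a0 i). Proof. exact: axis_gt0. Qed.

Let rel0_lip i y y' e : n2 (vsub y y') <= e * n2 (axis a0 i) ->
  n2 (rel a0 i y') - e <= n2 (rel a0 i y).
Proof.
move=> h; rewrite lerBlDr -lerBlDl; apply: le_trans (n2_sub_ge _ _) _.
by rewrite n2C; move: h; rewrite (n2_rel a0 i) mulrC ler_pM2r.
Qed.

Let rel0_ge a i z : U a -> discs_real a z -> 1 - del <= n2 (rel a0 i (set_val z)).
Proof.
move=> Ua /discs_realP/(_ i); have := near_rel i z Ua.
by rewrite ltr_norml; dlra.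
Qed.

(* A round trip moves points by at most 2 * 17 * del. *)
Let rel_away a1 a2 i z y : U a1 -> U a2 -> discs_real a2 z -> n2 y <= 1 ->
  n2 (vsub y (set_val z)) <= 34 * del -> 1 - 1/10 <= n2 (rel a1 i y).
Proof.
move=> U1 U2 z2 y1 yz.
have h1 := rel0_ge i U2 z2.
have h2 : n2 (rel a0 i (set_val z)) - 1/20 <= n2 (rel a0 i y).
  apply: rel0_lip; apply: le_trans yz _; have := del_radius i; dlra.
have := near_rel i (toD y) U1; rewrite toD_val// ltr_norml.
by dlra.
Qed.

Let half_lt : 2^-1 <= 1 - 1/10 :> R. Proof. dlra. Qed.

Let bpoint0_dist i y : 2^-1 <= n2 (rel a0 i y) ->
  n2 (vsub (bpoint a0 a0 (Some i) y) y) <= `|1 - n2 (rel a0 i y)|.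
Proof.
move=> h; rewrite -{2}(relK a0 i y) /= n2_aff n2_nrmlz_sub//.
by rewrite ler_piMl// axis_le1.
Qed.

Let bpoint_dist a1 a2 b z : U a1 -> U a2 -> discs_real a2 z -> 0 < chi b z ->
  n2 (vsub (bpoint a1 a2 b (set_val z)) (set_val z)) <= 5 * del.
Proof.
move=> U1 U2 z2 /chi_gt0; case: b => [i|] h; last first.
  rewrite /= in h *; rewrite n2_nrmlz_sub; last by dlra.
  by rewrite ger0_norm; [dlra|have := discP z; dlra].
have h1 := rel0_ge i U2 z2; rewrite /depth in h.
apply: le_trans (n2_tri (bpoint a0 a0 (Some i) (set_val z)) _ _) _.
have h2 := near_bpoint i z U1 U2.
have h3 : n2 (vsub (bpoint a0 a0 (Some i) (set_val z)) (set_val z)) <= 4 * del.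
  apply: le_trans (bpoint0_dist _) _; first by dlra.
  by rewrite ler_norml; dlra.
by dlra.
Qed.

Let spreadP a1 a2 z : U a1 -> U a2 -> discs_real a2 z ->
  n2 (spread a1 a2 z) <= 1 /\ n2 (vsub (spread a1 a2 z) (set_val z)) <= 5 * del.
Proof.
move=> U1 U2 z2.
have [[b cb]|H] := pselect (exists b, 0 < chi b z); last first.
  rewrite spread_idle; last by move=> b; rewrite leNgt; apply/negP => h; apply: H; exists b.
  by rewrite vsubxx n20; split; [exact: discP|rewrite mulr_ge0// ltW].
rewrite (spread_active a1 a2 cb); set w := bpoint _ _ _ _.
have c0 := ltW cb; have c1 : chi b z <= 1 := clamp_le1 _.
have wz : n2 (vsub w (set_val z)) <= 5 * del by exact: bpoint_dist.
split.
  rewrite (_ : vadd _ _ = vadd (vscale (1 - chi b z) (set_val z)) (vscale (chi b z) w)).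
    apply: le_trans (n2_triangle _ _) _; rewrite !n2Z ger0_norm ?subr_ge0// ger0_norm//.
    have h1 := discP z; have h2 : n2 w <= 1 by exact: n2_bpoint.
    by have := n2_ge0 w; have := n2_ge0 (set_val z); nra.
  by rewrite /vadd /vscale /vsub /=; congr (_, _); ring.
rewrite (_ : vsub _ _ = vscale (chi b z) (vsub w (set_val z))); last first.
  by rewrite /vadd /vscale /vsub /=; congr (_, _); ring.
by rewrite n2Z ger0_norm//; apply: le_trans wz; rewrite ler_piMl// n2_ge0.
Qed.

Let carryP a1 a2 z : U a1 -> U a2 -> discs_real a2 z ->
  discs_real a1 (carry a2 a1 z) /\
  n2 (vsub (set_val (carry a2 a1 z)) (set_val z)) <= 17 * del.
Proof.
move=> U1 U2 z2; have [y1 yz] := spreadP U1 U2 z2.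
set y := spread a1 a2 z in y1 yz *.
have far i : 1 - 1/10 <= n2 (rel a1 i y).
  by apply: (rel_away i U1 U2 z2 y1); apply: le_trans yz _; dlra.
have far' i : 2^-1 <= n2 (rel a1 i y) by exact: le_trans half_lt (far i).
have [p1 pr] := puncture_real y1 far'.
split; first exact: pr.
rewrite /carry -/y toD_val//.
apply: le_trans (n2_tri y _ _) _.
suff : n2 (vsub (puncture a1 y) y) <= 12 * del by dlra.
have [[i hi]|H] := pselect (exists i, n2 (rel a1 i y) < 1); last first.
  rewrite puncture_id; first by rewrite vsubxx n20 mulr_ge0// ltW.
  by move=> i; rewrite leNgt; apply/negP => h; apply: H; exists i.
rewrite (puncture_in (far' i) (ltW hi)).
apply: le_trans (n2_tri (bpoint a0 a0 (Some i) y) _ _) _.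
have h2 := near_bpoint i (toD y) U1 U1; rewrite toD_val// /= in h2.
have h3 := near_rel i (toD y) U1; rewrite toD_val// ltr_norml in h3.
have hr := far i.
have h4 : n2 (vsub (bpoint a0 a0 (Some i) y) y) <= 11 * del.
  rewrite -{2}(relK a0 i y) /= n2_aff n2_nrmlz_sub; last by dlra.
  have h5 := rel0_ge i U2 z2.
  have h6 : n2 (axis a0 i) * n2 (vsub (rel a0 i y) (rel a0 i (set_val z))) <= 5 * del.
    by rewrite -n2_rel.
  have h7 := n2_sub_ge (rel a0 i (set_val z)) (rel a0 i y).
  rewrite n2C in h7.
  have h8 : 1 - n2 (rel a0 i y) <= del + n2 (vsub (rel a0 i y) (rel a0 i (set_val z))).
    by dlra.
  have ax1 := axis_le1 a0 i; have ax0 := axis0 i.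
  have [s|s] := leP 0 (1 - n2 (rel a0 i y)).
    have : n2 (axis a0 i) * (1 - n2 (rel a0 i y)) <=
       n2 (axis a0 i) * (del + n2 (vsub (rel a0 i y) (rel a0 i (set_val z)))).
      by rewrite ler_pM2l.
    have : n2 (axis a0 i) * del <= del by rewrite ler_piMl// ltW.
    by rewrite ger0_norm//; dlra.
  have : n2 (axis a0 i) * - (1 - n2 (rel a0 i y)) <= 1 * del.
    by apply: ler_pM => //; dlra.
  by rewrite ltr0_norm//; dlra.
by move: h2; rewrite /=; dlra.
Qed.

Lemma carry_real a1 a2 z : U a1 -> U a2 -> discs_real a2 z ->
  discs_real a1 (carry a2 a1 z).
Proof. by move=> U1 U2 z2; have [] := carryP U1 U2 z2. Qed.

Lemma dcoord_ge a b z : U a -> discs_real a z -> 0 < lam b z ->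
  2^-1 <= n2 (dcoord a b (set_val z)).
Proof.
move=> Ua za /lam_gt0; case: b => [i|] /= h.
  by have /(_ i) := (discs_realP a z).1 za; dlra.
by dlra.
Qed.

Lemma carry_collar a1 a2 b z : U a1 -> U a2 -> discs_real a2 z -> 0 < lam b z ->
  carry a2 a1 z = dbnd a1 b (bdir a2 b z).
Proof.
move=> U1 U2 z2 lb; have h := dcoord_ge U2 z2 lb.
have cb : chi b z = 1 by apply: chi1; have := lam_gt0 lb; dlra.
have e : spread a1 a2 z = set_val (dbnd a1 b (bdir a2 b z)).
  rewrite (spread_active a1 a2 (b := b)) cb// -bpointE//.
  by rewrite /vadd /vscale /vsub [RHS]surjective_pairing /= !mul1r !(addrC _ (_ - _)) !subrK.
rewrite /carry e puncture_id ?toDK// => i.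
by have /discs_realP := dbnd_real a1 b (bdir a2 b z).
Qed.

Lemma lam_dbnd a b s : U a -> lam b (dbnd a b s) = 1.
Proof.
move=> Ua; apply: lam1; case: b => [i|]; last first.
  by rewrite dbndE /= circle_n2 subrr ltW.
have := near_rel i (dbnd a (Some i) s) Ua.
by rewrite dbndE /= affK circle_n2 ltr_norml; dlra.
Qed.

Lemma bdir_dbnd a b s : bdir a b (dbnd a b s) = s.
Proof.
rewrite /bdir dbndE; case: b => [i|] /=; last exact: cunitK.
by rewrite affK cunitK.
Qed.

Lemma carry_dbnd a1 a2 b s : U a1 -> U a2 ->
  carry a2 a1 (dbnd a2 b s) = dbnd a1 b s.
Proof.
move=> U1 U2; rewrite (carry_collar U1 U2 (dbnd_real _ _ _) (b := b)) ?bdir_dbnd//.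
by rewrite lam_dbnd.
Qed.

Lemma back_real a1 a2 (u : R) z : U a1 -> U a2 -> discs_real a1 z -> 0 <= u <= 1 ->
  discs_real a1 (back a1 a2 u z).
Proof.
move=> U1 U2 z1 /andP[u0 u1].
have [k1 d1] := carryP U2 U1 z1; have [k2 d2] := carryP U1 U2 k1.
set w := carry a2 a1 _ in k2 d2.
have d3 := le_trans (n2_tri (set_val (carry a1 a2 z)) (set_val w) (set_val z)) (lerD d2 d1).
set y := vadd (vscale (1 - u) (set_val w)) (vscale u (set_val z)).
have y1 : n2 y <= 1.
  apply: le_trans (n2_triangle _ _) _; rewrite (n2Z (1 - u)) (n2Z u) ger0_norm ?subr_ge0// ger0_norm//.
  have h1 := discP z; have h2 := discP w.
  by have := n2_ge0 (set_val w); have := n2_ge0 (set_val z); nra.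
have yz : n2 (vsub y (set_val z)) <= 34 * del.
  rewrite (_ : vsub _ _ = vscale (1 - u) (vsub (set_val w) (set_val z))); last first.
    by rewrite /y /vadd /vscale /vsub /=; congr (_, _); ring.
  rewrite (n2Z (1 - u)) ger0_norm ?subr_ge0//.
  have := n2_ge0 (vsub (set_val w) (set_val z)); move: d3 u0 u1; nra.
have far' i : 2^-1 <= n2 (rel a1 i y).
  by apply: le_trans half_lt (rel_away _ U1 U1 z1 y1 yz).
by have [] := puncture_real y1 far'.
Qed.

Let vadd_mix (u : R) y : vadd (vscale (1 - u) y) (vscale u y) = y.
Proof. by rewrite [RHS]surjective_pairing /vadd /vscale /=; congr (_, _); ring. Qed.

Let toD_puncture a z : discs_real a z -> toD (puncture a (set_val z)) = z.
Proof. by move=> /discs_realP h; rewrite puncture_id// toDK. Qed.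

Lemma back0 a1 a2 z : U a1 -> U a2 -> discs_real a1 z ->
  back a1 a2 0 z = carry a2 a1 (carry a1 a2 z).
Proof.
move=> U1 U2 z1; rewrite /back (_ : vadd _ _ = set_val (carry a2 a1 (carry a1 a2 z))).
  by apply: toD_puncture; do 2 apply: carry_real => //.
by rewrite [RHS]surjective_pairing /vadd /vscale subr0 /= !mul1r !mul0r !addr0.
Qed.

Lemma back1 a1 a2 z : discs_real a1 z -> back a1 a2 1 z = z.
Proof.
move=> z1; rewrite /back (_ : vadd _ _ = set_val z); first exact: toD_puncture.
by rewrite [RHS]surjective_pairing /vadd /vscale subrr /= !mul1r !mul0r !add0r.
Qed.

Lemma back_dbnd a1 a2 u b s : U a1 -> U a2 -> back a1 a2 u (dbnd a1 b s) = dbnd a1 b s.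
Proof.
move=> U1 U2; rewrite /back !carry_dbnd// vadd_mix.
by apply: toD_puncture; exact: dbnd_real.
Qed.

End DiscTransport.

Section CollarExistence.
Context {R : realType} {n : nat}.
Local Notation D := (disc R).
Implicit Types (a : fDo R n) (i : 'I_n) (b : option 'I_n) (z : D) (del : R).

(** Distinct little discs are disjoint from each other and from the boundary of
    the big disc. *)
Let depth_pos a b b' z : b != b' ->
  0 < Num.max (depth a b (set_val z)) (depth a b' (set_val z)).
Proof.
move=> bb; rewrite ltNge; apply/negP; rewrite ge_max => /andP[].
case: b b' bb => [i|] [j|] //= bb; rewrite ?subr_le0 => h h'.
- move/eqP: bb; apply; congr Some.
  by apply: (@aff_disjoint _ _ a i j _ _ h h'); rewrite !relK.
- by have := aff_in a i h; rewrite relK; lra.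
- by have := aff_in a j h'; rewrite relK; lra.
Qed.

Let near_all {X : topologicalType} {I : finType} (x : X) (P : I -> X -> Prop) :
  (forall k : I, nbhs x [set y | P k y]) -> nbhs x [set y | forall k, P k y].
Proof. by move=> H; exact: (@filter_forall _ _ P (nbhs x)). Qed.

Lemma collared_exists a0 : exists del U, nbhs a0 U /\ collared a0 del U.
Proof.
have nsep : \forall r \near (0 : R), forall z (bb : option 'I_n * option 'I_n),
    bb.1 != bb.2 ->
    5 * r < Num.max (depth a0 bb.1 (set_val z)) (depth a0 bb.2 (set_val z)).
  apply: tube => [|z]; first exact: compact_disc.
  apply: near_all => -[b b'] /=.
  have [->|bb] := eqVneq b b'; first exact: filterE.
  pose f (x : R * D) : R :=
    5 * x.1 - Num.max (depth a0 b (set_val x.2)) (depth a0 b' (set_val x.2)).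
  have cf : continuous f.
    by rewrite /f; cts; apply: cts_depth; cts.
  have := cts_near_lt (x := ((0 : R), z)) (a := 0) cf; rewrite /f /=.
  rewrite mulr0 sub0r oppr_lt0 => /(_ (depth_pos a0 z bb)).
  by apply: filterS => -[r w] /=; rewrite subr_lt0 => h _.
have nsm : \forall r \near (0 : R), 1000 * r < 1.
  apply: (@cts_near_lt _ _ (fun r : R => 1000 * r)); first by cts.
  by rewrite mulr0.
have nrad : \forall r \near (0 : R), forall i, 1000 * r < n2 (axis a0 i).
  apply: near_all => i.
  apply: (@cts_near_lt _ _ (fun r : R => 1000 * r)); first by cts.
  by rewrite mulr0 axis_gt0.
have : \forall r \near (0 : R), [/\ forall z bb, bb.1 != bb.2 ->
    5 * r < Num.max (depth a0 bb.1 (set_val z)) (depth a0 bb.2 (set_val z)),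
    1000 * r < 1 & forall i, 1000 * r < n2 (axis a0 i)].
  by move: nsep nsm nrad; apply: filterS3.
move=> /nbhs_ballP[e /= e0 He].
pose del := e / 2; have del0 : 0 < del by rewrite divr_gt0.
have [] := He del; first by rewrite /ball /= sub0r normrN gtr0_norm// /del; lra.
move=> hsep hsm hrad.
have nrel : \forall a \near a0, forall z i,
    `|n2 (rel a i (set_val z)) - n2 (rel a0 i (set_val z))| < del.
  apply: tube => [|z]; first exact: compact_disc.
  apply: near_all => i.
  pose f (x : fDo R n * D) :=
    `|n2 (rel x.1 i (set_val x.2)) - n2 (rel a0 i (set_val x.2))|.
  have cf : continuous f.
    by apply: ctsnorm; apply: ctsB; apply: ctsn2; apply: ctsrel; cts.
  by apply: (cts_near_lt cf); rewrite /f /= subrr normr0.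
have nbp : \forall aa \near ((a0, a0) : fDo R n * fDo R n), forall z i,
    n2 (vsub (bpoint aa.1 aa.2 (Some i) (set_val z))
             (bpoint a0 a0 (Some i) (set_val z))) < del.
  apply: tube => [|z]; first exact: compact_disc.
  apply: near_all => i.
  pose f (x : (fDo R n * fDo R n) * D) :=
    n2 (vsub (bpoint x.1.1 x.1.2 (Some i) (set_val x.2))
             (bpoint a0 a0 (Some i) (set_val x.2))).
  have cf : continuous f.
    apply: ctsn2; apply: ctsvsub; rewrite /bpoint; apply: ctsaff; try by cts.
      by apply: ctsnrmlz; apply: ctsrel; cts.
    by apply: ctsnrmlz; apply: ctsrel; cts.
  by apply: (cts_near_lt cf); rewrite /f /= vsubxx n20.
have [[U1 U2] /= [n1 n2'] U12] := nbp.
exists del, [set a | [/\ U1 a, U2 a & forall z i,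
  `|n2 (rel a i (set_val z)) - n2 (rel a0 i (set_val z))| < del]]; split.
  by move: n1 n2' nrel; apply: filterS3.
split.
- exact: del0.
- exact: ltW hsm.
- by move=> i; exact: ltW (hrad i).
- move=> z b b' bb h; have := hsep z (b, b') bb; rewrite /= lt_max => /orP[h'|/ltW//].
  by move: (lt_trans h h'); rewrite ltxx.
- by move=> a i z [_ _] h; exact: h.
- by move=> a1 a2 i z [h1 _ _] [_ h2 _]; exact: (U12 (a1, a2) (conj h1 h2) z i).
Qed.

End CollarExistence.

(** * Restricted maps and homotopy equivalences *)

Section Restriction.
Context {R : realType}.
Local Notation I := (@unit_interval R).

Definition corestr {X Y : topologicalType} (A : set X) (B : set Y) (f : X -> Y)
    (h : forall x, A x -> B (f x)) (x : A) : B :=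
  exist _ (f (set_val x)) (mem_set (h _ (set_valP x))).

(** Maps between realizations are represented by functions on the ambient
    spaces, so that composing them involves no proof of membership. *)
Definition he_on {X Y : topologicalType} (A : set X) (B : set Y) (f : X -> Y) : Prop :=
  exists h : forall x, A x -> B (f x), @homotopy_equivalence R _ _ (corestr h).

Lemma corestr_ext {X Y : topologicalType} (A : set X) (B : set Y) (f : X -> Y)
    (h : forall x, A x -> B (f x)) (g : A -> B) :
  (forall x, set_val (g x) = f (set_val x)) -> g = corestr h.
Proof. by move=> e; apply/funext => x; apply: set_val_inj; rewrite e. Qed.

Lemma corestr_cts {X Y : topologicalType} (A : set X) (B : set Y) (f : X -> Y)
    (h : forall x, A x -> B (f x)) :
  continuous (fun x : A => f (set_val x)) -> continuous (corestr h).
Proof. by move=> cf; apply: cts_sub. Qed.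

Lemma he_on_cts {X Y : topologicalType} (A : set X) (B : set Y) (f : X -> Y) :
  he_on A B f -> continuous (fun x : A => f (set_val x)).
Proof. by move=> [h [ch _]]; exact: cts_val ch. Qed.

Lemma he_on_ext {X Y : topologicalType} (A : set X) (B : set Y) (f g : X -> Y) :
  (forall x, A x -> f x = g x) -> he_on A B f -> he_on A B g.
Proof.
move=> fg [h hh]; have hg x : A x -> B (g x) by move=> Ax; rewrite -fg//; exact: (h x Ax).
exists hg; rewrite -(@corestr_ext _ _ _ _ _ hg (corestr h))// => x.
by rewrite -fg//; exact: set_valP.
Qed.

Lemma he_on_comp {X Y Z : topologicalType} (A : set X) (B : set Y) (C : set Z)
    (f : X -> Y) (g : Y -> Z) :
  he_on A B f -> he_on B C g -> he_on A C (fun x => g (f x)).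
Proof.
move=> [hf ef] [hg eg]; exists (fun x Ax => hg _ (hf x Ax)).
by rewrite -(@corestr_ext _ _ _ _ _ _ (fun x => corestr hg (corestr hf x)))//; exact: he_comp.
Qed.

Section Homotopy.
Context {X Y : topologicalType} (A : set X) (B : set Y) (H : X -> R -> Y).
Hypothesis HAB : forall x (t : R), 0 <= t <= 1 -> A x -> B (H x t).
Hypothesis cH : continuous (fun p : A * I => H (set_val p.1) (set_val p.2)).

Lemma corestr_homotopic (f g : A -> B) :
  (forall x, set_val (f x) = H (set_val x) 0) ->
  (forall x, set_val (g x) = H (set_val x) 1) -> @homotopic R _ _ f g.
Proof.
have HB (p : A * I) : B (H (set_val p.1) (set_val p.2)).
  apply: HAB; last exact: set_valP.
  by have := set_valP p.2; rewrite /unit_interval/= in_itv.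
move=> ef eg.
pose K (p : A * I) : B := exist _ (H (set_val p.1) (set_val p.2)) (mem_set (HB p)).
exists K; split.
- exact: cts_sub.
- by move=> x; apply: set_val_inj; rewrite ef.
- by move=> x; apply: set_val_inj; rewrite eg.
Qed.

Lemma he_on_homotopic : he_on A B (fun x => H x 1) -> he_on A B (fun x => H x 0).
Proof.
move=> [h1 e1].
have h0 x : A x -> B (H x 0) by apply: HAB; rewrite lexx ler01.
exists h0; apply: he_homotopic e1.
  apply: corestr_cts.
  by apply: (cts_comp (f := fun x : A => (x, unit0)) cH); cts.
by apply: homotopic_sym; apply: corestr_homotopic.
Qed.

End Homotopy.

Lemma he_on_intro {X Y : topologicalType} (A : set X) (B : set Y)
    (f : X -> Y) (g : Y -> X) (H : X -> R -> X) (K : Y -> R -> Y) :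
  (forall x, A x -> B (f x)) -> (forall y, B y -> A (g y)) ->
  continuous (fun x : A => f (set_val x)) ->
  continuous (fun y : B => g (set_val y)) ->
  (forall x (t : R), 0 <= t <= 1 -> A x -> A (H x t)) ->
  (forall y (t : R), 0 <= t <= 1 -> B y -> B (K y t)) ->
  continuous (fun p : A * I => H (set_val p.1) (set_val p.2)) ->
  continuous (fun p : B * I => K (set_val p.1) (set_val p.2)) ->
  (forall x, A x -> H x 0 = g (f x) /\ H x 1 = x) ->
  (forall y, B y -> K y 0 = f (g y) /\ K y 1 = y) ->
  he_on A B f.
Proof.
move=> hf hg cf cg hH hK cH cK eH eK; exists hf; split; first exact: corestr_cts.
exists (corestr hg); split; first exact: corestr_cts.
- by apply: (corestr_homotopic hH cH) => x; have [e0 e1] := eH _ (set_valP x); rewrite ?e0 ?e1.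
- by apply: (corestr_homotopic hK cK) => x; have [e0 e1] := eK _ (set_valP x); rewrite ?e0 ?e1.
Qed.

End Restriction.

(** * Maps into the space of fibrewise equivalences *)

Section FibrewiseEquivalenceMaps.
Context {R : realType} {n : nat}.
Local Notation E := (EB R n).
Local Notation D := (disc R).
Local Notation T := (torus R n).
Local Notation C := (circle R).
Local Notation I := (@unit_interval R).
Local Notation Eo := (Eo R n).
Implicit Types (b : option 'I_n) (e : Eo) (z : D) (s : C).

Definition cbnd (c : cacti R n) b s : T :=
  if b is Some i then cacti_bnd c i s else cacti_fun c s.

(** Evaluation as a total function; the value outside the domain is a dummy. *)
Definition ev e z : T :=
  if pselect (fibre_discs (fm_base (set_val e)) z) is left h then app h
  else fun=> circle_exp 0.

Lemma evE e z (h : fibre_discs (fm_base (set_val e)) z) : ev e z = app h.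
Proof. by rewrite /ev; case: pselect => [h'|]//; exact: app_irr. Qed.

Lemma ev_real e z : discs_real (Eo_proj e).1 z -> cacti_real (Eo_proj e).2 (ev e z).
Proof. by move=> h; rewrite (evE h); exact: set_valP. Qed.

Lemma ev_dbnd e b s : ev e (dbnd (Eo_proj e).1 b s) = cbnd (Eo_proj e).2 b s.
Proof.
have h : fibre_discs (fm_base (set_val e)) (dbnd (Eo_proj e).1 b s).
  exact: dbnd_real.
have [_ hb ho] := set_valP e.
rewrite (evE h); case: b h => [i|] h /=.
  by rewrite -hb /app; congr (set_val (fm_map _ _)); exact: val_inj.
by rewrite -[RHS]/(cacti_out _ s) -ho /app; congr (set_val (fm_map _ _)); exact: val_inj.
Qed.

Lemma ev_he e : @he_on R _ _ (fibre_discs (Eo_proj e)) (fibre_cacti (Eo_proj e)) (ev e).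
Proof.
exists (@ev_real e); have [he _ _] := set_valP e.
rewrite -(@corestr_ext _ _ _ _ _ _ (fm_map (set_val e)))// => x.
have h : fibre_discs (fm_base (set_val e)) (set_val x) by exact: set_valP.
by rewrite (evE h) /app; congr (set_val (fm_map _ _)); exact: val_inj.
Qed.

Lemma cts_Eo_proj (Y : topologicalType) (e : Y -> Eo) : continuous e ->
  continuous (fun y => Eo_proj (e y)).
Proof. by move=> ce; exact: (cts_comp (@fm_base_cts _ _ _ _ _) (cts_val ce)). Qed.

(** This is what makes evaluation continuous, see [app_cts]. *)
Lemma closed_discs_real : closed [set x : E * D | fibre_discs x.1 x.2].
Proof.
have -> : [set x : E * D | fibre_discs x.1 x.2] =
    \bigcap_(i in [set: 'I_n]) [set x : E * D | 1 <= n2 (rel x.1.1 i (set_val x.2))].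
  by apply/seteqP; split=> [x /discs_realP h i _|x h]; [exact: h|apply/discs_realP => i; exact: h].
apply: closed_bigI => i _.
have c : continuous (fun x : E * D => n2 (rel x.1.1 i (set_val x.2))).
  by apply: ctsn2; apply: ctsrel; cts.
by apply: (closed_comp (f := fun x : E * D => n2 (rel x.1.1 i (set_val x.2)))) (@closed_ge R 1) => x _; exact: c.
Qed.

Lemma cts_ev (Y : topologicalType) (e : Y -> Eo) (z : Y -> D) :
  continuous e -> continuous z -> (forall y, discs_real (Eo_proj (e y)).1 (z y)) ->
  continuous (fun y => ev (e y) (z y)).
Proof.
move=> ce cz h.
pose g y : @app_dom E D T (@fibre_discs R n) (@fibre_cacti R n) :=
  exist _ (set_val (e y), z y) (mem_set (h y)).
have cg : continuous g.
  apply: cts_sub; change (continuous (fun y => (set_val (e y), z y))); cts.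
rewrite (_ : (fun y => _) = (fun y => app_fun (g y))).
  apply: (cts_comp _ cg); apply: app_cts.
  - exact: compact_disc.
  - exact: regular_disc.
  - exact: closed_discs_real.
by apply/funext => y; rewrite (evE (h y)); exact: app_irr.
Qed.

Lemma Eo_ext e e' : Eo_proj e = Eo_proj e' ->
  (forall z, discs_real (Eo_proj e).1 z -> ev e z = ev e' z) -> e = e'.
Proof.
move=> eb ez; apply: set_val_inj; rewrite /Eo_proj in eb ez.
have H z (h : fibre_discs (fm_base (set_val e)) z) (h' : fibre_discs (fm_base (set_val e')) z) :
    app h = app h' by rewrite -!evE; exact: ez.
move: H eb; case: (set_val e) => b1 m1 c1; case: (set_val e') => b2 m2 c2 /= H eb.
move: eb m2 c2 H => <- m2 c2 H.
have mm : m1 = m2.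
  apply/funext => x; apply: set_val_inj.
  have h : fibre_discs b1 (set_val x) by exact: set_valP.
  have := H _ h h; rewrite /app /= (_ : exist _ _ _ = x)//; exact: val_inj.
by move: c2 H; rewrite -mm => c2 _; congr FibMap; exact: Prop_irrelevance.
Qed.

(** A map homotopic to a homotopy equivalence is one, so that along a homotopy
    this condition is only required at the end. *)
Lemma Eo_lift (Y : topologicalType) (be : Y -> E) (f : Y * I -> D -> T) :
  continuous be ->
  (forall p z, discs_real (be p.1).1 z -> cacti_real (be p.1).2 (f p z)) ->
  (forall p b s, f p (dbnd (be p.1).1 b s) = cbnd (be p.1).2 b s) ->
  continuous (fun x : [set x : (Y * I) * D | discs_real (be x.1.1).1 x.2] =>
    f (set_val x).1 (set_val x).2) ->
  (forall y, @he_on R _ _ (fibre_discs (be y)) (fibre_cacti (be y)) (f (y, unit1))) ->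
  exists g : Y * I -> Eo, [/\ continuous g, forall p, Eo_proj (g p) = be p.1 &
    forall p z, discs_real (be p.1).1 z -> ev (g p) z = f p z].
Proof.
move=> cbe fr fb cf fh.
have fhe p : @he_on R _ _ (fibre_discs (be p.1)) (fibre_cacti (be p.1)) (f p).
  case: p => y t.
  pose r (s : R) : I := clampI (set_val t + s * (1 - set_val t)).
  pose H z (s : R) := f (y, r s) z.
  have r0 : r 0 = t by rewrite /r mul0r addr0 clampI_val.
  have r1 : r 1 = unit1 by rewrite /r mul1r addrC subrK clampI_ge1.
  rewrite -[in f _]r0; apply: (@he_on_homotopic _ _ _ _ _ H).
  - by move=> z s _ h; apply: (fr (y, r s)).
  - pose k (p : fibre_discs (be y) * I) : [set x : (Y * I) * D | discs_real (be x.1.1).1 x.2] :=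
      exist _ ((y, r (set_val p.2)), set_val p.1) (mem_set (set_valP p.1)).
    apply: (cts_comp (f := k) cf); apply: cts_sub.
    change (continuous (fun p : fibre_discs (be y) * I => ((y, r (set_val p.2)), set_val p.1))).
    apply: cts_pair; last by cts.
    by apply: cts_pair; [cts|apply: clampI_cts; cts].
  - by rewrite /H r1; exact: fh.
have cfp p : continuous (corestr (fr p : forall z, fibre_discs (be p.1) z -> fibre_cacti (be p.1) (f p z))).
  by apply: corestr_cts; exact: he_on_cts (fhe p).
pose m p : Emaps R n := @FibMap _ _ _ (@fibre_discs R n) (@fibre_cacti R n) (be p.1) _ (cfp p).
have mE p : Eo (m p).
  split=> /=.
  - have [h hh] := fhe p; rewrite (_ : corestr _ = corestr h)//.
    by apply: corestr_ext.
  - by move=> i s; exact: (fb p (Some i) s).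
  - by move=> s; exact: (fb p None s).
pose g p : Eo := exist _ (m p) (mem_set (mE p)).
exists g; split=> //.
  apply: cts_sub; change (continuous m); apply: (@adjoint_cts _ _ _ _ _ _ m f) => //=.
  by apply: (cts_comp cbe); cts.
move=> p z h; by rewrite (evE (h : fibre_discs (fm_base (set_val (g p))) z)).
Qed.

End FibrewiseEquivalenceMaps.

(** * Transport of equivalences between nearby fibres *)

(** The direction [bdir] is only continuous where the collar function is
    positive; boundedness makes the weighted term continuous elsewhere. *)
Lemma cts_cutoff {R : realType} (X : topologicalType) (l g : X -> R) :
  continuous l -> (forall x, 0 <= l x) -> (forall x, `|g x| <= 1) ->
  continuous (fun x : [set x | 0 < l x] => g (set_val x)) ->
  continuous (fun x => l x * g x).
Proof.
move=> cl l0 g1 cg x.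
have [lx|lx] := ltP 0 (l x); last first.
  have lx0 : l x = 0 by apply/eqP; rewrite eq_le lx l0.
  apply/cvgrPdist_lt => /= e e0; rewrite lx0 mul0r.
  have : nbhs x [set y | l y < e] by apply: cts_near_lt; rewrite ?lx0.
  apply: filterS => y /= ly; rewrite sub0r normrN normrM ger0_norm//.
  by apply: le_lt_trans ly; rewrite ler_piMr.
apply: cvgM; first exact: cl.
move=> W nW.
pose x' : [set x | 0 < l x] := exist _ x (mem_set (lx : [set x | 0 < l x] x)).
have := cg x' W nW; rewrite /nbhs/= => -[_ [[Q oQ <-] Qx] QW].
have nQ : nbhs x Q by apply: open_nbhs_nbhs.
have nl : nbhs x [set y | 0 < l y] by exact: (cvgr_gt _ (cl x)).
move: nQ nl; apply: filterS2 => y Qy ly.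
by apply: (QW (exist _ y (mem_set (ly : [set x | 0 < l x] y)))).
Qed.

Lemma tau_le1 {R : realType} (x : circle R) : `|tau x| <= 1.
Proof.
rewrite /tau; set s := Num.max _ _.
have s1 : -1 <= s <= 1.
  have h0 : 0 < sin (pi / 6 : R).
    by apply: sin_gt0_pi; have := @pi_gt0 R; lra.
  have h1 := sin_le1 (pi / 6 : R).
  rewrite /s le_max ge_max; apply/andP; split.
    by rewrite lerN2 h1.
  by rewrite ge_min h1 orbT andbT; lra.
have a1 := asin_geNpi2 s1; have a2 := asin_lepi2 s1; have p0 := @pi_gt0 R.
have p20 : 0 < 2 * pi :> R by lra.
by rewrite ler_norml ler_pdivlMr// ler_pdivrMr//; lra.
Qed.

Lemma unit_intervalP {R : realType} (t : @unit_interval R) : 0 <= set_val t <= 1.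
Proof. by have := set_valP t; rewrite /unit_interval/= in_itv. Qed.

Section Slide.
Context {R : realType} {n : nat}.
Local Notation C := (circle R).
Local Notation T := (torus R n).
Implicit Types (x y : C) (u e : R) (w v : T).

(** The point at time [u] of the shortest path from [x] to [y], for close
    [x] and [y]. *)
Definition ell u x y : C := cmul x (circle_exp (u * tau (cmul (cinv x) y))).

Lemma ellxx u x : ell u x x = x.
Proof. by rewrite /ell cVmul tau1 mulr0 cmul1. Qed.

Lemma ell0 x y : ell 0 x y = x.
Proof. by rewrite /ell mul0r cmul1. Qed.

Lemma ell1 x y : cdist x y <= 12^-1 -> ell 1 x y = y.
Proof. by move=> /tauP[e _]; rewrite /ell mul1r e cmulKV. Qed.

Lemma ell_close u e x y : 0 <= u <= 1 -> cdist x y <= e -> e <= 12^-1 ->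
  cdist (ell u x y) x <= e.
Proof.
move=> /andP[u0 u1] h e1; have [_ h'] := tauP (le_trans h e1).
rewrite cdistC; apply: le_trans (cdistM _ _) _.
rewrite normrM h' ger0_norm//; apply: le_trans h.
by rewrite -[leRHS]mul1r ler_wpM2r// cdist_ge0.
Qed.

Lemma cts_ell (X : topologicalType) (u : X -> R) (x y : X -> C) :
  continuous u -> continuous x -> continuous y ->
  continuous (fun p => ell (u p) (x p) (y p)).
Proof.
move=> cu cx cy; apply: ctscmul => //; apply: ctsce; apply: ctsM => //.
by apply: ctstau; apply: ctscmul => //; exact: ctscinv.
Qed.

Definition slide u w v : T := fun k => ell u (w k) (v k).

Lemma slide0 w v : slide 0 w v = w.
Proof. by apply/funext => k; exact: ell0. Qed.

Lemma slidexx u w : slide u w w = w.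
Proof. by apply/funext => k; exact: ellxx. Qed.

Lemma slide1 e w v : tclose e w v -> e <= 12^-1 -> slide 1 w v = v.
Proof. by move=> h e1; apply/funext => k; exact: ell1 (le_trans (h k) e1). Qed.

Lemma slide_close u e w v : 0 <= u <= 1 -> tclose e w v -> e <= 12^-1 ->
  tclose e (slide u w v) w.
Proof. by move=> u1 h e1 k; exact: ell_close. Qed.

Lemma cts_slide (X : topologicalType) (u : X -> R) (w v : X -> T) :
  continuous u -> continuous w -> continuous v ->
  continuous (fun p => slide (u p) (w p) (v p)).
Proof.
move=> cu cw cv; apply: cts_mkprod => k.
by apply: cts_ell => //; exact: cts_torus.
Qed.

End Slide.

Section Transport.
Context {R : realType} {n : nat}.
Local Notation E := (EB R n).
Local Notation D := (disc R).
Local Notation T := (torus R n).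
Local Notation C := (circle R).
Local Notation I := (@unit_interval R).
Local Notation Eo := (Eo R n).
Local Notation Bd := (option 'I_n).
Implicit Types (b : Bd) (z : D) (s : C) (v w : T) (u : R).

Variables (a0 : fDo R n) (c0 : cacti R n) (del : R) (U : set (fDo R n)).
Hypothesis HU : collared a0 del U.

(** The scale of the neighbourhood of cacti: a few moves of this size, each
    amplified by the retraction [rho], stay within the range of [rho]. *)
Let e0 : R := @eps R n / (100 * n.+1%:R).
(** A bound for the displacement by [transport]: the values move by [2 * e0] to
    the blended ones, which are [4 * e0]-close to the target, so that [rho] moves
    them by at most [3 * n.+1 * 4 * e0]. *)
Let d1 : R := 14 * n.+1%:R * e0.

Let N1 : 1 <= n.+1%:R :> R. Proof. by rewrite ler1n. Qed.

Let e0_gt0 : 0 < e0.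
Proof. by rewrite divr_gt0 ?eps_gt0// mulr_gt0// ltr0n. Qed.

Let eps_le4 : @eps R n <= 4^-1.
Proof.
apply: le_trans (@eps_le_eta R n) _; rewrite /eta lef_pV2 ?posrE ?mulr_gt0//.
by rewrite ler_peMr.
Qed.

Let d1E : d1 = 14 / 100 * @eps R n.
Proof.
rewrite /d1 /e0; have : n.+1%:R != 0 :> R by rewrite pnatr_eq0.
by set N := n.+1%:R; move=> N0; field.
Qed.

Let e0_d1 : 14 * e0 <= d1.
Proof. by rewrite /d1 -mulrA ler_pM2l// ler_peMl// ltW. Qed.

Let d1_eps : 2 * d1 <= @eps R n.
Proof. by rewrite d1E; have := @eps_gt0 R n; lra. Qed.

Let d1_12 : 2 * d1 <= 12^-1.
Proof. by rewrite d1E; have := eps_le4; lra. Qed.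

Definition cacti_close (e : R) (c : cacti R n) : Prop :=
  (forall s, tclose e (cacti_fun c s) (cacti_fun c0 s)) /\
  forall i k, k != i -> cdist (lobes c i k) (lobes c0 i k) <= e.

Definition near_pair : set E := [set x | U x.1 /\ cacti_close e0 x.2].

Lemma near_pair_nbhs : nbhs a0 U -> nbhs ((a0, c0) : E) near_pair.
Proof.
move=> nU; exists (U, cacti_close e0) => //=; split=> //=.
have h1 := cacti_near c0 e0_gt0.
have h2 : \forall c \near c0, forall (ik : 'I_n * 'I_n), ik.2 != ik.1 ->
    cdist (lobes c ik.1 ik.2) (lobes c0 ik.1 ik.2) <= e0.
  apply: (@filter_forall _ _ (fun (ik : 'I_n * 'I_n) c => ik.2 != ik.1 ->
    cdist (lobes c ik.1 ik.2) (lobes c0 ik.1 ik.2) <= e0) (nbhs c0)) => -[i k] /=.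
  have [->|ki] := eqVneq k i; first exact: filterE.
  have c : continuous (fun c => cdist (lobes c i k) (lobes c0 i k)).
    by apply: ctscdist; [exact: cts_lobes|exact: cts_cst].
  have : nbhs c0 [set c | cdist (lobes c i k) (lobes c0 i k) < e0].
    by apply: (cts_near_lt c); rewrite cdistxx.
  by apply: filterS => c' /ltW h _.
move: h1 h2; apply: filterS2 => c h1 h2; split=> // i k ki; exact: (h2 (i, k)).
Qed.

Let cbnd_tree (c : cacti R n) b s : tree (lobes c) (cbnd c b s).
Proof. by case: b => [i|]; [exact: cacti_bnd_tree|exact: cacti_fun_tree]. Qed.

Let cfun_close c1 c2 s : cacti_close e0 c1 -> cacti_close e0 c2 ->
  tclose (e0 + e0) (cacti_fun c1 s) (cacti_fun c2 s).
Proof. by move=> [h1 _] [h2 _]; apply: tclose_tri (h1 s) _; exact: tclose_sym. Qed.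

Let cbnd_close c1 c2 b s : cacti_close e0 c1 -> cacti_close e0 c2 ->
  tclose (e0 + e0) (cbnd c1 b s) (cbnd c2 b s).
Proof.
move=> h1 h2; case: b => [i|]; last exact: cfun_close.
move=> k; rewrite /cbnd !cacti_bndE; case: ifPn => ki.
  by rewrite cdistxx addr_ge0// ltW.
have [_ /(_ i k ki) h1'] := h1; have [_ /(_ i k ki) h2'] := h2.
by apply: le_trans (cdist_tri (lobes c0 i k) _ _) _; apply: lerD => //; rewrite cdistC.
Qed.

(** Points are transferred along their common parameter on the source circle. *)
Let cacti_transfer c1 c2 v : cacti_close e0 c1 -> cacti_close e0 c2 ->
  cacti_real c1 v -> exists2 w, tree (lobes c2) w & tclose (e0 + e0) v w.
Proof.
move=> h1 h2 [s _ <-]; exists (cacti_fun c2 s); first exact: cacti_fun_tree.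
exact: cfun_close.
Qed.

Let rho_real c v w e : tree (lobes c) w -> tclose e v w -> e <= @eps R n ->
  cacti_real c (rho (lobes c) v).
Proof.
move=> tw vw e1; rewrite cacti_realE; apply: (rho_in (v := w)) => //.
  exact: lobes_treelike.
exact: tclose_le e1 vw.
Qed.

Lemma cts_cbnd (X : topologicalType) b (c : X -> cacti R n) (s : X -> C) :
  continuous c -> continuous s -> continuous (fun x => cbnd (c x) b (s x)).
Proof.
by move=> cc cs; case: b => [i|]; [exact: cts_cacti_bnd|exact: cts_cacti_fun].
Qed.

(** In the inner collar of a boundary circle, [v] is moved towards the
    prescribed boundary value, which is reached on the circle itself for
    [u = 1]. *)
Definition blend u (x2 : E) z v : T := fun k =>
  cmul (v k) (circle_exp (\sum_b lam a0 del b z *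
    (u * tau (cmul (cinv (v k)) (cbnd x2.2 b (bdir x2.1 b z) k))))).

Lemma blend0 x2 z v : blend 0 x2 z v = v.
Proof.
apply/funext => k; rewrite /blend big1 ?cmul1// => b _.
by rewrite mul0r mulr0.
Qed.

Lemma blend_active u x2 z v b : 0 < lam a0 del b z ->
  blend u x2 z v = slide (u * lam a0 del b z) v (cbnd x2.2 b (bdir x2.1 b z)).
Proof.
move=> lb; apply/funext => k; rewrite /blend /slide /ell (bigD1 b)//= big1 => [|b' bb].
  by rewrite [_ + 0]addr0 mulrA [_ * u]mulrC.
by rewrite (lam_uniq HU lb bb) mul0r.
Qed.

Lemma blend_idle u x2 z v : (forall b, lam a0 del b z <= 0) -> blend u x2 z v = v.
Proof.
move=> h; apply/funext => k; rewrite /blend big1 ?cmul1// => b _.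
by rewrite (_ : lam a0 del b z = 0) ?mul0r//; apply/eqP; rewrite eq_le h clamp_ge0.
Qed.

Lemma cts_blend (X : topologicalType) (u : X -> R) (x2 : X -> E) (z : X -> D) (v : X -> T) :
  (forall x, 0 <= u x <= 1) -> (forall x, U (x2 x).1) ->
  (forall x, discs_real (x2 x).1 (z x)) ->
  continuous u -> continuous x2 -> continuous z -> continuous v ->
  continuous (fun x => blend (u x) (x2 x) (z x) (v x)).
Proof.
move=> u01 Ux zx cu cx cz cv; apply: cts_mkprod => k; rewrite /blend.
have cvk : continuous (fun x => v x k) by exact: cts_torus.
apply: ctscmul => //; apply: ctsce; apply: ctssum => b.
apply: cts_cutoff.
- exact: cts_lam.
- by move=> x; exact: clamp_ge0.
- move=> x; have /andP[h0 h1] := u01 x; rewrite normrM ger0_norm//.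
  by rewrite mulr_ile1// tau_le1.
- have cdir : continuous (fun x : [set x | 0 < lam a0 del b (z x)] =>
      bdir (x2 (set_val x)).1 b (z (set_val x))).
    apply: ctscunit.
      by move=> x; apply: (dcoord_ge HU) => //; exact: (set_valP x).
    have cz' : continuous (fun x : [set x | 0 < lam a0 del b (z x)] => set_val (z (set_val x))).
      by apply: cts_val; apply: (cts_comp cz); cts.
    rewrite /dcoord; case: b cz' => [i|] // cz'.
    apply: ctsrel => //; apply: cts_fst; apply: (cts_comp cx); cts.
  apply: ctsM; first by apply: (cts_comp cu); cts.
  apply: ctstau; apply: ctscmul.
    by apply: ctscinv; apply: (cts_comp cvk); cts.
  apply: (@cts_torus _ _ _ (fun x : [set x | 0 < lam a0 del b (z x)] =>
    cbnd (x2 (set_val x)).2 b (bdir (x2 (set_val x)).1 b (z (set_val x))))).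
  apply: cts_cbnd => //.
  by apply: cts_snd; apply: (cts_comp cx); cts.
Qed.

(** The case of interest is [u = 1]; for [u = 0] the boundary values are not
    corrected and the result is a composite of homotopy equivalences. *)
Definition transport u (x1 x2 : E) (f : D -> T) z : T :=
  rho (lobes x2.2) (blend u x2 z (f (carry a0 del x2.1 x1.1 z))).

Section TransportOne.
Variables (x1 x2 : E) (e : Eo).
Hypotheses (W1 : near_pair x1) (W2 : near_pair x2) (ex : Eo_proj e = x1).

Let value_dbnd z b : discs_real x2.1 z -> 0 < lam a0 del b z ->
  ev e (carry a0 del x2.1 x1.1 z) = cbnd x1.2 b (bdir x2.1 b z).
Proof.
move=> hz lb; have [U1 _] := W1; have [U2 _] := W2.
by rewrite (carry_collar HU U1 U2 hz lb) -ex ev_dbnd.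
Qed.

Let blend_close u z : 0 <= u <= 1 -> discs_real x2.1 z ->
  let v := ev e (carry a0 del x2.1 x1.1 z) in
  tclose (e0 + e0) (blend u x2 z v) v.
Proof.
move=> /andP[u0 u1] hz v; have [U1 C1] := W1; have [U2 C2] := W2.
have [[b lb]|H] := pselect (exists b, 0 < lam a0 del b z); last first.
  rewrite blend_idle; first by move=> k; rewrite cdistxx addr_ge0// ltW.
  by move=> b; rewrite leNgt; apply/negP => lb; apply: H; exists b.
rewrite (blend_active _ _ _ lb); apply: slide_close.
- have l1 : lam a0 del b z <= 1 := clamp_le1 _.
  by rewrite mulr_ge0 ?(ltW lb)//= mulr_ile1// ltW.
- by rewrite /v (value_dbnd hz lb); exact: cbnd_close.
- by have := d1_12; have := e0_d1; have := e0_gt0; lra.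
Qed.

Let value_real z : discs_real x2.1 z ->
  cacti_real x1.2 (ev e (carry a0 del x2.1 x1.1 z)).
Proof.
move=> hz; have [U1 _] := W1; have [U2 _] := W2.
by rewrite -ex; apply: ev_real; rewrite ex; exact: (carry_real HU).
Qed.

Lemma transport_real u z : 0 <= u <= 1 -> discs_real x2.1 z ->
  cacti_real x2.2 (transport u x1 x2 (ev e) z).
Proof.
move=> u01 hz; have [_ C1] := W1; have [_ C2] := W2.
have [w tw vw] := cacti_transfer C1 C2 (value_real hz).
apply: rho_real tw (tclose_tri (blend_close u01 hz) vw) _.
by have := d1_eps; have := e0_d1; have := e0_gt0; lra.
Qed.

Lemma transport_close z : discs_real x2.1 z ->
  tclose d1 (ev e (carry a0 del x2.1 x1.1 z)) (transport 1 x1 x2 (ev e) z).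
Proof.
move=> hz; have [_ C1] := W1; have [_ C2] := W2.
have u01 : 0 <= (1 : R) <= 1 by rewrite ler01 lexx.
have [w tw vw] := cacti_transfer C1 C2 (value_real hz).
have h1 := blend_close u01 hz.
have h2 := rho_close (lobes_treelike x2.2) tw (tclose_tri h1 vw).
have h3 := tclose_tri (tclose_sym h1) (h2 _).
apply: tclose_le (h3 _); last by have := e0_gt0; lra.
rewrite /d1; set N := n.+1%:R; have : 1 <= N := N1.
by have := e0_gt0; nra.
Qed.

Lemma transport_dbnd b s :
  transport 1 x1 x2 (ev e) (dbnd x2.1 b s) = cbnd x2.2 b s.
Proof.
have [U1 C1] := W1; have [U2 C2] := W2.
have l1 := lam_dbnd HU b s U2.
have lb : 0 < lam a0 del b (dbnd x2.1 b s) by rewrite l1.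
rewrite /transport (blend_active _ _ _ lb) l1 mulr1 bdir_dbnd.
rewrite (value_dbnd (dbnd_real _ _ _) lb) bdir_dbnd.
rewrite (slide1 (cbnd_close b s C1 C2)); last first.
  by have := d1_12; have := e0_d1; have := e0_gt0; lra.
by apply: rho_id; [exact: lobes_treelike|exact: cbnd_tree].
Qed.

End TransportOne.

Let e0_12 : 12 * n.+1%:R * e0 <= @eps R n /\ 6 * n.+1%:R * e0 <= 12^-1.
Proof.
have h : 0 < n.+1%:R * e0 by rewrite mulr_gt0.
by move: d1_eps d1_12; rewrite /d1 -!mulrA; split; lra.
Qed.

Let rho_shift c1 c2 w : cacti_close e0 c1 -> cacti_close e0 c2 -> cacti_real c1 w ->
  tclose (6 * n.+1%:R * e0) (rho (lobes c2) w) w.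
Proof.
move=> C1 C2 w1; have [w' tw ww] := cacti_transfer C1 C2 w1.
apply: tclose_sym; have h := rho_close (lobes_treelike c2) tw ww.
apply: tclose_le (h _); last by have := e0_gt0; lra.
by rewrite (_ : _ * (e0 + e0) = 6 * n.+1%:R * e0)//; ring.
Qed.

Let rho_slide_real c1 c2 w u : cacti_close e0 c1 -> cacti_close e0 c2 ->
  0 <= u <= 1 -> cacti_real c1 w ->
  cacti_real c1 (rho (lobes c1) (slide u (rho (lobes c2) w) w)).
Proof.
move=> C1 C2 u01 w1; have [h1 h2] := e0_12.
have h := rho_shift C1 C2 w1.
have tw : tree (lobes c1) w by rewrite -cacti_realE.
apply: rho_real tw (tclose_tri (slide_close u01 h h2) h) _.
by apply: le_trans h1; rewrite -mulrDl -mulrDl; have := e0_gt0; lra.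
Qed.

Let cts_rho (X : topologicalType) (c : X -> cacti R n) (w : X -> T) :
  continuous c -> continuous w -> continuous (fun x => rho (lobes (c x)) (w x)).
Proof.
by move=> cc cw; apply: ctsrho => // i k ki; exact: cts_comp (cts_lobes ki) cc.
Qed.

(** The inverse is the retraction onto [c1]; both composites are close to the
    identity, and [rho] brings the short paths [slide] back into the cactus. *)
Let rho_he c1 c2 : cacti_close e0 c1 -> cacti_close e0 c2 ->
  @he_on R _ _ (cacti_real c1) (cacti_real c2) (rho (lobes c2)).
Proof.
move=> C1 C2; have [h1 h2] := e0_12.
have main c c' : cacti_close e0 c -> cacti_close e0 c' -> [/\
    forall w, cacti_real c w -> cacti_real c' (rho (lobes c') w),
    continuous (fun w : cacti_real c => rho (lobes c') (set_val w)),
    continuous (fun p : cacti_real c * I =>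
      rho (lobes c) (slide (set_val p.2) (rho (lobes c') (set_val p.1)) (set_val p.1))) &
    forall w, cacti_real c w ->
      rho (lobes c) (slide 0 (rho (lobes c') w) w) = rho (lobes c) (rho (lobes c') w) /\
      rho (lobes c) (slide 1 (rho (lobes c') w) w) = w].
  move=> C C'; split.
  - move=> w w1; have [w' tw ww] := cacti_transfer C C' w1.
    apply: rho_real tw ww _.
    by have := d1_eps; have := e0_d1; have := e0_gt0; lra.
  - by apply: cts_rho; cts.
  - apply: cts_rho; first by cts.
    apply: cts_slide; [by cts| |by cts].
    by apply: cts_rho; cts.
  - move=> w w1; rewrite slide0; split=> //.
    rewrite (slide1 (rho_shift C C' w1) h2); apply: rho_id; first exact: lobes_treelike.
    by rewrite -cacti_realE.
have [r1 k1 s1 t1] := main _ _ C1 C2; have [r2 k2 s2 t2] := main _ _ C2 C1.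
apply: (@he_on_intro R _ _ _ _ _ (rho (lobes c1))
  (fun w u => rho (lobes c1) (slide u (rho (lobes c2) w) w))
  (fun w u => rho (lobes c2) (slide u (rho (lobes c1) w) w))) => //.
- by move=> w u u01 w1; exact: rho_slide_real.
- by move=> w u u01 w1; exact: rho_slide_real.
Qed.

(** The inverse is [carry] in the other direction, and [back] provides the
    homotopies. *)
Let carry_he a1 a2 : U a1 -> U a2 ->
  @he_on R _ _ (discs_real a2) (discs_real a1) (carry a0 del a2 a1).
Proof.
move=> U1 U2.
apply: (@he_on_intro R _ _ _ _ _ (carry a0 del a1 a2)
  (fun z u => back a0 del a2 a1 u z) (fun z u => back a0 del a1 a2 u z)).
- by move=> z hz; exact: (carry_real HU).
- by move=> z hz; exact: (carry_real HU).
- by apply: cts_carry; cts.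
- by apply: cts_carry; cts.
- by move=> z u u01 hz; exact: (back_real HU).
- by move=> z u u01 hz; exact: (back_real HU).
- by apply: cts_back; cts.
- by apply: cts_back; cts.
- by move=> z hz; rewrite (back0 HU)// back1.
- by move=> z hz; rewrite (back0 HU)// back1.
Qed.

Lemma cts_transport (X : topologicalType) (u : X -> R) (e : X -> Eo) (x2 : X -> E)
    (z : X -> D) :
  (forall x, 0 <= u x <= 1) -> (forall x, near_pair (Eo_proj (e x))) ->
  (forall x, near_pair (x2 x)) -> (forall x, discs_real (x2 x).1 (z x)) ->
  continuous u -> continuous e -> continuous x2 -> continuous z ->
  continuous (fun x => transport (u x) (Eo_proj (e x)) (x2 x) (ev (e x)) (z x)).
Proof.
move=> u01 W1 W2 hz cu ce cx cz; have cp := cts_Eo_proj ce.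
apply: cts_rho; first by cts.
apply: cts_blend => //; first by move=> x; have [] := W2 x.
apply: cts_ev => //; first by apply: cts_carry => //; cts.
by move=> x; have [U1 _] := W1 x; have [U2 _] := W2 x; exact: (carry_real HU).
Qed.

Lemma transport_he (x1 x2 : E) (e : Eo) : near_pair x1 -> near_pair x2 ->
  Eo_proj e = x1 ->
  @he_on R _ _ (fibre_discs x2) (fibre_cacti x2) (transport 1 x1 x2 (ev e)).
Proof.
move=> W1 W2 ex; have [U1 C1] := W1; have [U2 C2] := W2.
have I01 (t : R) : 0 <= t <= 1 -> 0 <= 1 - t <= 1.
  by move=> /andP[t0 t1]; rewrite subr_ge0 t1/= gerBl.
have h : @he_on R _ _ (fibre_discs x2) (fibre_cacti x2) (transport 0 x1 x2 (ev e)).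
  have h := ev_he e; rewrite ex in h.
  apply: he_on_ext (he_on_comp (carry_he U1 U2) (he_on_comp h (rho_he C1 C2))).
  by move=> z hz; rewrite /transport blend0.
apply: (he_on_ext (f := fun z => transport (1 - 0) x1 x2 (ev e) z)).
  by move=> z _; rewrite subr0.
apply: (@he_on_homotopic R _ _ _ _ (fun z t => transport (1 - t) x1 x2 (ev e) z)).
- by move=> z t /I01 t01 hz; exact: transport_real.
- rewrite -ex in W1 *.
  apply: (cts_transport (e := fun=> e) (x2 := fun=> x2)) => //; try by cts.
    by move=> p; exact: I01 (unit_intervalP _).
  by move=> p; exact: (set_valP p.1).
- by apply: he_on_ext h => z _; rewrite subrr.
Qed.

Lemma transport_lift (Y : topologicalType) (e : Y -> Eo) (x2 : Y -> E) :
  continuous e -> continuous x2 ->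
  (forall y, near_pair (Eo_proj (e y))) -> (forall y, near_pair (x2 y)) ->
  exists g : Y -> Eo, [/\ continuous g, forall y, Eo_proj (g y) = x2 y &
    forall y z, discs_real (x2 y).1 z ->
      ev (g y) z = transport 1 (Eo_proj (e y)) (x2 y) (ev (e y)) z].
Proof.
move=> ce cx W1 W2.
have u01 : 0 <= (1 : R) <= 1 by rewrite ler01 lexx.
pose f (p : Y * I) z := transport 1 (Eo_proj (e p.1)) (x2 p.1) (ev (e p.1)) z.
have [||||g [cg pg fg]] := @Eo_lift R n Y x2 f cx.
- by move=> p z hz; exact: transport_real.
- by move=> p b s; exact: transport_dbnd.
- apply: (cts_transport (u := fun=> 1)
    (e := fun x : [set x : (Y * I) * D | discs_real (x2 x.1.1).1 x.2] => e (set_val x).1.1)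
    (x2 := fun x => x2 (set_val x).1.1)) => //; try by cts.
  + by move=> x; exact: (set_valP x).
  + by apply: (cts_comp ce); cts.
  + by apply: (cts_comp cx); cts.
- by move=> y; exact: transport_he.
exists (fun y => g (y, unit0)); split.
- by apply: (cts_comp cg); cts.
- by move=> y; exact: pg.
- by move=> y z hz; rewrite fg.
Qed.

(** After the round trip a map [f] has become a map close to [f] precomposed
    with the round trip of the domain. The short paths between the values, put
    back into the cactus by [rho], lead to that composite; the paths [back] then
    lead to [f]. *)
Lemma transport_round_trip (Y : topologicalType) (e g g' : Y -> Eo) :
  continuous e -> continuous g -> continuous g' ->
  (forall y, near_pair (Eo_proj (e y))) -> (forall y, near_pair (Eo_proj (g y))) ->
  (forall y, Eo_proj (g' y) = Eo_proj (e y)) ->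
  (forall y z, discs_real (Eo_proj (g y)).1 z ->
     ev (g y) z = transport 1 (Eo_proj (e y)) (Eo_proj (g y)) (ev (e y)) z) ->
  (forall y z, discs_real (Eo_proj (e y)).1 z ->
     ev (g' y) z = transport 1 (Eo_proj (g y)) (Eo_proj (e y)) (ev (g y)) z) ->
  exists H : Y * I -> Eo, [/\ continuous H,
    forall y, H (y, unit0) = g' y, forall y, H (y, unit1) = e y &
    forall p, Eo_proj (H p) = Eo_proj (e p.1)].
Proof.
move=> ce cg cg' W1 W2 g'b eg eg'.
have c1 := cts_Eo_proj ce; have c2 := cts_Eo_proj cg.
pose a1 y := (Eo_proj (e y)).1; pose a2 y := (Eo_proj (g y)).1.
have U1 y : U (a1 y) by have [] := W1 y.
have U2 y : U (a2 y) by have [] := W2 y.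
have ca1 : continuous a1 by rewrite /a1; cts.
have ca2 : continuous a2 by rewrite /a2; cts.
pose kk y z := carry a0 del (a2 y) (a1 y) (carry a0 del (a1 y) (a2 y) z).
have kk_real y z : discs_real (a1 y) z -> discs_real (a1 y) (kk y z).
  by move=> hz; do 2 apply: (carry_real HU) => //.
pose dom := [set x : (Y * I) * D | discs_real (a1 x.1.1) x.2].
have cY (Z : topologicalType) (h : Y -> Z) : continuous h ->
    continuous (fun x : dom => h (set_val x).1.1).
  by move=> ch; apply: (cts_comp ch); cts.
have domP (x : dom) : discs_real (a1 (set_val x).1.1) (set_val x).2 := set_valP x.
(* first, the correction made by the two transports is undone *)
pose f1 (p : Y * I) z := rho (lobes (Eo_proj (e p.1)).2)
  (slide (set_val p.2) (ev (g' p.1) z) (ev (e p.1) (kk p.1 z))).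
(* then, the domain is straightened *)
pose f2 (p : Y * I) z := ev (e p.1) (back a0 del (a1 p.1) (a2 p.1) (set_val p.2) z).
have close y z : discs_real (a1 y) z ->
    tclose (d1 + d1) (ev (g' y) z) (ev (e y) (kk y z)).
  move=> hz; apply: (@tclose_tri _ _ (ev (g y) (carry a0 del (a1 y) (a2 y) z))).
    apply: tclose_sym; rewrite eg'//.
    exact: (transport_close (W2 y) (W1 y) erefl hz).
  have h2 : discs_real (a2 y) (carry a0 del (a1 y) (a2 y) z) by exact: (carry_real HU).
  apply: tclose_sym; rewrite eg//.
  exact: (transport_close (W1 y) (W2 y) erefl h2).
have d_12 : d1 + d1 <= 12^-1 by have := d1_12; lra.
have d_eps : d1 + d1 <= @eps R n by have := d1_eps; lra.
have treeP y z : discs_real (a1 y) z -> tree (lobes (Eo_proj (e y)).2) (ev (e y) z).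
  by move=> hz; rewrite -cacti_realE; exact: ev_real.
have treeP' y z : discs_real (a1 y) z -> tree (lobes (Eo_proj (e y)).2) (ev (g' y) z).
  by move=> hz; rewrite -cacti_realE -g'b; apply: ev_real; rewrite g'b.
have rho_fix y w : tree (lobes (Eo_proj (e y)).2) w ->
    rho (lobes (Eo_proj (e y)).2) w = w.
  by apply: rho_id; exact: lobes_treelike.
have [||||G2 [cG2 pG2 fG2]] := @Eo_lift R n Y (fun y => Eo_proj (e y)) f2 c1.
- move=> p z hz; apply: ev_real.
  exact: (back_real HU (U1 _) (U2 _) hz (unit_intervalP _)).
- by move=> p b s; rewrite /f2 (back_dbnd HU _ _ _ (U1 _) (U2 _)) ev_dbnd.
- apply: cts_ev.
  + exact: cY.
  + by apply: cts_back; [exact: cY|exact: cY|cts|cts].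
  + by move=> x; exact: (back_real HU (U1 _) (U2 _) (domP x) (unit_intervalP _)).
- by move=> y; apply: he_on_ext (ev_he (e y)) => z hz; rewrite /f2 /= back1.
have [||||G1 [cG1 pG1 fG1]] := @Eo_lift R n Y (fun y => Eo_proj (e y)) f1 c1.
- move=> p z hz; have h := slide_close (unit_intervalP p.2) (close _ _ hz) d_12.
  exact: rho_real (treeP' _ _ hz) h d_eps.
- move=> p b s; rewrite /f1 /kk !(carry_dbnd HU _ _ (U1 _) (U2 _), carry_dbnd HU _ _ (U2 _) (U1 _)) ev_dbnd.
  rewrite -[in ev (g' _) _]g'b ev_dbnd g'b slidexx.
  by apply: rho_fix; exact: cbnd_tree.
- apply: cts_rho; first by apply: (cY _ (fun y => (Eo_proj (e y)).2)); cts.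
  apply: cts_slide; first by cts.
    by apply: cts_ev; [exact: cY|cts|move=> x; rewrite g'b; exact: domP].
  apply: cts_ev; first exact: cY.
    apply: cts_carry; [exact: cY|exact: cY|].
    by apply: cts_carry; [exact: cY|exact: cY|cts].
  by move=> x; exact: kk_real.
- move=> y; have h := ev_he (G2 (y, unit0)); rewrite pG2 in h.
  apply: he_on_ext h => z hz; rewrite fG2// /f1 /f2 /=.
  rewrite (slide1 (close _ _ hz) d_12) (back0 HU)// -/(kk y z).
  by apply/esym/rho_fix; exact/treeP/kk_real.
exists (paste G1 G2); split.
- apply: paste_cts => // y; apply: Eo_ext; rewrite !pG1 ?pG2// => z hz.
  rewrite fG1// fG2// /f1 /f2 /= (slide1 (close _ _ hz) d_12) (back0 HU)//.
  by apply: rho_fix; exact/treeP/kk_real.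
- move=> y; rewrite paste0; apply: Eo_ext; rewrite !pG1 ?g'b// => z hz.
  by rewrite fG1// /f1 /= slide0; apply: rho_fix; exact: treeP'.
- move=> y; rewrite paste1; apply: Eo_ext; rewrite !pG2// => z hz.
  by rewrite fG2// /f2 /= back1.
- by move=> p; rewrite /paste; case: ifP => _; rewrite ?pG1 ?pG2.
Qed.

End Transport.

Theorem theoremC (R : realType) (n : nat) (a : fDo R n) (c : cacti R n) :
  exists U : set (EB R n),
    nbhs ((a, c) : EB R n) U /\
    @fibrewise_homotopy_equivalent R (EB R n)
      (Eo_restr U : set (Eo R n))
      ((U : set (EB R n)) * (Map_bnd ((a, c) : EB R n) : set (Eo R n)))%type
      (fun e => Eo_proj (set_val e))
      (fun y => set_val y.1).
Proof.
have [del [U [nU HU]]] := collared_exists a.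
pose W : set (EB R n) := near_pair c U; pose b0 : EB R n := (a, c).
have nW : nbhs b0 W by exact: near_pair_nbhs.
have Wb0 : W b0 by exact: nbhs_singleton nW.
exists W; split=> //.
set X := (Eo_restr W : set (Eo R n)) : topologicalType.
set Y := ((W : set (EB R n)) * (Map_bnd b0 : set (Eo R n)))%type : topologicalType.
have WX (x : X) : W (Eo_proj (set_val x)) by exact: (set_valP x).
have WY (y : Y) : W (set_val y.1) by exact: (set_valP y.1).
have bY (y : Y) : Eo_proj (set_val y.2) = b0 by exact: (set_valP y.2).
have [f [cf pf ef]] : exists f : X -> Eo R n, [/\ continuous f,
    forall x, Eo_proj (f x) = b0 & forall x z, discs_real b0.1 z ->
      ev (f x) z = transport a del 1 (Eo_proj (set_val x)) b0 (ev (set_val x)) z].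
  apply: (transport_lift (c0 := c) HU (x2 := fun=> b0)) => //; cts.
have [g [cg pg eg]] : exists g : Y -> Eo R n, [/\ continuous g,
    forall y, Eo_proj (g y) = set_val y.1 &
    forall y z, discs_real (set_val y.1).1 z ->
      ev (g y) z = transport a del 1 b0 (set_val y.1) (ev (set_val y.2)) z].
  have [||||g [cg pg eg]] := @transport_lift _ _ _ c _ _ HU Y (fun y => set_val y.2) (fun y => set_val y.1).
  - by cts.
  - by cts.
  - by move=> y; rewrite bY.
  - by [].
  exists g; split; [exact: cg|exact: pg|].
  by move=> y z hz; rewrite (eg _ _ hz) bY.
pose phi (x : X) : Y := (exist _ (Eo_proj (set_val x)) (mem_set (WX x)),
  exist _ (f x) (mem_set (pf x : Map_bnd b0 (f x)))).
have Wg y : Eo_restr W (g y) by rewrite /Eo_restr /= pg; exact: WY.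
pose psi (y : Y) : X := exist _ (g y) (mem_set (Wg y)).
have cphi : continuous phi.
  apply: cts_pair; apply: cts_sub.
    by change (continuous (fun x : X => Eo_proj (set_val x))); apply: cts_Eo_proj; cts.
  exact: cf.
have cpsi : continuous psi by apply: cts_sub; exact: cg.
exists phi, psi; split.
- by split; [exact: cphi|].
- by split; [exact: cpsi|exact: pg].
- have [||||||||H [cH H0 H1 pH]] := @transport_round_trip _ _ _ c _ _ HU X
    (fun x => set_val x) f (fun x => g (phi x)).
  + by cts.
  + exact: cf.
  + exact: (cts_comp cg cphi).
  + exact: WX.
  + by move=> x; rewrite pf.
  + by move=> x; rewrite pg.
  + by move=> x z; rewrite pf => hz; exact: ef.
  + by move=> x z hz; rewrite (eg (phi x) z hz) pf.
  have WH p : Eo_restr W (H p) by rewrite /Eo_restr /= pH; exact: WX.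
  exists (fun p => exist _ (H p) (mem_set (WH p))); split.
  + exact: cts_sub.
  + by move=> x; apply: set_val_inj; exact: H0.
  + by move=> x; apply: set_val_inj; exact: H1.
  + by move=> x t; exact: pH.
- have [||||||||H [cH H0 H1 pH]] := @transport_round_trip _ _ _ c _ _ HU Y
    (fun y => set_val y.2) g (fun y => f (psi y)).
  + by cts.
  + exact: cg.
  + exact: (cts_comp cf cpsi).
  + by move=> y; rewrite bY.
  + by move=> y; rewrite pg; exact: WY.
  + by move=> y; rewrite pf bY.
  + by move=> y z; rewrite pg bY => hz; exact: eg.
  + by move=> y z; rewrite bY => hz; rewrite (ef _ _ hz).
  have bH p : Map_bnd b0 (H p) by rewrite /Map_bnd /= pH bY.
  exists (fun p => (p.1.1, exist _ (H p) (mem_set (bH p)))); split.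
  + by apply: cts_pair; [cts|apply: cts_sub].
  + move=> y; congr (_, _); apply: set_val_inj; last exact: H0.
    by rewrite -[RHS]/(Eo_proj (g y)) pg.
  + by move=> [y e]; congr (_, _); apply: set_val_inj; exact: H1.
  + by [].
Qed.
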